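(* There exists an $O(\log n)$-competitive deterministic online algorithm for strong edge-weighted Steiner forest with deadlines which runs in polynomial time, where $n$ is the number of vertices of the input graph.
   Context: Strong edge-weighted Steiner forest with deadlines: given in advance a simple undirected graph $G=(V,E)$ with $|V|=n$ and edge costs $c:E\to\mathbb{R}^+$. Requests arrive over time; each request $q$ is a subset $U_q\subseteq V$ of vertices, released at time $r_q$ with a deadline $d_q$ revealed at release. At any time the algorithm may transmit an edge set $E'\subseteq E$ at cost $\sum_{e\in E'}c(e)$; this serves every pending request $q$ such that all vertices of $U_q$ lie in a single connected component of $(V,E')$. Each request must be served at some time in $[r_q,d_q]$. The cost is the total transmission cost. An online algorithm is $\alpha$-competitive if on every input its cost is at most $\alpha$ times the optimal offline cost. *)

(* Defs.v *)
From HB Require Import structures.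
From mathcomp Require Import all_boot all_order all_algebra.
From mathcomp Require Import all_classical all_reals all_analysis.

Set Implicit Arguments.
Unset Strict Implicit.
Unset Printing Implicit Defensive.

Import Order.TTheory GRing.Theory Num.Theory.
Import numFieldNormedType.Exports.

Local Open Scope classical_set_scope.
Local Open Scope ring_scope.

(** * Strong edge-weighted Steiner forest with deadlines *)

(** A simple graph on the vertices 0, ..., n-1: edges are two-element sets of
    vertices. The values of [cost] outside [edges] are irrelevant. *)
Record network (R : realType) (n : nat) := Network {
  edges : {set {set 'I_n}};
  cost : {set 'I_n} -> R;
  card_edge : forall e, e \in edges -> #|e| = 2%N;
  cost_gt0 : forall e, e \in edges -> 0 < cost e }.

(** The terminal set, the release time and the deadline. *)
Definition request (R : realType) (n : nat) := ({set 'I_n} * R * R)%type.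

Definition terminals (R : realType) (n : nat) (q : request R n) : {set 'I_n} :=
  q.1.1.
Definition release (R : realType) (n : nat) (q : request R n) : R := q.1.2.
Definition deadline (R : realType) (n : nat) (q : request R n) : R := q.2.

(** Finitely many transmissions, each a time and the edge set sent then. *)
Definition schedule (R : realType) (n : nat) := seq (R * {set {set 'I_n}}).

Section Problem.
Variables (R : realType) (n : nat).
Implicit Types (G : network R n) (q : request R n) (qs : seq (request R n)).
Implicit Types (F : {set {set 'I_n}}) (s : schedule R n).

Definition edge_rel F : rel 'I_n := fun x y => [set x; y]%SET \in F.

Definition connects F (U : {set 'I_n}) : Prop :=
  {in U &, forall x y, connect (edge_rel F) x y}.

Definition valid_input qs : Prop :=
  sorted (fun q q' => release q <= release q') qs /\
  all (fun q => release q <= deadline q) qs.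

Definition feasible G qs s : Prop :=
  (forall t F, (t, F) \in s -> F \subset edges G) /\
  (forall q, q \in qs -> exists t F, [/\ (t, F) \in s,
     release q <= t <= deadline q & connects F (terminals q)]).

Definition transmission_cost G F : R := \sum_(e in F) cost G e.

Definition schedule_cost G s : R := \sum_(x <- s) transmission_cost G x.2.

Definition offline_opt G qs : R :=
  inf [set schedule_cost G s | s in [set s | feasible G qs s]].

End Problem.

(** * Deterministic online algorithms *)

(** Each time a request is released, the algorithm maps the network and the
    requests released so far to a plan: the transmissions it will make if no
    further request is released. *)
Definition online_algorithm (R : realType) :=
  forall n : nat, network R n -> seq (request R n) -> schedule R n.

(** The transmissions actually made. The plan computed when [q] is released is
    carried out from that time on, until the next release replaces it. *)
Fixpoint online_run (R : realType) (n : nat)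
    (plan : seq (request R n) -> schedule R n)
    (past future : seq (request R n)) : schedule R n :=
  if future is q :: future' then
    [seq x <- plan (rcons past q) | (release q <= x.1) &&
       all (fun q' => x.1 < release q') future'] ++
    online_run plan (rcons past q) future'
  else [::].

(** Inputs that no schedule can serve (the terminals of some request lie in
    different components of the network) are excluded. *)
Definition competitive (R : realType) (A : online_algorithm R) (n : nat)
    (alpha : R) : Prop :=
  forall (G : network R n) (qs : seq (request R n)),
    valid_input qs -> (exists s, feasible G qs s) ->
    let s := online_run (A n G) [::] qs in
    feasible G qs s /\ schedule_cost G s <= alpha * offline_opt G qs.

(** * Polynomial time *)

(** The machine model is the WHILE language on binary trees, with real numbers
    as additional leaves. Every operation takes time proportional to the size
    of the program text evaluated, whatever the size of the trees (which are
    pointers to shared immutable cells). Arithmetic is limited to the constant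
    1, addition, subtraction, halving and comparison: on rational data, brought
    to a common denominator, each operation adds only O(1) bits to the length
    of a number, so polynomially many steps also take polynomially many bit
    operations. *)
Inductive val (R : realType) := Nil | Num of R | Cons of val R & val R.
Arguments Nil {R}.

Inductive expr :=
| Var of nat
| ENil
| ECons of expr & expr
| EHd of expr
| ETl of expr
| EOne
| EAdd of expr & expr
| ESub of expr & expr
| EHalf of expr
| ELe of expr & expr.

Inductive cmd :=
| Assign of nat & expr
| Seq of cmd & cmd
| If of expr & cmd & cmd
| While of expr & cmd.

Fixpoint expr_size (e : expr) : nat :=
  match e with
  | Var _ | ENil | EOne => 1%N
  | EHd e1 | ETl e1 | EHalf e1 => (expr_size e1).+1
  | ECons e1 e2 | EAdd e1 e2 | ESub e1 e2 | ELe e1 e2 =>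
      (expr_size e1 + expr_size e2).+1%N
  end.

Section Machine.
Variable R : realType.
Notation val := (val R).

Definition store := nat -> val.

Definition update (st : store) (x : nat) (v : val) : store :=
  fun y => if y == x then v else st y.

Definition val_of_bool (b : bool) : val := if b then Num 1 else Nil.

Definition truthy (v : val) : bool := if v is Nil then false else true.

(** Operations applied to arguments of the wrong shape return [Nil]. *)
Fixpoint eval (st : store) (e : expr) : val :=
  match e with
  | Var x => st x
  | ENil => Nil
  | ECons e1 e2 => Cons (eval st e1) (eval st e2)
  | EHd e1 => if eval st e1 is Cons v _ then v else Nil
  | ETl e1 => if eval st e1 is Cons _ v then v else Nil
  | EOne => Num 1
  | EAdd e1 e2 =>
      match eval st e1, eval st e2 with
      | Num a, Num b => Num (a + b) | _, _ => Nil end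
  | ESub e1 e2 =>
      match eval st e1, eval st e2 with
      | Num a, Num b => Num (a - b) | _, _ => Nil end
  | EHalf e1 => if eval st e1 is Num a then Num (a / 2) else Nil
  | ELe e1 e2 =>
      match eval st e1, eval st e2 with
      | Num a, Num b => val_of_bool (a <= b) | _, _ => Nil end
  end.

(** [exec c st t st']: from [st], the command [c] halts in [st'] after time
    [t]. *)
Inductive exec : cmd -> store -> nat -> store -> Prop :=
| ExecAssign x e st :
    exec (Assign x e) st (expr_size e).+1 (update st x (eval st e))
| ExecSeq c1 c2 st1 st2 st3 t1 t2 :
    exec c1 st1 t1 st2 -> exec c2 st2 t2 st3 ->
    exec (Seq c1 c2) st1 (t1 + t2).+1%N st3
| ExecIf e c1 c2 st st' t :
    exec (if truthy (eval st e) then c1 else c2) st t st' ->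
    exec (If e c1 c2) st (expr_size e + t).+1%N st'
| ExecWhileEnd e c st :
    ~~ truthy (eval st e) ->
    exec (While e c) st (expr_size e).+1 st
| ExecWhileStep e c st1 st2 st3 t1 t2 :
    truthy (eval st1 e) ->
    exec c st1 t1 st2 -> exec (While e c) st2 t2 st3 ->
    exec (While e c) st1 (expr_size e + t1 + t2).+1%N st3.

(** Input and output are in variable 0; the other variables start as [Nil]. *)
Definition computes (c : cmd) (v : val) (t : nat) (w : val) : Prop :=
  exists2 st, exec c (update (fun=> Nil) 0%N v) t st & st 0%N = w.

Fixpoint val_size (v : val) : nat :=
  if v is Cons v1 v2 then (val_size v1 + val_size v2).+1%N else 1%N.

Definition val_of_seq (vs : seq val) : val := foldr (@Cons R) Nil vs.

Definition val_of_matrix (n : nat) (f : 'I_n -> 'I_n -> val) : val :=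
  val_of_seq [seq val_of_seq [seq f i j | j <- enum 'I_n] | i <- enum 'I_n].

Definition val_of_network (n : nat) (G : network R n) : val :=
  val_of_matrix (fun i j =>
    if [set i; j]%SET \in edges G then Num (cost G [set i; j]%SET) else Nil).

Definition val_of_request (n : nat) (q : request R n) : val :=
  Cons (val_of_seq [seq val_of_bool (i \in terminals q) | i <- enum 'I_n])
       (Cons (Num (release q)) (Num (deadline q))).

Definition val_of_input (n : nat) (G : network R n)
    (qs : seq (request R n)) : val :=
  Cons (val_of_network G) (val_of_seq [seq val_of_request q | q <- qs]).

Definition val_of_edge_set (n : nat) (F : {set {set 'I_n}}) : val :=
  val_of_matrix (fun i j : 'I_n => val_of_bool ([set i; j]%SET \in F)).

Definition val_of_schedule (n : nat) (s : schedule R n) : val :=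
  val_of_seq [seq Cons (Num x.1) (val_of_edge_set x.2) | x <- s].

(** One program must work for all networks. The output is charged at its full
    size since, subtrees being shared, a short run could otherwise describe a
    plan with exponentially many transmissions. *)
Definition polynomial_time (A : online_algorithm R) : Prop :=
  exists (c : cmd) (p : {poly nat}),
    forall (n : nat) (G : network R n) (qs : seq (request R n)),
      valid_input qs ->
      let v := val_of_input G qs in
      let w := val_of_schedule (A n G qs) in
      exists2 t, computes c v t w & (t + val_size w <= p.[val_size v])%N.

End Machine.

(* Main.v *)
(** Each pending request has a level, initially the cost of a primal-dual
    Steiner forest for it alone. When a deadline expires, the service of the
    expiring request gets twice its level as budget [B]: edges of cost at most
    [B / n^2] are bought outright, and with these for free, the visible
    requests of level below [B] and deadline at most [d] are served as well, for
    the latest [d] at which the primal-dual algorithm spends at most [2 B]. The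
    requests left out are raised to level [B]. A service costs [O(B)].

    If the expiring request was never raised, the optimum pays [Omega(B)]
    between its release and its deadline. Otherwise it was last raised by a
    service of budget [B / 2] which left it out, and serving that request
    together with the earlier deadlines costs the optimum [Omega(B)] between
    the first release among them and the present, even if cheap edges are
    free. Hence the service can be charged to the transmissions [e] of the
    optimum in that window, each to the amount [min(c e, B)] and only if
    [B = O(n^2 c e)]. At any given time, the budgets of the services of either
    kind whose window is open differ pairwise by factors of at least 2, because
    a service raises every visible request of level below its budget. So each
    transmission [e] receives a geometric sum below [c e] plus [O(log n)]
    charges of [c e].

    Levels are real numbers that are never rounded to powers of 2, since the
    ratio of the largest to the smallest cost is not polynomially bounded. *)

Require Import Defs.
From HB Require Import structures.
From mathcomp Require Import all_boot all_order all_algebra.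
From mathcomp Require Import all_classical all_reals all_analysis.
From mathcomp Require Import lra zify.

Set Implicit Arguments.
Unset Strict Implicit.
Unset Printing Implicit Defensive.

Import Order.TTheory GRing.Theory Num.Theory.
Import numFieldNormedType.Exports.

Local Open Scope ring_scope.

(** * Primal-dual Steiner forests *)

(** The algorithm keeps no state between releases: each plan simulates all services from the
    beginning. This is harmless because a service at time [t] looks only at requests released by
    [t], and requests released later have deadlines after [t]. So plans agree up to the next
    release, the executed pieces form the plan for the complete input, and the charging argument
    concerns that single plan.

    The bound [n^2] on the number of edges explains both thresholds. Edges bought outright cost at
    most [B] together, and edges of the optimum of cost at most [B / (8 n^2)] are exempt from
    charging at a total loss of [B / 8]. An edge is then charged only by budgets below [8 n^2] times
    its cost, whatever the spread of the edge costs.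

    Services with a fresh trigger and those with a raised trigger have windows of different origin;
    budgets are compared within each kind only, at the price of a factor 2.

    The primal-dual forest is analysed by local ratio: residual costs decrease along the growth, and
    no dual solution is written down. *)

Section Connectivity.
Variable n : nat.
Implicit Types (F E : {set {set 'I_n}}) (x y u v : 'I_n).

Notation conn F := (connect (edge_rel F)).

Lemma edge_rel_sym F : symmetric (edge_rel F).
Proof. by move=> x y; rewrite /edge_rel finset.setUC. Qed.

Lemma conn_sym F : connect_sym (edge_rel F).
Proof. exact/sym_connect_sym/edge_rel_sym. Qed.

Lemma conn_sub F F' : F \subset F' -> subrel (conn F) (conn F').
Proof.
move=> /fintype.subsetP FF'; apply: connect_sub => x y xy.
by apply: connect1; apply: FF'.
Qed.

Lemma exit_edge F (P : pred 'I_n) x y :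
  conn F x y -> P x -> ~~ P y ->
  exists u v, [/\ [set u; v]%SET \in F, P u & ~~ P v].
Proof.
move=> xy Px Py; apply/not_existsP => noexit.
have cl : closed_mem (edge_rel F) (mem P).
  apply: (intro_closed (conn_sym F)) => u v uv Pu; apply/negPn/negP => Pv.
  by case: (noexit u); exists v.
by move: (closed_connect cl xy); rewrite -!topredE /= Px (negbTE Py).
Qed.

(** A path leaving a component of the remaining edges must use the deleted edge, so if [a] and [b]
    are separated, each is still joined to an end of that edge, and not to the same one. *)
Lemma conn_setD1 F x y a b :
  conn F a b ->
  [\/ conn (F :\ [set x; y]%SET) a b,
      conn (F :\ [set x; y]%SET) a x /\ conn (F :\ [set x; y]%SET) b y |
      conn (F :\ [set x; y]%SET) a y /\ conn (F :\ [set x; y]%SET) b x].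
Proof.
set F' := F :\ _ => ab.
have [abF'|abF'] := boolP (conn F' a b); first by constructor 1.
have one c d : conn F c d -> ~~ conn F' c d -> conn F' c x || conn F' c y.
  move=> cd ncd; have [u [v [uv cu ncv]]] := exit_edge cd (connect0 _ c) ncd.
  have [e_uv|n_uv] := eqVneq [set u; v]%SET [set x; y]%SET; last first.
    case/negP: ncv; apply: connect_trans cu _; apply: connect1.
    by rewrite /edge_rel !inE n_uv.
  have : u \in [set x; y]%SET by rewrite -e_uv set21.
  by rewrite !inE => /orP[]/eqP <-; rewrite cu ?orbT.
have nba : ~~ conn F' b a by rewrite conn_sym.
have ba : conn F b a by rewrite conn_sym.
have {one} := (one _ _ ab abF', one _ _ ba nba).
have no z : conn F' a z -> conn F' b z -> False.
  move=> az bz; case/negP: abF'; apply: connect_trans az _.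
  by rewrite conn_sym.
case=> /orP[ax|ay] /orP[bx|by_].
- by case: (no _ ax bx).
- by constructor 2.
- by constructor 3.
- by case: (no _ ay by_).
Qed.

Definition ncomps F (W : {set 'I_n}) : nat :=
  #|[set fingraph.root (edge_rel F) x | x in W]%SET|.

(** Sending old roots to new roots is onto the new ones and identifies the roots of [u] and [v], so
    it is not injective. *)
Lemma ncompsU1 F (W : {set 'I_n}) u v :
  u \in W -> v \in W -> ~~ conn F u v ->
  (ncomps ([set u; v]%SET |: F) W < ncomps F W)%N.
Proof.
move=> uW vW nuv; set F' := _ |: F.
have rr x : fingraph.root (edge_rel F') (fingraph.root (edge_rel F) x) =
    fingraph.root (edge_rel F') x.
  apply/esym/(fingraph.rootP (conn_sym F')).
  exact: (conn_sub (finset.subsetUr _ _) (connect_root _ _)).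
have -> : ncomps F' W =
    #|[set fingraph.root (edge_rel F') r | r in [set fingraph.root (edge_rel F) x | x in W]]%SET|.
  by rewrite /ncomps -imset_comp; congr #|pred_of_set _|; apply: eq_imset => x /=.
rewrite ltn_neqAle leq_imset_card andbT; apply/negP => /imset_injP inj.
have := inj _ _ (imset_f (fingraph.root (edge_rel F)) uW) (imset_f (fingraph.root (edge_rel F)) vW).
rewrite !rr => same; move/negP: nuv; apply; apply/(fingraph.rootP (conn_sym F)).
apply: same.
apply/(fingraph.rootP (conn_sym F')); apply: connect1.
by rewrite /edge_rel !inE eqxx.
Qed.

End Connectivity.

(** * Minimisers over lists with a fixed tie-breaking rule *)

Section Argmin.
Variables (R : realType) (T : Type).
Implicit Types (P : pred T) (v : T -> R) (l : seq T).

(* Ties are won by the element that comes last in the list. *)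
Definition argmin_seq P v l : option T :=
  foldl (fun s x =>
    if P x && (if s is Some u then v x <= v u else true) then Some x else s)
    None l.

End Argmin.

Lemma argmin_seqP (R : realType) (T : eqType) (P : pred T) (v : T -> R) l :
  match argmin_seq P v l with
  | Some u => [/\ u \in l, P u & {in l, forall x, P x -> v u <= v x}]
  | None => {in l, forall x, ~~ P x}
  end.
Proof.
elim/last_ind: l => [|l x]; first by move=> ?; rewrite in_nil.
rewrite /argmin_seq foldl_rcons; case: foldl => [u|] /=.
  move=> [ul Pu umin]; case: (boolP (P x)) => [Px|nPx] /=; last first.
    split=> [|//|y]; first by rewrite mem_rcons inE ul orbT.
    rewrite mem_rcons inE => /orP[/eqP ->|]; last exact: umin.
    by rewrite (negbTE nPx).
  case: leP => xu.
    split=> [|//|y]; first by rewrite mem_rcons inE eqxx.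
    rewrite mem_rcons inE => /orP[/eqP -> //|yl Py].
    exact: le_trans xu (umin _ yl Py).
  split=> [|//|y]; first by rewrite mem_rcons inE ul orbT.
  by rewrite mem_rcons inE => /orP[/eqP -> _|]; [exact: ltW|exact: umin].
move=> nP; case: (boolP (P x)) => [Px|nPx] /=.
  split=> [|//|y]; first by rewrite mem_rcons inE eqxx.
  rewrite mem_rcons inE => /orP[/eqP -> //|yl].
  by rewrite (negbTE (nP _ yl)).
by move=> y; rewrite mem_rcons inE => /orP[/eqP ->|/nP].
Qed.

(** * Moat growing, pruning, and the approximation factor 2 *)

Section PrimalDual.
Variables (R : realType) (n : nat).
Implicit Types (F E : {set {set 'I_n}}) (e : {set 'I_n}) (x y u v : 'I_n).
Implicit Types (w : {set 'I_n} -> R) (D : rel 'I_n).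
Implicit Type st : {set {set 'I_n}} * ({set 'I_n} -> R).

Notation conn F := (connect (edge_rel F)).
Notation rt F := (fingraph.root (edge_rel F)).

(** Edges are searched as ordered pairs, each twice and with the diagonal included, so that a
    program working on adjacency matrices can follow the same order. *)
Definition pairs : seq ('I_n * 'I_n) :=
  [seq (x, y) | x <- enum 'I_n, y <- enum 'I_n].

Lemma mem_pairs p : p \in pairs.
Proof.
by case: p => x y; apply/allpairsP; exists (x, y); rewrite !mem_enum.
Qed.

Definition act D F x : bool :=
  [exists a, exists b, [&& D a b, conn F x a & ~~ conn F x b]].

Definition crossing F e : bool :=
  [exists x, exists y, [&& x \in e, y \in e & ~~ conn F x y]].

(* The rate at which the moats around active components consume the edge. *)
Definition load D F e : nat :=
  (if crossing F e then \sum_(x in e) act D F x else 0)%N.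

Definition candidate E D F x y : bool :=
  [&& [set x; y]%SET \in E, ~~ conn F x y & act D F x || act D F y].

Definition tight_time D F w x y : R :=
  if act D F x && act D F y then w [set x; y]%SET / 2 else w [set x; y]%SET.

(** All moats grow until the first edge goes tight. Only the residual costs are stored; the dual is
    implicit in the amounts subtracted. *)
Definition grow_step E D (st : {set {set 'I_n}} * ({set 'I_n} -> R)) :=
  if argmin_seq (fun p => candidate E D st.1 p.1 p.2)
       (fun p => tight_time D st.1 st.2 p.1 p.2) pairs is Some p
  then ([set p.1; p.2]%SET |: st.1,
        fun e => st.2 e - tight_time D st.1 st.2 p.1 p.2 *+ load D st.1 e)
  else st.

Definition satisfies D F : bool :=
  [forall x, forall y, D x y ==> conn F x y].

(** One pass in any order yields a minimal solution: supersets of solutions are solutions, so an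
    edge that cannot be dropped when examined cannot be dropped later either. *)
Definition prune D F : {set {set 'I_n}} :=
  foldl (fun F' p =>
    let F'' := F' :\ [set p.1; p.2]%SET in
    if satisfies D F'' then F'' else F') F pairs.

(** Every step that changes the edge set merges two components, so no candidate can remain after
    [n.+1] steps. *)
Definition grow E w D := iter n.+1 (grow_step E D) (finset.set0, w).

Definition steiner E w D : {set {set 'I_n}} := prune D (grow E w D).1.

Lemma satisfiesP D F :
  reflect (forall x y, D x y -> conn F x y) (satisfies D F).
Proof.
apply: (iffP forallP) => [DF x y Dxy|DF x].
  by move/forallP/(_ y)/implyP: (DF x); apply.
by apply/forallP => y; apply/implyP/DF.
Qed.

Lemma satisfies_connect D F x y : satisfies D F -> D x y -> conn F x y.
Proof. by move=> /satisfiesP; apply. Qed.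

Lemma satisfiesS D F F' : F \subset F' -> satisfies D F -> satisfies D F'.
Proof.
by move=> FF' /satisfiesP DF; apply/satisfiesP => x y /DF; apply: conn_sub.
Qed.

Lemma act_conn D F x y : conn F x y -> act D F x = act D F y.
Proof.
move=> xy; rewrite /act; apply: eq_existsb => a; apply: eq_existsb => b.
by rewrite !(same_connect (@conn_sym _ F) xy).
Qed.

Lemma actP D F x :
  reflect (exists a b, [/\ D a b, conn F x a & ~~ conn F x b]) (act D F x).
Proof.
apply: (iffP existsP) => [[a /existsP[b /and3P[? ? ?]]]|[a [b [? ? ?]]]].
  by exists a, b.
by exists a; apply/existsP; exists b; apply/and3P.
Qed.

Lemma crossing2 F x y : crossing F [set x; y]%SET = ~~ conn F x y.
Proof.
apply/existsP/idP => [[u /existsP[v /and3P[]]]|nxy]; last first.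
  by exists x; apply/existsP; exists y; rewrite !inE !eqxx orbT.
rewrite !inE => /orP[]/eqP -> /orP[]/eqP ->; rewrite ?connect0 //.
by rewrite conn_sym.
Qed.

Lemma load2 D F x y :
  load D F [set x; y]%SET = if ~~ conn F x y then (act D F x + act D F y)%N else 0%N.
Proof.
rewrite /load crossing2; case: ifP => // nxy.
have xy : x != y by apply: contraNneq nxy => ->; exact: connect0.
by rewrite big_setU1 ?inE //= big_set1.
Qed.

Lemma card2_pair e : #|e| = 2%N -> exists x y, e = [set x; y]%SET /\ x != y.
Proof.
move=> e2; have /cards2P[x [y [xy ->]]] : #|e| == 2%N by rewrite e2.
by exists x, y.
Qed.

Section Run.
Variables (E : {set {set 'I_n}}) (D : rel 'I_n).
Hypothesis E2 : forall e, e \in E -> #|e| = 2%N.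
Hypothesis Dsym : symmetric D.

Definition residual_ok (st : {set {set 'I_n}} * ({set 'I_n} -> R)) : Prop :=
  [/\ st.1 \subset E, forall e, e \in E -> 0 <= st.2 e &
      forall e, e \in st.1 -> st.2 e = 0].

Inductive grow_step_spec (st : {set {set 'I_n}} * ({set 'I_n} -> R)) :
    {set {set 'I_n}} * ({set 'I_n} -> R) -> Prop :=
| GrowStepNone of (forall x y, ~~ candidate E D st.1 x y) :
    grow_step_spec st st
| GrowStepSome x y of candidate E D st.1 x y &
    (forall u v, candidate E D st.1 u v ->
       tight_time D st.1 st.2 x y <= tight_time D st.1 st.2 u v) :
    grow_step_spec st ([set x; y]%SET |: st.1,
        fun e => st.2 e - tight_time D st.1 st.2 x y *+ load D st.1 e).

Lemma grow_stepP st : grow_step_spec st (grow_step E D st).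
Proof.
rewrite /grow_step; set P := fun p => candidate _ _ _ _ _.
have := argmin_seqP P (fun p => tight_time D st.1 st.2 p.1 p.2) pairs.
case: argmin_seq => [[x y]|].
  case=> _ Pxy xymin; apply: GrowStepSome => // u v uv.
  by apply: (xymin (u, v)) => //; exact: mem_pairs.
move=> nP; apply: GrowStepNone => x y.
by apply: (nP (x, y)); exact: mem_pairs.
Qed.

Lemma tight_time_load F w x y : candidate E D F x y ->
  tight_time D F w x y *+ load D F [set x; y]%SET = w [set x; y]%SET.
Proof.
case/and3P=> _ nxy; rewrite load2 nxy /tight_time.
case: (act D F x); case: (act D F y) => //= _.
by rewrite mulr2n -splitr.
Qed.

Lemma load_gt0 F x y : [set x; y]%SET \in E ->
  (0 < load D F [set x; y]%SET)%N -> candidate E D F x y.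
Proof.
move=> xyE; rewrite load2 /candidate xyE /=; case: ifP => // _.
by case: (act D F x); case: (act D F y).
Qed.

Lemma tight_time_ge0 F w x y : (forall e, e \in E -> 0 <= w e) ->
  candidate E D F x y -> 0 <= tight_time D F w x y.
Proof.
move=> w0 /and3P[/w0 wxy _ _]; rewrite /tight_time; case: ifP => // _.
exact: divr_ge0.
Qed.

Lemma load_member F e : #|e| = 2%N -> e \in F -> load D F e = 0%N.
Proof.
move=> /card2_pair[x [y [-> _]]] xyF.
by rewrite load2 (connect1 (xyF : edge_rel F x y)).
Qed.

(** Every edge of positive load is a candidate, and the chosen one goes tight first, so no residual
    becomes negative. Edges bought earlier lie inside a component and carry no load. *)
Lemma residual_step st : residual_ok st -> residual_ok (grow_step E D st).
Proof.
move=> [FE w0 wF]; case: grow_stepP => // x y cxy xymin.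
have /and3P[xyE _ _] := cxy.
have t0 := tight_time_ge0 w0 cxy.
split=> [|e eE|e] /=.
- by rewrite finset.subUset finset.sub1set xyE.
- rewrite subr_ge0; have [x' [y' [e_xy _]]] := card2_pair (E2 eE).
  have [l0|lpos] := posnP (load D st.1 e); first by rewrite l0 mulr0n w0.
  rewrite e_xy in eE lpos *.
  have cxy' := load_gt0 eE lpos.
  by rewrite -[leRHS](tight_time_load st.2 cxy') lerMn2r xymin ?orbT.
- rewrite !inE => /orP[/eqP ->|eF]; first by rewrite tight_time_load // subrr.
  rewrite load_member ?mulr0n ?subr0 ?wF //.
  by apply: E2; move/fintype.subsetP: FE; apply.
Qed.

Lemma residual_iter m st :
  residual_ok st -> residual_ok (iter m (grow_step E D) st).
Proof. by move=> st_ok; elim: m => //= m; exact: residual_step. Qed.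

Lemma grow_stepS st : st.1 \subset (grow_step E D st).1.
Proof. by case: grow_stepP => //= x y _ _; exact: finset.subsetUr. Qed.

Lemma grow_iterS m st : st.1 \subset (iter m (grow_step E D) st).1.
Proof.
elim: m => //= m IH; apply: fintype.subset_trans IH _; exact: grow_stepS.
Qed.

(* Each edge of [F'] added after [st] joins two components of [F'] that touch
   [W], so there are at most as many such edges as components to begin with. *)
Lemma forest_bound m st (F' : {set {set 'I_n}}) (W : {set 'I_n}) :
  {in F' :\: st.1, forall e, e \subset W} ->
  let st' := iter m (grow_step E D) st in
  (#|(F' :&: st'.1) :\: st.1| + ncomps (st.1 :|: (F' :&: st'.1)) W
     <= ncomps st.1 W)%N.
Proof.
move=> F'W; elim: m => [|m IH] /=.
  have -> : ((F' :&: st.1) :\: st.1 = finset.set0)%SET.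
    by apply/setP => e; rewrite !inE andbCA andNb andbF.
  rewrite cards0 add0n finset.setUC.
  by rewrite (finset.setUidPr _) // finset.subsetIr.
set st' := iter _ _ _ in IH *.
have st_st' : st.1 \subset st'.1 by exact: grow_iterS.
case: (grow_stepP st') => [//|x y /and3P[_ nxy _] _] /=.
set e := [set x; y]%SET.
have neF : e \notin st'.1.
  by apply: contra nxy => eF; exact: connect1.
have [eF'|eF'] := boolP (e \in F'); last first.
  rewrite (_ : F' :&: (e |: st'.1) = F' :&: st'.1) //.
  apply/setP => e'; rewrite !inE; have [->|//] := eqVneq e' e.
  by rewrite (negbTE eF').
have neF1 : e \notin st.1.
  by apply: contra neF; exact/fintype.subsetP.
have -> : F' :&: (e |: st'.1) = e |: (F' :&: st'.1).
  apply/setP => e'; rewrite !inE; have [->|//] := eqVneq e' e.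
  by rewrite eF'.
rewrite finset.setUCA finset.setDUl.
have -> : [set e]%SET :\: st.1 = [set e]%SET.
  by apply/setP => e'; rewrite !inE; case: eqP => [->|]; rewrite ?neF1 ?andbF.
rewrite cardsU1 !inE neF1 (negbTE neF) andbF /=.
have /fintype.subsetP eW : e \subset W by apply: F'W; rewrite !inE neF1.
apply: leq_trans IH; rewrite -addnA addnCA leq_add2l.
apply: ncompsU1; [by apply: eW; rewrite set21|by apply: eW; rewrite set22|].
apply: contra nxy; apply: conn_sub; apply/fintype.subsetP => e'.
by rewrite !inE => /orP[/(fintype.subsetP st_st')//|/andP[]].
Qed.

(** With an unmet demand [a], [b], some edge of [Fs] would leave the component of [a]; this
    component is active, so the edge would still be a candidate. *)
Lemma grow_satisfies w (Fs : {set {set 'I_n}}) :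
  Fs \subset E -> satisfies D Fs -> satisfies D (grow E w D).1.
Proof.
move=> FsE /satisfiesP DFs; set st := grow E w D.
have nocand : forall x y, ~~ candidate E D st.1 x y.
  (* As long as there are candidates, each step adds a new edge; [n.+1] such steps would make a
     forest with [n.+1] edges on [n] vertices. *)
  have H k : let st := iter k (grow_step E D) (finset.set0, w) in
      (forall x y, ~~ candidate E D st.1 x y) \/ #|st.1| = k.
    elim: k => [|k] /=; first by right; rewrite cards0.
    set st' := iter _ _ _; case: grow_stepP => [nc _|x y cxy _ [nc|ck]].
    - by left.
    - by move: (nc x y); rewrite cxy.
    right; rewrite /= cardsU1 ck (_ : _ \notin _) //.
    by case/and3P: cxy => _ nxy _; apply: contra nxy => eF; exact: connect1.
  have [//|cn] := H n.+1.
  have := @forest_bound n.+1 (finset.set0, w) [set: _]%SET [set: _]%SET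
    (fun _ _ => finset.subsetT _).
  cbv zeta; rewrite -[iter _ _ _]/st finset.setTI finset.setD0.
  rewrite [#|_|]cn => /(leq_trans (leq_addr _ _)).
  by move/leq_trans/(_ (leq_imset_card _ _)); rewrite cardsT card_ord ltnn.
apply/satisfiesP => a b Dab; apply/negPn/negP => nab.
have [u [v [uvF au nav]]] := exit_edge (DFs _ _ Dab) (connect0 _ a) nab.
case/negP: (nocand u v); apply/and3P; split.
- exact: (fintype.subsetP FsE).
- by apply: contra nav; exact: connect_trans.
- by rewrite -(act_conn D au); apply/orP; left; apply/actP; exists a, b.
Qed.

Definition active_roots D F : {set 'I_n} :=
  [set rt F x | x in [set x | act D F x]]%SET.

Lemma sum_eq_mem (A : {set 'I_n}) y : (\sum_(r in A) (y == r) = (y \in A))%N.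
Proof.
have [yA|yA] := boolP (y \in A); last first.
  by apply: big1 => r rA; case: eqP yA => // ->; rewrite rA.
rewrite (bigD1 y) //= eqxx big1 // => r /andP[_ ry].
by rewrite eq_sym (negbTE ry).
Qed.

Definition minimal_solution D F : Prop :=
  satisfies D F /\ forall e, e \in F -> ~~ satisfies D (F :\ e).

(* Contracting the components of [F] turns the crossing edges of [F'] into a
   forest all of whose leaves are active, so the active degrees sum to at most
   twice the number of active components. *)
Lemma load_upper_bound m st (F' : {set {set 'I_n}}) :
  st.1 \subset E -> F' \subset (iter m (grow_step E D) st).1 -> F' \subset E ->
  minimal_solution D F' ->
  (\sum_(e in F') load D st.1 e <= 2 * #|active_roots D st.1|)%N.
Proof.
move=> FE F'm /fintype.subsetP F'E [/satisfiesP DF' minF']; set F := st.1 in FE *.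
pose H := [set e in F' | crossing F e]%SET.
pose W := finset.cover H.
pose T := [set rt F x | x in W]%SET.
pose I := [set r in T | ~~ act D F r]%SET.
have HF' e : e \in H -> e \in F' by rewrite inE => /andP[].
have H2 e : e \in H -> exists x y, e = [set x; y]%SET /\ ~~ conn F x y.
  rewrite inE => /andP[eF' ce].
  have [x [y [e_xy _]]] := card2_pair (E2 (F'E _ eF')).
  by exists x, y; rewrite e_xy -crossing2 -e_xy.
have eW e x : e \in H -> x \in e -> x \in W.
  by move=> eH xe; apply/bigcupP; exists e.
have HF : H :\: F = H.
  apply/setP => e; rewrite finset.in_setD.
  case: (boolP (e \in H)) => [eH|]; last by rewrite andbF.
  rewrite andbT; apply/negP => eF; have [x [y [e_xy /negP[]]]] := H2 _ eH.
  by apply: connect1; rewrite /edge_rel -e_xy.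
have HT : (#|H| <= #|T|)%N.
  have := @forest_bound m st H W; cbv zeta; rewrite -/F.
  rewrite HF.
  have -> : H :&: (iter m (grow_step E D) st).1 = H.
    apply/finset.setIidPl; apply: fintype.subset_trans F'm.
    by apply/fintype.subsetP.
  rewrite HF => fb; apply: leq_trans (leq_addr _ _) (fb _) => e eH.
  by apply/fintype.subsetP => x; exact: eW.
have degI r : r \in I -> (2 <= \sum_(e in H) \sum_(x in e) (rt F x == r))%N.
  rewrite inE => /andP[/imsetP[x0 /bigcupP[e eH x0e] rx0] nact].
  have [x [y [e_xy nxy rx]]] : exists x y,
      [/\ e = [set x; y]%SET, ~~ conn F x y & r = rt F x].
    have [x [y [e_xy nxy]]] := H2 _ eH.
    move: x0e; rewrite e_xy !inE => /orP[]/eqP x0_.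
      by exists x, y; rewrite rx0 x0_.
    exists y, x; split; [by rewrite finset.setUC|by rewrite conn_sym|].
    by rewrite rx0 x0_.
  have mem1 e' x' : e' \in H -> x' \in e' -> rt F x' = r ->
      (0 < \sum_(x in e') (rt F x == r))%N.
    by move=> _ xe' rx'; rewrite (bigD1 x') //= rx' eqxx.
  (* Minimality gives a demand [a], [b] that needs [e]. By inactivity the component of [x] cannot
     contain just one of them. If [a] is outside, the path from [x] to [a] avoiding [e] leaves the
     component; if both are inside, the path from [b] to [y] does. It leaves through a second
     crossing edge. *)
  have [e' [x' [e'H e'e x'e' rx']]] : exists e' x',
      [/\ e' \in H, e' != e, x' \in e' & rt F x' = r].
    have /forallPn[a /forallPn[b]] := minF' _ (HF' _ eH).
    rewrite negb_imply => /andP[Dab nab].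
    wlog [ax by_] : a b Dab nab / conn (F' :\ e) a x /\ conn (F' :\ e) b y.
      move=> wl; have [|[ax by_]|[ay bx]] := @conn_setD1 _ F' x y a b (DF' _ _ Dab).
      - by rewrite -e_xy (negbTE nab).
      - by apply: (wl a b); rewrite // e_xy.
      - by apply: (wl b a); rewrite ?(Dsym b) // ?e_xy // conn_sym -e_xy.
    have exit c d : conn (F' :\ e) c d -> conn F x c -> ~~ conn F x d ->
        exists e' x', [/\ e' \in H, e' != e, x' \in e' & rt F x' = r].
      move=> cd xc nxd; have [u [v [uv xu nxv]]] := exit_edge cd xc nxd.
      move: uv; rewrite finset.in_setD1 => /andP[ne uv].
      exists [set u; v]%SET, u; split; rewrite ?set21 //.
        rewrite inE uv crossing2; apply: contra nxv; exact: connect_trans.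
      by rewrite rx; apply/esym/(fingraph.rootP (@conn_sym _ F)).
    have [xa|nxa] := boolP (conn F x a); last first.
      by apply: (exit x a) => //; rewrite conn_sym.
    have [xb|nxb] := boolP (conn F x b); first exact: (exit b y).
    case/negP: nact; rewrite rx -(act_conn D (connect_root _ x)).
    by apply/actP; exists a, b.
  have xe : x \in e by rewrite e_xy set21.
  rewrite (bigD1 e) //= (bigD1 e') /=; last by rewrite e'H.
  rewrite addnA; apply: leq_trans (leq_addr _ _).
  exact: (leq_add (mem1 _ _ eH xe (esym rx)) (mem1 _ _ e'H x'e' rx')).
have HI : (\sum_(e in H) \sum_(x in e) ~~ act D F x >= 2 * #|I|)%N.
  apply: (@leq_trans (\sum_(r in I) \sum_(e in H) \sum_(x in e) (rt F x == r))%N).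
    rewrite mulnC -sum_nat_const; apply: leq_sum => r; exact: degI.
  rewrite exchange_big /=; apply: leq_sum => e eH.
  rewrite exchange_big /=; apply: leq_sum => x xe.
  rewrite sum_eq_mem (act_conn D (connect_root _ x)).
  by case: (boolP (_ \in I)) => //; rewrite inE => /andP[_ ->].
have H12 : (\sum_(e in H) \sum_(x in e) act D F x +
            \sum_(e in H) \sum_(x in e) ~~ act D F x = 2 * #|H|)%N.
  rewrite -big_split /= mulnC -sum_nat_const; apply: eq_bigr => e eH.
  rewrite -big_split /= -(E2 (F'E _ (HF' _ eH))) -sum1_card.
  by apply: eq_bigr => x _; case: (act D F x).
have -> : (\sum_(e in F') load D F e = \sum_(e in H) \sum_(x in e) act D F x)%N.
  rewrite [RHS](eq_bigl (fun e => (e \in F') && crossing F e)).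
    by rewrite big_mkcondr.
  by move=> e; rewrite inE.
have cT : (#|T| = #|[set r in T | act D F r]%SET| + #|I|)%N.
  rewrite -(cardsID [set r | act D F r]%SET T); congr (_ + _)%N; apply: eq_card => r.
    by rewrite !inE.
  by rewrite !inE andbC.
have cA : (#|[set r in T | act D F r]%SET| <= #|active_roots D F|)%N.
  apply: subset_leq_card; apply/fintype.subsetP => r; rewrite inE => /andP[].
  move=> /imsetP[x _ ->]; rewrite -(act_conn D (connect_root _ x)) => ax.
  by apply: imset_f; rewrite inE.
(* Active endpoints are [2 * #|H|] minus the inactive ones. By [HT] and [HI] this is at most
   [2 * (#|T| - #|I|)], twice the active members of [T]. *)
rewrite -(leq_add2r (\sum_(e in H) \sum_(x in e) ~~ act D F x)) H12.
apply: leq_trans (leq_add (leqnn _) HI); rewrite -mulnDr leq_mul2l /=.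
by apply: leq_trans HT _; rewrite cT leq_add2r.
Qed.

(** An active component separates a demand pair, so [Fs] has an edge leaving it, and this edge has
    an active end there. Distinct components use distinct ends. *)
Lemma load_lower_bound F (Fs : {set {set 'I_n}}) : satisfies D Fs ->
  (#|active_roots D F| <= \sum_(e in Fs) load D F e)%N.
Proof.
move=> /satisfiesP DFs.
apply: (@leq_trans (\sum_(r in active_roots D F) \sum_(e in Fs)
    (if crossing F e then \sum_(x in e) act D F x * (rt F x == r) else 0)%N)%N).
  rewrite -sum1_card; apply: leq_sum => r /imsetP[x]; rewrite inE => /actP.
  case=> a [b [Dab xa nxb]] ->.
  have [u [v [uvF xu nxv]]] := exit_edge (DFs _ _ Dab) xa nxb.
  have nuv : ~~ conn F u v by apply: contra nxv; exact: connect_trans.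
  rewrite (bigD1 [set u; v]%SET) //= crossing2 nuv.
  rewrite (bigD1 u) ?set21 //= -(act_conn D xu).
  rewrite (_ : act D F x = true); last by apply/actP; exists a, b.
  rewrite (_ : rt F u == rt F x) //.
  by apply/eqP/esym/(fingraph.rootP (@conn_sym _ F)).
rewrite exchange_big /=; apply: leq_sum => e _; rewrite /load.
case: ifP => _; last by rewrite big1.
rewrite exchange_big /=; apply: leq_sum => x _.
rewrite -big_distrr /= sum_eq_mem; case: (act D F x) => //.
by rewrite mul1n; case: (_ \in _).
Qed.

(** Induction on the growth steps still to come, with the final solution [F'] fixed. At the end [F']
    has residual 0; undoing a step adds to the cost of [F'] at most twice what it adds to the cost
    of [Fs], as both loads are compared with the number of active components. *)
Lemma residual_approx m st (F' Fs : {set {set 'I_n}}) :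
  residual_ok st -> F' \subset (iter m (grow_step E D) st).1 ->
  minimal_solution D F' -> Fs \subset E -> satisfies D Fs ->
  \sum_(e in F') st.2 e <= 2 * \sum_(e in Fs) st.2 e.
Proof.
move=> st_ok F'm minF' FsE DFs; have sE := fintype.subsetP.
have F'E : F' \subset E.
  by apply: fintype.subset_trans F'm _; have [] := residual_iter m st_ok.
elim: m st st_ok F'm => [|m IH] st st_ok F'm.
  have [_ w0 wF] := st_ok; rewrite big1 => [|e eF'].
    by rewrite mulr_ge0 // sumr_ge0 // => e /(sE _ _ _ FsE)/w0.
  exact/wF/(sE _ _ _ F'm).
have lub := load_upper_bound (m := m.+1) _ F'm F'E minF'.
have {IH} := IH _ (residual_step st_ok); rewrite -iterSr => /(_ F'm).
case: grow_stepP => [nc //|x y cxy xymin] /=.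
have [FE w0 _] := st_ok.
have llb := load_lower_bound st.1 DFs.
have t0 := tight_time_ge0 w0 cxy.
set t := tight_time _ _ _ _ _ in t0 *.
rewrite !sumrB !sumrMnr mulrBr => IH.
have : t *+ (\sum_(e in F') load D st.1 e) <=
       t *+ (2 * \sum_(e in Fs) load D st.1 e).
  by apply: ler_wpMn2l => //; apply: leq_trans (lub FE) _; rewrite leq_mul2l.
rewrite mulrnA -[_ *+ 2]mulr_natl -mulrnAr => ut.
by have := lerD IH ut; rewrite !subrK.
Qed.

Lemma steinerP w (Fs : {set {set 'I_n}}) :
  (forall e, e \in E -> 0 <= w e) -> Fs \subset E -> satisfies D Fs ->
  let F := steiner E w D in
  [/\ F \subset E, satisfies D F &
      \sum_(e in F) w e <= 2 * \sum_(e in Fs) w e].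
Proof.
move=> w0 FsE DFs; cbv zeta.
have st_ok : residual_ok (finset.set0, w).
  by split=> [|//|e]; [exact: finset.sub0set|rewrite inE].
have [FE _ _] := residual_iter n.+1 st_ok; rewrite -/(grow E w D) in FE.
have DF := grow_satisfies w FsE DFs.
have [FF minF] : steiner E w D \subset (grow E w D).1 /\
    minimal_solution D (steiner E w D).
  rewrite /steiner /prune.
  set body := fun _ _ => _; move: (grow E w D).1 DF FE => F0 DF0 F0E.
  have sub l F : foldl body F l \subset F.
    elim: l F => //= p l IH F; apply: fintype.subset_trans (IH _) _.
    by rewrite /body; case: ifP => // _; exact: finset.subsetDl.
  have sat l F : satisfies D F -> satisfies D (foldl body F l).
    by elim: l F => //= p l IH F DF'; apply: IH; rewrite /body; case: ifP.
  split; first exact: sub.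
  split=> [|e]; first exact: sat.
  (* An edge that survives was indispensable when its pair was examined, hence is so in the smaller
     final set. *)
  have key l F : satisfies D F -> forall x y, (x, y) \in l ->
      [set x; y]%SET \in foldl body F l ->
      ~~ satisfies D (foldl body F l :\ [set x; y]%SET).
    elim: l F => //= p l IH F DF' x y; rewrite inE => /orP[/eqP xy|]; last first.
      by apply: IH; rewrite /body; case: ifP.
    rewrite {2 4}/body -xy /=; case: ifP => [_ |/negbT nD _].
      by move/(fintype.subsetP (sub l _)); rewrite !inE eqxx.
    by apply: contra nD; apply: satisfiesS; exact/finset.setSD/sub.
  move=> eF; have eE : e \in E.
    by apply: (fintype.subsetP F0E); apply: (fintype.subsetP (sub pairs F0)).
  have [x [y [e_xy _]]] := card2_pair (E2 eE).
  by rewrite e_xy in eF *; apply: key => //; exact: mem_pairs.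
split; first exact: fintype.subset_trans FF FE.
  by case: minF.
exact: (residual_approx st_ok FF).
Qed.

End Run.
End PrimalDual.

(** * The online algorithm *)

Lemma set2_eq (T : finType) (u v x y : T) :
  ([set u; v]%SET == [set x; y]%SET) =
  ((u == x) && (v == y)) || ((u == y) && (v == x)).
Proof.
apply/eqP/orP => [/setP e|[]/andP[/eqP -> /eqP ->] //]; last exact: finset.setUC.
have eu := e u; have ev := e v; have ex := e x; have ey := e y.
move: eu ev ex ey; rewrite !inE !eqxx /= ?orbT => /esym/orP[]/eqP -> /esym vxy xuv yuv.
  left; rewrite eqxx; case/orP: yuv => /eqP yE; last by rewrite yE eqxx.
  by move: vxy; rewrite yE orbb.
right; rewrite eqxx; case/orP: xuv => /eqP xE; last by rewrite xE eqxx.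
by move: vxy; rewrite xE orbb.
Qed.

Section Algorithm.
Variables (R : realType) (n : nat) (G : network R n).
Implicit Types (q r : request R n) (p : request R n * R).
Implicit Types (pl : seq (request R n * R)).

Definition together q : rel 'I_n :=
  fun x y => (x \in terminals q) && (y \in terminals q).

(** Zero outside [edges], where [cost] is arbitrary, so that all weights form a matrix computable
    from the input. *)
Definition edge_cost (e : {set 'I_n}) : R :=
  if e \in edges G then cost G e else 0.

(** A sum over matrix entries, as a program can form it; each edge occurs in two ordered pairs,
    hence the halving. *)
Definition pair_cost (F : {set {set 'I_n}}) (w : {set 'I_n} -> R) : R :=
  (\sum_x \sum_y if [set x; y]%SET \in F then w [set x; y]%SET else 0) / 2.

Definition solo q : {set {set 'I_n}} :=
  steiner (edges G) edge_cost (together q).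

Definition init_level q : R := pair_cost (solo q) edge_cost.

Definition cheap (B : R) (e : {set 'I_n}) : bool :=
  edge_cost e *+ (n * n) <= B.

Definition reduced_cost (B : R) (e : {set 'I_n}) : R :=
  if cheap B e then 0 else edge_cost e.

Definition trigger pl : option (request R n * R) :=
  argmin_seq predT (fun p => deadline p.1) pl.

(** The release must be tested because a plan simulates services at times before the release of some
    requests in its list. *)
Definition eligible (t B : R) p : bool := (release p.1 <= t) && (p.2 < B).

Definition group_demand pl (t B : R) q (d : R) : rel 'I_n := fun x y =>
  together q x y || has (fun p =>
    [&& eligible t B p, deadline p.1 <= d & together p.1 x y]) pl.

Definition group pl (t B : R) q (d : R) : {set {set 'I_n}} :=
  steiner (edges G) (reduced_cost B) (group_demand pl t B q d).

Definition affordable pl (t B : R) q (d : R) : bool :=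
  pair_cost (group pl t B q d) (reduced_cost B) <= B + B.

(** The cost of an approximate forest need not grow with [d], so every eligible deadline is tried
    and the latest affordable one wins. The fallback serves the trigger alone. *)
Definition best_group pl (B : R) q : R * {set {set 'I_n}} :=
  foldl (fun acc p =>
      if [&& eligible (deadline q) B p,
             affordable pl (deadline q) B q (deadline p.1) &
             acc.1 <= deadline p.1]
      then (deadline p.1, group pl (deadline q) B q (deadline p.1)) else acc)
    (deadline q, solo q) pl.

Definition transmitted pl (B : R) q : {set {set 'I_n}} :=
  (best_group pl B q).2 :|: [set e in edges G | cheap B e]%SET.

Definition raised (t B : R) p : request R n * R :=
  (p.1, if eligible t B p then B else p.2).

Definition served (t : R) (F : {set {set 'I_n}}) q : bool :=
  (release q <= t) && satisfies (together q) F.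

Definition serve (st : seq (request R n * R) * schedule R n) :=
  if trigger st.1 is Some p then
    let t := deadline p.1 in
    let B := p.2 + p.2 in
    let F := transmitted st.1 B p.1 in
    ([seq raised t B p' | p' <- st.1 & ~~ served t F p'.1], (t, F) :: st.2)
  else st.

(** On inputs that can be served, every service removes at least its trigger, so [size qs] rounds
    exhaust the list. Services are prepended, hence the [rev]. *)
Definition steiner_plan (qs : seq (request R n)) : schedule R n :=
  rev (iter (size qs) serve ([seq (q, init_level q) | q <- qs], [::])).2.

End Algorithm.

(** * Cost and coverage of a single service *)

Section ServiceCost.
Variables (R : realType) (n : nat) (G : network R n).
Implicit Types (q r : request R n) (p : request R n * R).
Implicit Types (pl : seq (request R n * R)) (F Fs : {set {set 'I_n}}).

Lemma edge_cost_ge0 e : 0 <= edge_cost G e.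
Proof. by rewrite /edge_cost; case: ifP => // /cost_gt0/ltW. Qed.

Lemma reduced_cost_ge0 B e : 0 <= reduced_cost G B e.
Proof. by rewrite /reduced_cost; case: ifP => // _; exact: edge_cost_ge0. Qed.

Lemma reduced_cost_le B e : reduced_cost G B e <= edge_cost G e.
Proof. by rewrite /reduced_cost; case: ifP => // _; exact: edge_cost_ge0. Qed.

Lemma pair_costE F w : F \subset edges G -> pair_cost F w = \sum_(e in F) w e :> R.
Proof.
move=> /fintype.subsetP FE; rewrite /pair_cost pair_bigA /=.
rewrite (eq_bigr (fun p : 'I_n * 'I_n =>
    \sum_(e in F) if [set p.1; p.2]%SET == e then w e else 0)); last first.
  move=> [x y] _ /=; case: ifP => [xyF|nF]; last first.
    by rewrite big1 // => e eF; case: eqP nF => // ->; rewrite eF.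
  rewrite (bigD1 _ xyF) /= eqxx big1 ?addr0 // => e /andP[_].
  by rewrite eq_sym => /negbTE ->.
rewrite exchange_big /= mulr_suml; apply: eq_bigr => e eF.
have [x [y [e_xy nxy]]] := card2_pair (card_edge (FE _ eF)).
rewrite -big_mkcond /= sumr_const (_ : #|_| = 2%N).
  by rewrite -[w e *+ 2]mulr_natr mulfK // pnatr_eq0.
rewrite (eq_card (B := [set (x, y); (y, x)]%SET)) ?cards2.
  by rewrite xpair_eqE negb_and nxy.
move=> [u v]; transitivity ([set u; v]%SET == e); first by [].
by rewrite e_xy set2_eq !inE !xpair_eqE.
Qed.

Lemma together_sym q : symmetric (together q).
Proof. by move=> x y; rewrite /together andbC. Qed.

Lemma group_demand_sym pl t B q d : symmetric (group_demand pl t B q d).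
Proof.
move=> x y; rewrite /group_demand together_sym; congr (_ || _).
by apply: eq_has => p; rewrite together_sym.
Qed.

Lemma soloP q Fs : Fs \subset edges G -> satisfies (together q) Fs ->
  [/\ solo G q \subset edges G, satisfies (together q) (solo G q) &
      init_level G q <= 2 * \sum_(e in Fs) edge_cost G e].
Proof.
move=> FsE qFs; have [sE sq sle] := steinerP (@card_edge _ _ G) (@together_sym q)
  (fun e _ => edge_cost_ge0 e) FsE qFs.
by split=> //; rewrite /init_level pair_costE.
Qed.

Lemma groupP pl t B q d Fs :
  Fs \subset edges G -> satisfies (group_demand pl t B q d) Fs ->
  let F := group G pl t B q d in
  [/\ F \subset edges G, satisfies (group_demand pl t B q d) F &
      pair_cost F (reduced_cost G B) <=
        2 * \sum_(e in Fs) reduced_cost G B e].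
Proof.
move=> FsE qFs; have [sE sq sle] := steinerP (@card_edge _ _ G)
  (@group_demand_sym pl t B q d) (fun e _ => reduced_cost_ge0 B e) FsE qFs.
by split=> //; rewrite pair_costE.
Qed.

Lemma card_edges : (#|edges G| <= n * n)%N.
Proof.
have -> : (n * n = #|{: 'I_n * 'I_n}|)%N by rewrite card_prod card_ord.
apply: leq_trans (leq_imset_card (fun p : 'I_n * 'I_n => [set p.1; p.2]%SET) predT).
apply: subset_leq_card; apply/fintype.subsetP => e eE.
have [x [y [-> _]]] := card2_pair (card_edge eE).
by apply/imsetP; exists (x, y).
Qed.

Lemma cheap_cost B F : 0 <= B -> F \subset edges G ->
  (forall e, e \in F -> edge_cost G e *+ (n * n) <= B) ->
  \sum_(e in F) edge_cost G e <= B.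
Proof.
move=> B0 FE cF; have [nn0|nn0] := posnP (n * n).
  rewrite big1 // => e eF.
  have := leq_trans (subset_leq_card FE) card_edges; rewrite nn0 leqn0 cards_eq0.
  by move=> /eqP F0; rewrite F0 inE in eF.
rewrite -(ler_pMn2r nn0) -sumrMnl.
apply: (@le_trans _ _ (B *+ #|F|)).
  by rewrite -sumr_const; apply: ler_sum.
apply: ler_wpMn2l => //.
exact: leq_trans (subset_leq_card FE) card_edges.
Qed.

Section Service.
Variables (pl : seq (request R n * R)) (B : R) (q : request R n).
Hypothesis satE : satisfies (together q) (edges G).
Hypothesis plE : {in pl, forall p, satisfies (together p.1) (edges G)}.
Hypothesis firstq : {in pl, forall p, deadline q <= deadline p.1}.
Hypothesis levelB : init_level G q <= B.

Lemma B_ge0 : 0 <= B.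
Proof.
apply: le_trans levelB; rewrite /init_level pair_costE.
  by apply: sumr_ge0 => e _; exact: edge_cost_ge0.
by have [] := soloP (fintype.subxx _) satE.
Qed.

Lemma group_satE d :
  satisfies (group_demand pl (deadline q) B q d) (edges G).
Proof.
apply/satisfiesP => x y /orP[|/hasP[p ppl /and3P[_ _]]].
  exact: satisfies_connect.
exact/satisfies_connect/plE.
Qed.

Definition group_ok p := [&& eligible (deadline q) B p &
  affordable G pl (deadline q) B q (deadline p.1)].

(** Demands grow with [d], so the set chosen for the latest affordable deadline serves the group of
    every other affordable deadline as well. *)
Lemma best_groupP : let acc := best_group G pl B q in
  [/\ acc.2 \subset edges G, satisfies (together q) acc.2,
      \sum_(e in acc.2) reduced_cost G B e <= B + B &
      {in pl, forall p, group_ok p ->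
         satisfies (group_demand pl (deadline q) B q (deadline p.1)) acc.2}].
Proof.
rewrite /best_group; set body := fun _ _ => _.
(* The initial [solo] serves only [q], so the label [acc.1] describes the demand served only once
   some group has been accepted. *)
pose inv (l : seq (request R n * R)) (acc : R * {set {set 'I_n}}) :=
  [/\ acc.2 \subset edges G, satisfies (together q) acc.2,
      \sum_(e in acc.2) reduced_cost G B e <= B + B,
      acc.1 = deadline q \/
        satisfies (group_demand pl (deadline q) B q acc.1) acc.2 &
      {in l, forall p, group_ok p -> deadline p.1 <= acc.1 /\
         satisfies (group_demand pl (deadline q) B q (deadline p.1)) acc.2}].
have mono d d' F : d <= d' ->
    satisfies (group_demand pl (deadline q) B q d') F ->
    satisfies (group_demand pl (deadline q) B q d) F.
  move=> dd' /satisfiesP sF; apply/satisfiesP => x y Dxy; apply: sF.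
  case/orP: Dxy => [|/hasP[p ppl /and3P[el le xy]]]; first by rewrite /group_demand => ->.
  apply/orP; right; apply/hasP; exists p => //.
  by rewrite el xy (le_trans le dd').
suff H (l : seq (request R n * R)) : {subset l <= pl} ->
    inv l (foldl body (deadline q, solo G q) l).
  by have [] := H pl (fun p => id) => ? ? ? _ Hl; split=> // p /Hl pH /pH[].
elim/last_ind: l => [|l p IH] lpl.
  have [sE sq _] := soloP (fintype.subxx _) satE.
  split=> //=; last by left.
  apply: le_trans (ler_sum _ _) _.
  - by move=> e _; exact: reduced_cost_le.
  - rewrite -pair_costE //; apply: le_trans levelB _.
    by rewrite lerDl B_ge0.
have ppl : p \in pl by apply: lpl; rewrite mem_rcons mem_head.
rewrite foldl_rcons; move: (foldl _ _ _) IH => acc [|FE Fq Fc Fd Fl].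
  by move=> r rl; apply: lpl; rewrite mem_rcons inE rl orbT.
rewrite {1}/body; case: ifP => [/and3P[el aff le]|/negbT nok].
  have [gE gd _] := groupP (fintype.subxx _) (group_satE (deadline p.1)).
  have gq : satisfies (together q) (group G pl (deadline q) B q (deadline p.1)).
    apply/satisfiesP => x y xy; apply: (satisfies_connect gd).
    by rewrite /group_demand xy.
  split=> //=; [by rewrite -pair_costE|by right|].
  move=> r; rewrite mem_rcons inE => /orP[/eqP -> //|rl] rok.
  have [rd _] := Fl _ rl rok; have rp := le_trans rd le.
  by split=> //; apply: mono rp gd.
split=> // r; rewrite mem_rcons inE => /orP[/eqP ->|/Fl]; last by apply.
move=> /andP[el aff]; move: nok; rewrite el aff /= -ltNge => lt.
split; first exact: ltW.
(* The rejected deadline is below [acc.1], so [acc.1] cannot be [deadline q], the smallest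
   deadline. *)
case: Fd => [acc1|]; last by apply: mono; exact: ltW.
by move: lt; rewrite acc1 ltNge firstq.
Qed.

Definition service_edges := transmitted G pl B q.

Lemma service_edgesE : service_edges \subset edges G.
Proof.
rewrite finset.subUset; case: best_groupP => -> _ _ _ /=.
by apply/fintype.subsetP => e; rewrite inE => /andP[].
Qed.

Lemma service_edges_trigger : satisfies (together q) service_edges.
Proof.
by case: best_groupP => _ + _ _; apply: satisfiesS; exact: finset.subsetUl.
Qed.

(** At most [B] for the cheap edges, and [B + B] for the others, whose reduced cost is their full
    cost. *)
Lemma service_cost : \sum_(e in service_edges) edge_cost G e <= B *+ 3.
Proof.
have [FE _ Fc _] := best_groupP.
rewrite (bigID (cheap G B)) /= mulrS; apply: lerD.
  pose F0 := [set e in service_edges | cheap G B e]%SET.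
  rewrite (eq_bigl (fun e => e \in F0)) => [|e]; last by rewrite [RHS]inE.
  apply: cheap_cost B_ge0 _ _ => [|e]; last by rewrite inE => /andP[].
  apply: fintype.subset_trans service_edgesE.
  by apply/fintype.subsetP => e; rewrite inE => /andP[].
rewrite mulr2n; apply: le_trans Fc.
rewrite [leRHS](bigID (cheap G B)) /= [X in _ <= X + _]big1 ?add0r; last first.
  by move=> e /andP[_ ce]; rewrite /reduced_cost ce.
rewrite le_eqVlt; apply/orP; left; apply/eqP.
rewrite [RHS](eq_bigr (edge_cost G)) => [|e /andP[_ /negbTE nc]]; last first.
  by rewrite /reduced_cost nc.
apply: eq_bigl => e; rewrite inE [in X in _ || X]inE.
by case: (cheap G B e); rewrite ?andbF ?orbF.
Qed.

(* If a request of the group was left out, serving it together with the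
   eligible requests of earlier deadline is more expensive than [B]. *)
Lemma left_out_cost p Fs : p \in pl -> eligible (deadline q) B p ->
  ~~ satisfies (together p.1) service_edges ->
  Fs \subset edges G ->
  satisfies (group_demand pl (deadline q) B q (deadline p.1)) Fs ->
  B < \sum_(e in Fs) edge_cost G e.
Proof.
move=> ppl el np FsE dFs; have [_ _ _ ok] := best_groupP.
have [_ _ gle] := groupP FsE dFs.
apply: lt_le_trans (ler_sum _ (fun e _ => reduced_cost_le B e)).
(* Being left out means that the group of this deadline was not affordable: it costs more than
   [2 B], and the approximation factor 2 leaves [B] for [Fs]. *)
rewrite -(ltr_pM2l (ltr0n R 2)); apply: lt_le_trans gle.
rewrite mulr_natl mulr2n ltNge; apply: contra np => aff.
have pok : group_ok p by rewrite /group_ok el.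
have sp := ok _ ppl pok.
apply: (satisfiesS (finset.subsetUl _ _)); apply/satisfiesP => x y xy.
by apply: (satisfies_connect sp); apply/orP; right; apply/hasP; exists p; rewrite // el lexx.
Qed.

End Service.
End ServiceCost.

(** * Competitive analysis *)

Lemma pairwise_rem (T : eqType) (r : rel T) (l : seq T) x y : symmetric r ->
  pairwise r l -> x \in l -> y \in rem x l -> r x y.
Proof.
move=> r_sym; elim: l => // a l IH; rewrite pairwise_cons inE /=.
move=> /andP[/allP al sl]; have [<- _ /al //|ax] := eqVneq a x.
move=> xl; rewrite inE => /orP[/eqP ->|]; last exact: IH.
by rewrite r_sym al.
Qed.

(** * Sums of numbers that pairwise differ by factors of at least 2 *)

Section ApartSums.
Variable R : realType.
Implicit Types (c x y : R) (l : seq R).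

Definition factor2_apart x y : bool := (x *+ 2 <= y) || (y *+ 2 <= x).

Lemma factor2_apart_sym : symmetric factor2_apart.
Proof. by move=> x y; rewrite /factor2_apart orbC. Qed.

(** Remove the largest element [x]; all others are at most [x / 2], so by induction they add up to
    at most [x]. *)
Lemma sum_apart_le l c : pairwise factor2_apart l ->
  {in l, forall x, 0 <= x <= c} -> 0 <= c -> \sum_(x <- l) x <= c *+ 2.
Proof.
elim: {l}(size l) {-2}l (leqnn (size l)) c => [|k IH] l lk c sep lc c0.
  by move: lk; rewrite leqn0 size_eq0 => /eqP ->; rewrite big_nil mulrn_wge0.
have := argmin_seqP predT -%R l; case: argmin_seq => [x [xl _ xmax]|no]; last first.
  case: l no {lk sep lc} => [|x l no]; first by rewrite big_nil mulrn_wge0.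
  by have := no x (mem_head _ _).
have /andP[x0 xc] := lc x xl.
rewrite (perm_big _ (perm_to_rem xl)) /= big_cons mulr2n; apply: lerD => //.
apply: le_trans xc; rewrite [leRHS]splitr -mulr2n.
apply: IH; last by rewrite divr_ge0.
- by rewrite size_rem // -ltnS prednK // -has_predT; apply/hasP; exists x.
- exact: subseq_pairwise (rem_subseq _ _) sep.
move=> y yl; have yl' := mem_rem yl.
have /andP[-> yc] := lc y yl'.
have yx : y <= x by rewrite -lerN2; exact: xmax.
rewrite ler_pdivlMr ?ltr0n // mulr_natr.
case/orP: (pairwise_rem factor2_apart_sym sep xl yl) => // x2y.
have y0 : 0 <= y by case/andP: (lc y yl').
rewrite mulr2n; apply: le_trans (lerD yx yx) (le_trans _ yx).
by move: x2y; rewrite mulr2n.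
Qed.

(** The elements below [c] sum to at most [2 c]. Each of the [p] octaves from [c * 2 ^+ i] to its
    double contains at most one element, which contributes [c]. *)
Lemma sum_min_apart_le (p : nat) l c :
  pairwise factor2_apart l -> {in l, forall x, 0 <= x} -> 0 <= c ->
  \sum_(x <- l | x < c * 2 ^+ p) Num.min c x <= c *+ p.+2.
Proof.
move=> sep l0 c0; elim: p => [|p IH].
  rewrite expr0 mulr1 -big_filter big_seq.
  apply: (@le_trans _ _ (\sum_(x <- l | x < c) x)).
    rewrite -[leRHS]big_filter [leRHS]big_seq; apply: ler_sum => x _.
    by rewrite ge_min lexx orbT.
  rewrite -big_filter; apply: sum_apart_le => //.
    exact: subseq_pairwise (filter_subseq _ _) sep.
  by move=> x; rewrite mem_filter => /andP[/ltW -> /l0 ->].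
rewrite (bigID (fun x => x < c * 2 ^+ p)) /= [c *+ _]mulrSr; apply: lerD.
  rewrite (eq_bigl (fun x => x < c * 2 ^+ p)) // => x.
  apply: andb_idl => lt; apply: lt_le_trans lt _.
  by rewrite exprS ler_wpM2l // ler_peMl ?exprn_ge0 // ler1n.
rewrite -big_filter; set P := fun _ => _.
have := subseq_pairwise (filter_subseq P l) sep.
have : all P [seq x <- l | P x] by exact: filter_all.
case: [seq x <- l | P x] => [|x [|y l']]; first by rewrite big_nil.
  by rewrite big_seq1 ge_min lexx.
have far u v : P u -> P v -> ~~ (u *+ 2 <= v).
  rewrite /P -leNgt => /andP[_ uc] /andP[vc _]; rewrite -ltNge.
  apply: lt_le_trans vc _; rewrite exprSr mulrA mulr_natr.
  exact: ler_wMn2r.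
move=> /= /and3P[Px Py _] /andP[/andP[sxy _] _].
by case/orP: sxy => le; [have := far _ _ Px Py|have := far _ _ Py Px]; rewrite le.
Qed.

End ApartSums.
Lemma argmin_seq_map (R : realType) (S T : Type) (f : S -> T) (P : pred T)
    (v : T -> R) l :
  argmin_seq P v (map f l) = omap f (argmin_seq (P \o f) (v \o f) l).
Proof.
elim/last_ind: l => // l x IH; rewrite map_rcons /argmin_seq !foldl_rcons.
rewrite -!/(argmin_seq _ _ _) IH /=.
by case: (argmin_seq _ _ l) => [u|] /=; case: ifP.
Qed.

(** * The sequence of services and the charging argument *)

Section Run.
Variables (R : realType) (n : nat) (G : network R n).
Implicit Types (q r : request R n) (st : seq (request R n) * (request R n -> R)).

(** For the analysis the levels form one function on requests, still defined after a request is
    served. This is faithful to [serve]: a level depends only on the request and the services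
    made. *)
Definition entries st : seq (request R n * R) := [seq (r, st.2 r) | r <- st.1].

(** On an empty list the default makes the levels of [next] meaningless, but the list stays empty,
    and only states with a nonempty list count as services. *)
Definition target st : request R n :=
  odflt (finset.set0, 0, 0) (argmin_seq predT (@deadline R n) st.1).

Definition service_time st : R := deadline (target st).

Definition budget st : R := st.2 (target st) + st.2 (target st).

Definition sent st : {set {set 'I_n}} :=
  transmitted G (entries st) (budget st) (target st).

Definition raises st r : bool :=
  eligible (service_time st) (budget st) (r, st.2 r).

Definition next st : seq (request R n) * (request R n -> R) :=
  ([seq r <- st.1 | ~~ served (service_time st) (sent st) r],
   fun r => if raises st r then budget st else st.2 r).

Fixpoint run m st : schedule R n :=
  if m is m'.+1 then
    if st.1 is [::] then [::] else (service_time st, sent st) :: run m' (next st)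
  else [::].

Lemma targetP st : st.1 != [::] ->
  [/\ argmin_seq predT (@deadline R n) st.1 = Some (target st),
      target st \in st.1 &
      {in st.1, forall r, service_time st <= deadline r}].
Proof.
rewrite /service_time /target.
have := argmin_seqP predT (@deadline R n) st.1.
case: argmin_seq => [q [qs _ qmin] _|no]; first by split=> // r /qmin; apply.
by case: (st.1) no => // r s /(_ r (mem_head _ _)).
Qed.

Lemma run_nil m lv : run m ([::], lv) = [::].
Proof. by case: m. Qed.

Lemma serve_run m st out :
  (iter m (serve G) (entries st, out)).2 = catrev (run m st) out.
Proof.
elim: m st out => [|m IH] st out //; rewrite iterSr /=.
have [st0|st_n0] := eqVneq st.1 [::].
  rewrite (_ : serve G _ = (entries st, out)); last first.
    by rewrite /serve /= /entries st0.
  by rewrite IH; case: st st0 => s lv /= ->; rewrite run_nil.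
have [trg _ _] := targetP st_n0.
rewrite (_ : serve G _ = (entries (next st), (service_time st, sent st) :: out)).
  by rewrite IH; case: (st.1) st_n0.
rewrite /serve /= /trigger /entries argmin_seq_map trg /=; congr (_, _).
rewrite filter_map -map_comp; apply: eq_map => r /=.
by rewrite /raised.
Qed.

Lemma steiner_planE qs : steiner_plan G qs = run (size qs) (qs, init_level G).
Proof.
rewrite /steiner_plan -[[seq _ | _ <- _]]/(entries (qs, init_level G)).
by rewrite serve_run -[catrev _ _]/(rev _) revK.
Qed.

Lemma run_iter m st : run m st =
  [seq (service_time (iter k next st), sent (iter k next st)) |
     k <- iota 0 m & (iter k next st).1 != [::]].
Proof.
elim: m st => // m IH st; case: (eqVneq st.1 [::]) => [st0|st_n0].
  have nil k : (iter k next st).1 = [::].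
    by elim: k => //= k ->.
  case: st st0 nil => s lv /= -> nil.
  by rewrite (eq_filter (a2 := pred0)) ?filter_pred0 // => k; rewrite nil.
rewrite /= st_n0 /=; case: (st.1) st_n0 => //= _ _ _; congr (_ :: _).
rewrite IH -add1n iotaDl filter_map -map_comp /=.
by congr map; [apply: funext => k /=|apply: eq_filter => k /=];
   rewrite -iterSr.
Qed.

Lemma next_sub st : {subset (next st).1 <= st.1}.
Proof. by move=> r; rewrite mem_filter => /andP[]. Qed.

Lemma level_next st r : st.2 r <= (next st).2 r.
Proof. by rewrite /= /raises /eligible; case: ifP => // /andP[_ /ltW]. Qed.

(** The source of the factor 2 between budgets: a request visible at a service and triggering a
    later one does so with at least twice the budget. *)
Lemma level_visible st r : release r <= service_time st ->
  budget st <= (next st).2 r.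
Proof. by move=> vis; rewrite /= /raises /eligible vis /=; case: ltP. Qed.

Lemma init_level_ge0 q : 0 <= init_level G q.
Proof.
apply: mulr_ge0; last by rewrite invr_ge0.
apply: sumr_ge0 => x _; apply: sumr_ge0 => y _.
by case: ifP => // _; exact: edge_cost_ge0.
Qed.

Lemma sentP st : st.1 != [::] ->
  {in st.1, forall q, satisfies (together q) (edges G)} ->
  (forall q, init_level G q <= st.2 q) ->
  [/\ sent st \subset edges G, satisfies (together (target st)) (sent st) &
      \sum_(e in sent st) edge_cost G e <= budget st *+ 3].
Proof.
move=> st_n0 sat lv; have [_ tst first] := targetP st_n0.
have h1 := sat _ tst.
have h2 : {in entries st, forall p, satisfies (together p.1) (edges G)}.
  by move=> p /mapP[r rS ->] /=; exact/sat/rS.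
have h3 : {in entries st, forall p, deadline (target st) <= deadline p.1}.
  by move=> p /mapP[r rS ->] /=; exact: first.
have h4 : init_level G (target st) <= budget st.
  apply: le_trans (lv _) _; rewrite /budget lerDl.
  exact: le_trans (init_level_ge0 _) (lv _).
split; [exact: service_edgesE|exact: service_edges_trigger|exact: service_cost].
Qed.

Lemma size_next st : st.1 != [::] ->
  {in st.1, forall q, satisfies (together q) (edges G)} ->
  {in st.1, forall q, release q <= deadline q} ->
  (forall q, init_level G q <= st.2 q) ->
  (size (next st).1 < size st.1)%N.
Proof.
move=> st_n0 sat timely lv; have [_ tst _] := targetP st_n0.
rewrite size_filter -(count_predC (served (service_time st) (sent st))).
rewrite -[X in (X < _)%N]add0n ltn_add2r -has_count; apply/hasP.
exists (target st) => //; rewrite /served timely //=.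
by have [_ ->] := sentP st_n0 sat lv.
Qed.

Section Orbit.
Variable qs : seq (request R n).
Hypothesis satE : {in qs, forall q, satisfies (together q) (edges G)}.
Hypothesis timely : {in qs, forall q, release q <= deadline q}.

Let st_ k := iter k next (qs, init_level G).
Let live k := (st_ k).1 != [::].

Lemma orbit_sub j k : (j <= k)%N -> {subset (st_ k).1 <= (st_ j).1}.
Proof.
move/subnKC <-; elim: (k - j)%N => [|i IH] r; first by rewrite addn0.
by rewrite addnS => /next_sub/IH.
Qed.

Lemma live_le j k : (j <= k)%N -> live k -> live j.
Proof.
move=> jk; rewrite /live; case E : (st_ k).1 => [//|r s] _.
have /(orbit_sub jk) : r \in (st_ k).1 by rewrite E mem_head.
by case: (st_ j).1.
Qed.

Lemma target_mem k : live k -> target (st_ k) \in (st_ k).1.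
Proof. by move=> /targetP[]. Qed.

Lemma mem_qs k r : r \in (st_ k).1 -> r \in qs.
Proof. exact: (orbit_sub (leq0n k)). Qed.

Lemma service_time_le j k : (j <= k)%N -> live k ->
  service_time (st_ j) <= service_time (st_ k).
Proof.
move=> jk lk; have [_ _] := targetP (live_le jk lk); apply.
exact/(orbit_sub jk)/target_mem.
Qed.

Lemma level_le j k r : (j <= k)%N -> (st_ j).2 r <= (st_ k).2 r.
Proof.
move/subnKC <-; elim: (k - j)%N => [|i IH]; first by rewrite addn0.
by rewrite addnS; apply: le_trans IH (level_next _ _).
Qed.

Lemma level_ge0 k r : 0 <= (st_ k).2 r.
Proof. exact: le_trans (init_level_ge0 r) (level_le r (leq0n k)). Qed.

Lemma budget_ge0 k : 0 <= budget (st_ k).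
Proof. by apply: addr_ge0; exact: level_ge0. Qed.

Lemma target_visible k : live k -> release (target (st_ k)) <= service_time (st_ k).
Proof. by move=> /target_mem/mem_qs/timely. Qed.

Fixpoint last_raise q k : option nat :=
  if k is k'.+1 then if raises (st_ k') q then Some k' else last_raise q k'
  else None.

Lemma last_raiseP q k :
  if last_raise q k is Some j then
    [/\ (j < k)%N, raises (st_ j) q &
        forall i, (j < i <= k)%N -> (st_ i).2 q = budget (st_ j)]
  else (st_ k).2 q = init_level G q.
Proof.
elim: k => //= k IH; case: ifP => [rk|nrk].
  split=> // i ik; have -> : i = k.+1 by apply/eqP; rewrite eqn_leq andbC.
  by rewrite /= rk.
case: (last_raise q k) IH => [j [jk rj jE]|//]; split=> //; first exact: ltnW.
move=> i /andP[ji]; rewrite leq_eqVlt => /orP[/eqP ->|ik]; last first.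
  by apply: jE; rewrite ji.
by rewrite /= nrk jE // jk leqnn.
Qed.

(* The times in which the optimum has to pay for the [k]-th service. *)
Definition window k (t : R) : bool :=
  (t <= service_time (st_ k)) &&
  match last_raise (target (st_ k)) k with
  | Some j => has (fun r => raises (st_ j) r && (release r <= t)) (st_ j).1
  | None => release (target (st_ k)) <= t
  end.

Definition primary k : bool := last_raise (target (st_ k)) k == None.

Lemma windows_apart k1 k2 t : live k1 -> live k2 -> k1 != k2 ->
  primary k1 = primary k2 -> window k1 t -> window k2 t ->
  factor2_apart (budget (st_ k1)) (budget (st_ k2)).
Proof.
move=> l1 l2 k12; rewrite /primary /window.
have H1 := last_raiseP (target (st_ k1)) k1.
have H2 := last_raiseP (target (st_ k2)) k2.
case: (last_raise _ k1) H1 => [j1 [jk1 r1 E1]|E1];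
case: (last_raise _ k2) H2 => [j2 [jk2 r2 E2]|E2] // _.
  move=> /andP[t1 w1] /andP[t2 w2].
  have B1 : budget (st_ k1) = budget (st_ j1) *+ 2.
    by rewrite {1}/budget E1 ?jk1 ?leqnn // mulr2n.
  have B2 : budget (st_ k2) = budget (st_ j2) *+ 2.
    by rewrite {1}/budget E2 ?jk2 ?leqnn // mulr2n.
  (* Each budget is twice that of the last raise of its trigger. If the budgets are not apart, then
     each exceeds the budget of the other trigger's last raise. *)
  apply/negPn/negP; rewrite /factor2_apart negb_or -!ltNge {1}B2 {2}B1.
  rewrite !ltr_pMn2r // => /andP[b21 b12].
  wlog j12 : k1 k2 j1 j2 t1 t2 w1 w2 l1 l2 k12 jk1 jk2 r1 r2 E1 E2 B1 B2 b12 b21 /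
      (j1 <= j2)%N.
    move=> wl; case: (leqP j1 j2) => [le|/ltnW le].
      exact: (wl k1 k2 j1 j2).
    apply: (wl k2 k1 j2 j1) => //. by rewrite eq_sym.
  (* A service between the last raise of a trigger and the service triggered by it sees this request
     but leaves its level unchanged, so its budget is no larger than that level. *)
  have kept ja ka kb : live kb -> raises (st_ ja) (target (st_ kb)) ->
      (forall i, (ja < i <= kb)%N -> (st_ i).2 (target (st_ kb)) = budget (st_ ja)) ->
      (ja < ka < kb)%N -> budget (st_ ka) <= budget (st_ ja).
    move=> lb ra Ea /andP[jaka kakb].
    rewrite -(Ea ka.+1) ?kakb ?andbT ?ltnS 1?ltnW //.
    apply: level_visible; case/andP: ra => vis _; apply: le_trans vis _.
    by apply: service_time_le; [exact: ltnW|exact: live_le (ltnW kakb) lb].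
  (* If [k1] precedes [j2], a request raised at [j2] is visible at [k1] through the common time [t].
     Its level would then be at least [budget (st_ k1)], yet below the smaller [budget (st_ j2)]. *)
  case: (ltngtP k1 j2) => [k1j2|j2k1|k1j2].
  - case/hasP: w2 => r _ /andP[/andP[_ rl] rt].
    have := level_visible (le_trans rt t1); rewrite -[next _]/(st_ k1.+1) => lv.
    have := lt_trans (le_lt_trans (le_trans lv (level_le r k1j2)) rl) b21.
    by rewrite ltxx.
  - case: (ltngtP k1 k2) k12 => // [k12|k21] _.
      have := kept _ _ _ l2 r2 E2; move/(_ k1); rewrite j2k1 k12 => /(_ isT).
      by rewrite leNgt b21.
    have := kept _ _ _ l1 r1 E1; move/(_ k2).
    by rewrite k21 (leq_ltn_trans j12 jk2) => /(_ isT); rewrite leNgt b12.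
  - by move: b21; rewrite k1j2 ltxx.
(* Two fresh triggers: the later one is visible at the earlier service, so its level is at least
   that budget, and its own budget is twice its level. *)
wlog k12' : k1 k2 l1 l2 k12 E1 E2 / (k1 < k2)%N.
  move=> wl w1 w2; case: (ltngtP k1 k2) k12 => // lt neq.
    by apply: wl => //; rewrite neq_ltn lt.
  by rewrite factor2_apart_sym; apply: wl => //; rewrite neq_ltn lt.
move=> /andP[t1 _] /andP[_ r2]; apply/orP; left.
have := le_trans (level_visible (le_trans r2 t1)) (level_le _ k12').
by rewrite [in X in _ -> X]/budget -mulr2n ler_pMn2r.
Qed.

(** Capping at [B] turns small budgets into a geometric sum; the threshold bounds the large budgets
    that reach [e], which leaves logarithmically many full charges. *)
Definition charge (B : R) (e : {set 'I_n}) : R :=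
  if B < edge_cost G e *+ (8 * (n * n)) then Num.min (edge_cost G e) B else 0.

Lemma charge_ge0 B e : 0 <= B -> 0 <= charge B e.
Proof.
move=> B0; rewrite /charge; case: ifP => // _.
by rewrite le_min edge_cost_ge0.
Qed.

(** An edge of cost at least [B] pays [B] alone. Otherwise edges below the threshold total at most
    [B / 8] and all others are charged in full, so of the cost [B / 4] at least [B / 8] is
    charged. *)
Lemma sum_charge B (F : {set {set 'I_n}}) : 0 <= B -> F \subset edges G ->
  B <= (\sum_(e in F) edge_cost G e) *+ 4 ->
  B <= (\sum_(e in F) charge B e) *+ 8.
Proof.
move=> B0 FE BF; have S0 (P : pred _) : 0 <= \sum_(e in F | P e) charge B e.
  by apply: sumr_ge0 => e _; exact: charge_ge0.
have [->|B_n0] := eqVneq B 0.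
  by apply: mulrn_wge0; apply: sumr_ge0 => e _; exact: charge_ge0.
have B_gt0 : 0 < B by rewrite lt_neqAle eq_sym B_n0.
case: (pickP (fun e => (e \in F) && (B <= edge_cost G e))) => [e /andP[eF Be]|small].
  have nn0 : (0 < n * n)%N.
    by apply: leq_trans (card_edges G); apply/card_gt0P; exists e; apply: (fintype.subsetP FE).
  suff cE : charge B e = B.
    rewrite (bigD1 e) //= cE mulrnDl mulrS -addrA lerDl.
    by apply: addr_ge0; apply: mulrn_wge0.
  rewrite /charge (min_idPr Be) ifT //; apply: (@lt_le_trans _ _ (edge_cost G e *+ 2)).
    by rewrite (le_lt_trans Be) // mulr2n ltrDl (lt_le_trans B_gt0 Be).
  apply: ler_wpMn2l; first exact: edge_cost_ge0.
  by rewrite (leq_trans _ (leq_mul (leqnn 8) nn0)).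
pose low e := edge_cost G e *+ (8 * (n * n)) <= B.
have lowB : \sum_(e in F | low e) edge_cost G e <= B / 8.
  pose F0 := [set e in F | low e]%SET.
  rewrite (eq_bigl (fun e => e \in F0)) => [|e]; last by rewrite [RHS]inE.
  apply: cheap_cost; first exact: divr_ge0.
    by apply: fintype.subset_trans FE; apply/fintype.subsetP => e; rewrite inE => /andP[].
  by move=> e; rewrite inE => /andP[_]; rewrite /low ler_pdivlMr ?ltr0n // mulr_natr -mulrnA mulnC.
have highB : \sum_(e in F | ~~ low e) edge_cost G e <= \sum_(e in F) charge B e.
  rewrite [leRHS](bigID low) /= -[leLHS]add0r; apply: lerD; first exact: S0.
  apply: ler_sum => e /andP[eF hi]; rewrite /charge ltNge hi le_min lexx /=.
  by rewrite leNgt; apply/negP => /ltW le; move: (small e); rewrite eF le.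
move: BF; rewrite (bigID low) /= => BF.
have := lerD lowB highB => le; have := le_trans BF (ler_wMn2r 4 le).
rewrite mulrnDl -[B / 8 *+ 4]mulr_natr.
lra.
Qed.

Lemma satisfies_connects q F : connects F (terminals q) <-> satisfies (together q) F.
Proof.
split=> [cF|/satisfiesP sF x y xq yq]; last by apply: sF; rewrite /together xq.
by apply/satisfiesP => x y /andP[xq yq]; exact: cF.
Qed.

(** It suffices that the budget is at most 4 times the cost of what the schedule sends in the
    window. For a fresh trigger, the budget is twice the initial level, itself at most twice any
    solution. For a raised one, [left_out_cost] applies to the service [j] of half the budget that
    raised it last. *)
Lemma window_charge k s : live k -> feasible G qs s ->
  budget (st_ k) <=
    (\sum_(x <- s | window k x.1) \sum_(e in x.2) charge (budget (st_ k)) e) *+ 8.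
Proof.
move=> lk [sE sq].
(* The union of all transmissions in the window. Counting repeated edges once only lowers the
   charges. *)
pose F := [set e : {set 'I_n} |
  has (fun x : R * {set {set 'I_n}} => window k x.1 && (e \in x.2)) s]%SET.
have subF (x : R * {set {set 'I_n}}) : x \in s -> window k x.1 -> x.2 \subset F.
  move=> xs wx; apply/fintype.subsetP => e ex; rewrite inE; apply/hasP.
  by exists x; rewrite // wx.
have FE : F \subset edges G.
  apply/fintype.subsetP => e; rewrite inE => /hasP[[t F'] /sE/fintype.subsetP F'E].
  by case/andP => _ /F'E.
have B0 := budget_ge0 k.
apply: (@le_trans _ _ ((\sum_(e in F) charge (budget (st_ k)) e) *+ 8)); last first.
  apply: ler_wMn2r.
  apply: (@le_trans _ _ (\sum_(e in F) \sum_(x <- s | window k x.1)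
      if e \in x.2 then charge (budget (st_ k)) e else 0)).
    apply: ler_sum => e; rewrite inE => /hasP[x xs /andP[wx ex]].
    rewrite (big_rem x xs) /= wx ex lerDl; apply: sumr_ge0 => y _.
    by case: ifP => // _; exact: charge_ge0.
  rewrite exchange_big /=; apply: ler_sum => x _.
  rewrite -big_mkcondr /= [leRHS](bigID (fun e => e \in F)) /=.
  rewrite (eq_bigl (fun e => (e \in x.2) && (e \in F))).
    by rewrite lerDl; apply: sumr_ge0 => e _; exact: charge_ge0.
  by move=> e; rewrite andbC.
apply: sum_charge => //.
have tqs := mem_qs (target_mem lk).
have covers r : r \in qs -> deadline r <= service_time (st_ k) ->
    (forall t, release r <= t -> t <= service_time (st_ k) -> window k t) ->
    satisfies (together r) F.
  move=> /sq[t [F' [tF' /andP[rt td] /satisfies_connects sF']]] rk wr.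
  apply: satisfiesS sF'; apply: (subF _ tF'); apply: wr => //.
  exact: le_trans td rk.
have := last_raiseP (target (st_ k)) k.
case E : (last_raise _ k) => [j|]; last first.
  move=> lE; have := soloP FE; move=> /(_ (target (st_ k))) [|_ _ le].
    by apply: covers => // t rt tk; rewrite /window tk E.
  rewrite /budget lE -mulr2n (_ : 4 = 2 * 2)%N // mulrnA ler_pMn2r //.
  by rewrite -mulr_natl.
case=> jk rj lE; have Bk : budget (st_ k) = budget (st_ j) *+ 2.
  by rewrite {1}/budget lE ?jk ?leqnn // mulr2n.
have lj := live_le (ltnW jk) lk.
have [_ tj firstj] := targetP lj.
rewrite Bk (_ : 4 = 2 * 2)%N // mulrnA ler_pMn2r // mulr2n ler_wpDr //.
  by apply: sumr_ge0 => e _; exact: edge_cost_ge0.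
have tSj : target (st_ k) \in (st_ j).1 by exact/(orbit_sub (ltnW jk))/target_mem.
apply/ltW/(@left_out_cost _ _ G (entries (st_ j)) (budget (st_ j)) (target (st_ j))
  _ _ _ _ (target (st_ k), (st_ j).2 (target (st_ k)))).
- exact/satE/mem_qs/tj.
- by move=> p /mapP[r rS ->] /=; exact/satE/mem_qs/rS.
- by move=> p /mapP[r rS ->] /=; exact: firstj.
- apply: le_trans (level_le _ (leq0n j)) _.
  by rewrite /budget lerDl level_ge0.
- by apply/mapP; exists (target (st_ k)).
- exact: rj.
(* The trigger of [k] was visible at service [j] and is still pending afterwards, so it was not
   connected there. *)
- have := orbit_sub jk (target_mem lk); rewrite mem_filter => /andP[+ _].
  by rewrite /served; case/andP: rj => /= -> _.
- exact: FE.
apply/satisfiesP => x y /orP[xy|/hasP[p /mapP[r rS ->] /= /and3P[el dr xy]]].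
  apply: satisfies_connect xy; apply: covers (mem_qs tj) _ _.
    exact: service_time_le (ltnW jk) lk.
  (* The trigger of [j] must count as raised by [j], for the window to reach back to its release.
     This requires a positive level: with level 0 the budget would be 0, and service [j] could not
     have raised anything. *)
  move=> t rt tk; rewrite /window tk E; apply/hasP; exists (target (st_ j)) => //.
  rewrite rt andbT /raises /eligible /= target_visible //=.
  rewrite /budget ltrDl lt_neqAle level_ge0 andbT eq_sym.
  case/andP: rj => _ /= lt; apply: contraTneq lt => lj0.
  by rewrite /budget lj0 addr0 -leNgt level_ge0.
apply: satisfies_connect xy; apply: covers (mem_qs rS) dr _.
move=> t rt tk; rewrite /window tk E; apply/hasP; exists r => //.
by rewrite rt andbT.
Qed.

Lemma live_service k : live k ->
  [/\ sent (st_ k) \subset edges G,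
      satisfies (together (target (st_ k))) (sent (st_ k)) &
      \sum_(e in sent (st_ k)) edge_cost G e <= budget (st_ k) *+ 3].
Proof.
move=> lk; apply: sentP => // [r /mem_qs/satE //|r].
exact: level_le (leq0n k).
Qed.

Lemma size_orbit_next k : live k -> (size (st_ k.+1).1 < size (st_ k).1)%N.
Proof.
move=> lk; apply: size_next => // [r /mem_qs/satE //|r /mem_qs/timely //|r].
exact: level_le (leq0n k).
Qed.

Lemma orbit_end : (st_ (size qs)).1 = [::].
Proof.
apply/eqP/negPn/negP => l.
have H k : (k <= size qs)%N -> (size (st_ k).1 + k <= size qs)%N.
  elim: k => [|k IH] kq; first by rewrite addn0.
  rewrite addnS -addSn; apply: leq_trans (IH (ltnW kq)).
  by rewrite leq_add2r size_orbit_next // (live_le (ltnW kq) l).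
have := H _ (leqnn _); rewrite -[leqRHS]add0n leq_add2r leqn0 size_eq0 => /eqP st0.
by move: l; rewrite /live st0.
Qed.

Lemma orbit_feasible : feasible G qs (run (size qs) (qs, init_level G)).
Proof.
rewrite run_iter; split=> [t F /mapP[k]|q qqs].
  by rewrite mem_filter => /andP[lk _] [_ ->]; have [] := live_service lk.
have [k [kq qk nqk]] : exists k, [/\ (k < size qs)%N, q \in (st_ k).1 & q \notin (st_ k.+1).1].
  have : q \notin (st_ (size qs)).1 by rewrite orbit_end.
  elim: (size qs) => [|m IH]; first by rewrite /= qqs.
  case: (boolP (q \in (st_ m).1)) => [qm nq|nqm _]; first by exists m.
  by have [k [km ? ?]] := IH nqm; exists k; split=> //; exact: ltnW.
have lk : live k by rewrite /live; case: (st_ k).1 qk.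
exists (service_time (st_ k)), (sent (st_ k)); split.
- by apply/mapP; exists k => //; rewrite mem_filter mem_iota /= add0n kq andbT.
- move: nqk; rewrite mem_filter qk andbT negbK => /andP[-> _] /=.
  by have [_ _ ->] := targetP lk.
- by apply/satisfies_connects; move: nqk; rewrite mem_filter qk andbT negbK => /andP[].
Qed.

Lemma pairwise_distinct (T : eqType) (r : rel T) l : uniq l ->
  {in l &, forall x y, x != y -> r x y} -> pairwise r l.
Proof.
elim: l => //= x l IH /andP[xl ul] rl; apply/andP; split.
  apply/allP => y yl; apply: rl; rewrite ?inE ?eqxx ?yl ?orbT //.
  by apply: contraNneq xl => ->.
by apply: IH => // y z yl zl; apply: rl; rewrite inE ?yl ?zl orbT.
Qed.

(** The total received by one edge of one transmission, at time [t], from services of one kind.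
    Their budgets are pairwise apart, and those that charge lie below [edge_cost G e * 2 ^+ p]. *)
Lemma sum_charge_le p b m e t : (8 * (n * n) <= 2 ^ p)%N ->
  \sum_(k <- iota 0 m | [&& live k, window k t & primary k == b])
     charge (budget (st_ k)) e <= edge_cost G e *+ p.+2.
Proof.
move=> np; pose P k := [&& live k, window k t & primary k == b].
pose l := [seq budget (st_ k) | k <- iota 0 m & P k].
have c0 := edge_cost_ge0 G e.
apply: le_trans (@sum_min_apart_le R p l (edge_cost G e) _ _ c0).
- rewrite big_map big_filter_cond [leRHS]big_mkcondr /=.
  apply: ler_sum => k _; rewrite /charge; case: ltP => [lt|_]; last first.
    by case: ifP => // _; rewrite le_min c0 budget_ge0.
  rewrite ifT //; apply: lt_le_trans lt _; rewrite -natrX mulr_natr.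
  exact: ler_wpMn2l.
- rewrite pairwise_map; apply: pairwise_distinct; first exact/filter_uniq/iota_uniq.
  move=> j k; rewrite !mem_filter => /andP[/and3P[lj wj /eqP pj] _].
  move=> /andP[/and3P[lk wk /eqP pk] _] jk; apply: (windows_apart lj lk jk _ wj wk).
  by rewrite pj pk.
- by move=> x /mapP[k _ ->]; exact: budget_ge0.
Qed.

(** The factor 48 is 3 for the cost of a service relative to its budget, 8 for the budget relative
    to the charges, and 2 for the two kinds of service. *)
Lemma orbit_cost p s : (8 * (n * n) <= 2 ^ p)%N -> feasible G qs s ->
  schedule_cost G (run (size qs) (qs, init_level G)) <=
    schedule_cost G s *+ (48 * p.+2).
Proof.
move=> np sf; have [sE _] := sf; rewrite run_iter /schedule_cost big_map big_filter /=.
have costE (F : {set {set 'I_n}}) : F \subset edges G ->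
    transmission_cost G F = \sum_(e in F) edge_cost G e.
  move=> /fintype.subsetP FE; apply: eq_bigr => e /FE eE.
  by rewrite /edge_cost eE.
apply: (@le_trans _ _ (\sum_(k <- iota 0 (size qs) | live k)
   (\sum_(x <- s | window k x.1) \sum_(e in x.2) charge (budget (st_ k)) e) *+ 24)).
  apply: ler_sum => k lk; have [kE _ kc] := live_service lk.
  rewrite costE //; apply: le_trans kc _; rewrite (_ : 24 = 8 * 3)%N // mulrnA.
  exact/ler_wMn2r/window_charge.
rewrite sumrMnl (_ : 48 * _ = (2 * p.+2) * 24)%N; last first.
  by rewrite [RHS]mulnAC.
rewrite mulrnA; apply: ler_wMn2r.
rewrite (exchange_big_dep predT) //= big_seq [X in _ <= X *+ _]big_seq -sumrMnl.
apply: ler_sum => -[t F] /= xs; rewrite costE; last exact: sE xs.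
rewrite exchange_big /= -sumrMnl; apply: ler_sum => e eF.
rewrite (bigID primary) /= mul2n -addnn mulrnDr; apply: lerD.
  rewrite (eq_bigl (fun k => [&& live k, window k t & primary k == true])).
    exact: sum_charge_le.
  by move=> k; rewrite eqb_id andbA.
rewrite (eq_bigl (fun k => [&& live k, window k t & primary k == false])).
  exact: sum_charge_le.
by move=> k; rewrite eqbF_neg andbA.
Qed.

End Orbit.
End Run.

(** * Stability of plans under later releases *)

Lemma foldl_fixed (T : eqType) (S : Type) (f : S -> T -> S) (l : seq T) z :
  {in l, forall x, f z x = z} -> foldl f z l = z.
Proof.
elim: l => //= x l IH fz; rewrite fz ?mem_head //; apply: IH => y yl.
by apply: fz; rewrite inE yl orbT.
Qed.

Section Online.
Variables (R : realType) (n : nat) (G : network R n).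
Implicit Types (q r : request R n) (st : seq (request R n) * (request R n -> R)).
Implicit Types (p : request R n * R) (pl : seq (request R n * R)).

Lemma transmitted_cat pl pl' B q :
  {in pl', forall p, deadline q < release p.1} ->
  transmitted G (pl ++ pl') B q = transmitted G pl B q.
Proof.
move=> late; have nel p : p \in pl' -> eligible (deadline q) B p = false.
  by move=> /late lt; rewrite /eligible leNgt lt.
have gdE d : group_demand (pl ++ pl') (deadline q) B q d =
    group_demand pl (deadline q) B q d.
  apply/funext => x; apply/funext => y; rewrite /group_demand has_cat.
  rewrite (_ : has _ pl' = false) ?orbF //.
  by apply/negbTE/hasPn => p /nel ->.
rewrite /transmitted /best_group foldl_cat /affordable /group.
rewrite [foldl _ (foldl _ _ _) _]foldl_fixed => [|p /nel -> //].
congr (_.2 :|: _); congr (foldl _ _ _); apply/funext => acc; apply/funext => p.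
by rewrite gdE.
Qed.

Lemma run_ge m st (T : R) : {in st.1, forall r, T <= deadline r} ->
  {in run G m st, forall x, T <= x.1}.
Proof.
elim: m st => //= m IH st Tst x; have [st0|st_n0] := eqVneq st.1 [::].
  by rewrite st0.
have [_ tst _] := targetP st_n0.
have : x \in (service_time st, sent G st) :: run G m (next G st) -> T <= x.1.
  rewrite inE => /orP[/eqP -> /=|]; first exact: Tst.
  by apply: IH => r /next_sub/Tst.
by case: (st.1) st_n0.
Qed.

Lemma run_sorted m st : sorted <=%R [seq x.1 | x <- run G m st].
Proof.
elim: m st => //= m IH st; have [st0|st_n0] := eqVneq st.1 [::].
  by rewrite st0.
have [_ _ first] := targetP st_n0.
suff : sorted <=%R [seq x.1 | x <- (service_time st, sent G st) :: run G m (next G st)].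
  by case: (st.1) st_n0.
rewrite /= path_min_sorted //; apply/allP => t /mapP[x xr ->].
by apply: run_ge xr => r /next_sub/first.
Qed.

Lemma filter_lt_run_ge m st (T : R) : {in st.1, forall r, T <= deadline r} ->
  [seq x <- run G m st | x.1 < T] = [::].
Proof.
move=> /(@run_ge m) ge; apply/eqP; rewrite -(negbK (_ == _)) -has_filter.
by apply/hasPn => x /ge; rewrite -leNgt.
Qed.

(** Requests of [f] are invisible to services before [T], and their deadlines are too late to
    trigger one. The numbers [m1] and [m2] are only fuel, large enough to empty the lists. *)
Lemma run_prefix (T : R) m1 m2 s f lv : (size s <= m1)%N -> (size (s ++ f) <= m2)%N ->
  {in s ++ f, forall q, satisfies (together q) (edges G)} ->
  {in s ++ f, forall q, release q <= deadline q} ->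
  {in f, forall q, T <= release q} ->
  (forall q, init_level G q <= lv q) ->
  [seq x <- run G m1 (s, lv) | x.1 < T] =
  [seq x <- run G m2 (s ++ f, lv) | x.1 < T].
Proof.
elim: m1 m2 s lv => [|m1 IH] m2 s lv sm sfm sat timely late lvP.
  move: sm; rewrite leqn0 size_eq0 => /eqP s0.
  rewrite s0 run_nil [RHS]filter_lt_run_ge // => r rf.
  by rewrite (le_trans (late r rf)) // timely // mem_cat rf orbT.
have [s0|s_n0] := eqVneq s [::].
  rewrite s0 run_nil [RHS]filter_lt_run_ge // => r rf.
  by rewrite (le_trans (late r rf)) // timely // mem_cat rf orbT.
have [trg ts first] := @targetP R n (s, lv) s_n0.
have [dT|Td] := leP T (service_time (s, lv)).
  rewrite !filter_lt_run_ge // => r /=.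
    rewrite mem_cat => /orP[/first|rf]; first exact: le_trans.
    by rewrite (le_trans (late r rf)) // timely // mem_cat rf orbT.
  by move=> /first; exact: le_trans.
have sf_n0 : s ++ f != [::] by case: (s) s_n0.
have [trg' ts' first'] := @targetP R n (s ++ f, lv) sf_n0.
have tE : target (s ++ f, lv) = target (s, lv).
  rewrite {1}/target /= /argmin_seq foldl_cat -/(argmin_seq _ _ s).
  rewrite -/(argmin_seq predT (@deadline R n) s) trg /=.
  (* The strict inequality excludes ties, which the later elements of the list would win. *)
  have {}late : {in f, forall r, service_time (s, lv) < deadline r}.
    move=> r rf; apply: lt_le_trans Td (le_trans (late r rf) _).
    by rewrite timely // mem_cat rf orbT.
  by rewrite foldl_fixed // => r /late; rewrite ltNge => /negbTE ->.
have bE : budget (s ++ f, lv) = budget (s, lv) by rewrite /budget tE.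
have dE : service_time (s ++ f, lv) = service_time (s, lv) by rewrite /service_time tE.
have sE : sent G (s ++ f, lv) = sent G (s, lv).
  rewrite /sent tE bE /entries map_cat transmitted_cat // => p /mapP[r rf ->] /=.
  exact: lt_le_trans Td (late r rf).
have nE : next G (s ++ f, lv) = ((next G (s, lv)).1 ++ f, (next G (s, lv)).2).
  rewrite /next /raises /= sE dE bE filter_cat; congr (_ ++ _, _).
  apply/all_filterP/allP => r rf; rewrite /served negb_and -ltNge.
  by rewrite (lt_le_trans Td (late r rf)).
have runE m st : st.1 != [::] ->
    run G m.+1 st = (service_time st, sent G st) :: run G m (next G st).
  by case: st => -[].
have m2E : m2 = m2.-1.+1.
  by rewrite prednK // (leq_trans _ sfm) // size_cat ltn_addr // lt0n size_eq0.
have sub : {subset (next G (s, lv)).1 <= s} by exact: next_sub.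
have subf : {subset (next G (s, lv)).1 ++ f <= s ++ f}.
  by move=> r; rewrite !mem_cat => /orP[/sub ->|->]; rewrite ?orbT.
have sz : (size (next G (s, lv)).1 < size s)%N.
  apply: size_next => // q qs; first by apply: sat; rewrite mem_cat qs.
  by apply: timely; rewrite mem_cat qs.
rewrite m2E !runE //= -/(next G _) -/(next G _) nE sE dE Td; congr (_ :: _).
have {}IH := IH m2.-1 (next G (s, lv)).1 (next G (s, lv)).2.
rewrite -IH //.
- by rewrite -ltnS (leq_trans sz).
- rewrite -ltnS -m2E; apply: leq_trans sfm.
  by rewrite !size_cat ltn_add2r.
- by move=> r /subf/sat.
- by move=> r /subf/timely.
- by move=> q; apply: le_trans (lvP q) (level_next G (s, lv) q).
Qed.

Lemma filter_sorted_split (l : schedule R n) (a b : R) :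
  sorted <=%R [seq x.1 | x <- l] -> a <= b ->
  [seq x <- l | a <= x.1] =
  [seq x <- l | (a <= x.1) && (x.1 < b)] ++ [seq x <- l | b <= x.1].
Proof.
move=> + ab; elim: l => //= x l IH pl; rewrite IH; last exact: path_sorted pl.
have [bx|xb] := leP b x.1; last by rewrite andbT; case: ifP.
have -> : [seq y <- l | (a <= y.1) && (y.1 < b)] = [::].
  rewrite (@eq_in_filter _ _ pred0) ?filter_pred0 // => y yl.
  apply/negbTE; rewrite negb_and -leNgt (le_trans bx) ?orbT //.
  by have /allP := order_path_min le_trans pl; apply; apply: map_f.
by rewrite (le_trans ab bx).
Qed.

(** Each plan is followed until the next release, and by [run_prefix] it agrees with the final plan
    up to then; the pieces concatenate because transmission times are sorted. *)
Lemma online_run_steiner (qs : seq (request R n)) : valid_input qs ->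
  {in qs, forall q, satisfies (together q) (edges G)} ->
  online_run (steiner_plan G) [::] qs = steiner_plan G qs.
Proof.
move=> [srt /allP timely] sat.
have tr : transitive (fun q r => release q <= release r).
  by move=> x y z; exact: le_trans.
have H future past q : past ++ q :: future = qs ->
    online_run (steiner_plan G) past (q :: future) =
    [seq x <- steiner_plan G qs | release q <= x.1].
  elim: future past q => [|q' future IH] past q E.
    rewrite /= cats0 -cats1 E; apply: eq_filter => x; by rewrite andbT.
  have E' : rcons past q ++ q' :: future = qs by rewrite cat_rcons.
  have /andP[qq' q'f] : (release q <= release q') &&
      all (fun r => release q' <= release r) future.
    move: srt; rewrite -E => /(subseq_sorted tr (suffix_subseq _ _)) /= /andP[-> /=].
    exact: order_path_min.
  have -> : online_run (steiner_plan G) past [:: q, q' & future] =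
      [seq x <- steiner_plan G (rcons past q) | (release q <= x.1) &&
        all (fun r => x.1 < release r) (q' :: future)] ++
      online_run (steiner_plan G) (rcons past q) (q' :: future) by [].
  rewrite IH //.
  rewrite [RHS](@filter_sorted_split _ _ (release q')) //; last first.
    by rewrite steiner_planE run_sorted.
  congr (_ ++ _).
  have lateq' : {in q' :: future, forall r, release q' <= release r}.
    by move=> r; rewrite inE => /orP[/eqP ->|/(allP q'f)].
  transitivity [seq x <- [seq x <- steiner_plan G (rcons past q) | x.1 < release q']
     | release q <= x.1].
    rewrite -filter_predI; apply: eq_filter => x /=; congr (_ && _).
    apply/andP/idP => [[]//|xq']; split=> //; apply/allP => r rf.
    by apply: lt_le_trans xq' _; apply: lateq'; rewrite inE rf orbT.
  rewrite [RHS]filter_predI; congr [seq x <- _ | _].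
  rewrite -E' !steiner_planE; apply: run_prefix => //; rewrite ?E' //.
case: qs srt timely sat H => // q0 qs srt timely sat H.
(* Nothing is cut off at the start: no transmission precedes the first release. *)
rewrite (H qs [::] q0) //; apply/all_filterP/allP => x.
rewrite steiner_planE; apply: run_ge => r rq.
apply: le_trans (timely _ rq); move: rq; rewrite inE => /orP[/eqP -> //|].
by have /allP := order_path_min tr srt; apply.
Qed.

End Online.

(** * Polynomial time *)

Section Tasks.
Variable R : realType.
Notation val := (Defs.val R).
Notation store := (store R).

(* The code is parametric in its base register [k]: it reads its input from
   [k], leaves its output there, and does not touch the registers below. Time
   is bounded in terms of a parameter [N i] of the instance, so composing tasks
   requires no control of the sizes of intermediate results. *)
Definition task (I : Type) (N : I -> nat) (f g : I -> val) : Prop :=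
  exists (c : nat -> cmd) (p : {poly nat}), forall i k (st : store),
    st k = f i -> exists t st',
      [/\ exec (c k) st t st', st' k = g i,
          forall j, (j < k)%N -> st' j = st j & (t <= p.[N i])%N].

Lemma update_eq (st : store) x v : update st x v x = v.
Proof. by rewrite /update eqxx. Qed.

Lemma update_neq (st : store) x y v : y != x -> update st x v y = st y.
Proof. by rewrite /update => /negbTE ->. Qed.

Lemma update_lt (st : store) x y v : (y < x)%N -> update st x v y = st y.
Proof. by move=> yx; rewrite update_neq // ltn_eqF. Qed.

Section Combinators.
Variables (I : Type) (N : I -> nat).
Implicit Types f g h : I -> val.

Lemma eq_task f g g' : (forall i, g i = g' i) -> task N f g -> task N f g'.
Proof. by move=> /funext ->. Qed.

Lemma task_reindex (J : Type) (h : J -> I) f g :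
  task N f g -> task (fun j => N (h j)) (fun j => f (h j)) (fun j => g (h j)).
Proof. by move=> [c [p H]]; exists c, p => j; exact: H. Qed.

Lemma task_id f : task N f f.
Proof.
exists (fun k => Assign k (Var k)), 2%:P => i k st stk.
exists 2%N, (update st k (st k)); rewrite update_eq hornerC; split=> //.
- exact: ExecAssign.
- by move=> j jk; rewrite update_neq // ltn_eqF.
Qed.

Lemma task_comp f g h : task N f g -> task N g h -> task N f h.
Proof.
move=> [c1 [p1 H1]] [c2 [p2 H2]].
exists (fun k => Seq (c1 k) (c2 k)), (p1 + p2 + 1%:P) => i k st stk.
have [t1 [st1 [e1 r1 k1 b1]]] := H1 _ _ _ stk.
have [t2 [st2 [e2 r2 k2 b2]]] := H2 _ _ _ r1.
exists (t1 + t2).+1%N, st2; split=> //.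
- exact: ExecSeq e1 e2.
- by move=> j jk; rewrite k2 ?k1.
- by rewrite !hornerD hornerC -addn1 !leq_add.
Qed.

Lemma task_expr1 (e : expr -> expr) (F : val -> val) s f g :
  (forall st a, Defs.eval st (e a) = F (Defs.eval st a)) ->
  (forall x, expr_size (e (Var x)) = s) ->
  task N f g -> task N f (fun i => F (g i)).
Proof.
move=> eF es fg; apply: task_comp fg _.
exists (fun k => Assign k (e (Var k))), s.+1%:P => i k st stk.
exists s.+1, (update st k (F (g i))); rewrite update_eq hornerC; split=> //.
- have := ExecAssign k (e (Var k)) st.
  by rewrite eF /= stk es.
- by move=> j jk; rewrite update_neq // ltn_eqF.
Qed.

Lemma task_expr2 (e : expr -> expr -> expr) (F : val -> val -> val) s f g h :
  (forall st a b, Defs.eval st (e a b) = F (Defs.eval st a) (Defs.eval st b)) ->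
  (forall x y, expr_size (e (Var x) (Var y)) = s) ->
  task N f g -> task N f h -> task N f (fun i => F (g i) (h i)).
Proof.
move=> eF es [c1 [p1 H1]] [c2 [p2 H2]].
exists (fun k => Seq (Assign k.+1 (Var k)) (Seq (c1 k.+1)
  (Seq (Assign k.+2 (Var k)) (Seq (c2 k.+2)
    (Assign k (e (Var k.+1) (Var k.+2))))))), (p1 + p2 + (s + 9)%:P) => i k st stk.
have e0 := ExecAssign k.+1 (Var k) st; set st0 := update _ _ _ in e0.
have [t1 [st1 [e1 r1 k1 b1]]] := H1 i k.+1 st0 (etrans (update_eq _ _ _) stk).
have st1k : st1 k = f i by rewrite k1 // /st0 update_neq // ltn_eqF.
have e2 := ExecAssign k.+2 (Var k) st1; set st2 := update _ _ _ in e2.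
have [t3 [st3 [e3 r3 k3 b3]]] := H2 i k.+2 st2 (etrans (update_eq _ _ _) st1k).
have e4 := ExecAssign k (e (Var k.+1) (Var k.+2)) st3.
have st3k1 : st3 k.+1 = g i by rewrite k3 // /st2 update_neq ?ltn_eqF.
rewrite es eF /= st3k1 r3 in e4.
eexists; eexists; split.
- apply: ExecSeq e0 _; apply: ExecSeq e1 _; apply: ExecSeq e2 _.
  exact: ExecSeq e3 e4.
- exact: update_eq.
- move=> j jk; have jk1 := ltnW jk : (j < k.+1)%N.
  have jk2 := ltnW jk1 : (j < k.+2)%N.
  by rewrite update_lt // k3 // /st2 update_lt // k1 // /st0 update_lt.
- rewrite !hornerD hornerC /=; move: b1 b3; set a := p1.[_]; set b := p2.[_].
  by lia.
Qed.

Lemma task_cons f g h :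
  task N f g -> task N f h -> task N f (fun i => Defs.Cons (g i) (h i)).
Proof. exact: (@task_expr2 ECons (@Defs.Cons R) 3). Qed.

Lemma task_fst f g h : task N f (fun i => Defs.Cons (g i) (h i)) -> task N f g.
Proof.
exact: (@task_expr1 EHd (fun v => if v is Defs.Cons a _ then a else Defs.Nil) 2 f
  (fun i => Defs.Cons (g i) (h i))).
Qed.

Lemma task_snd f g h : task N f (fun i => Defs.Cons (g i) (h i)) -> task N f h.
Proof.
exact: (@task_expr1 ETl (fun v => if v is Defs.Cons _ a then a else Defs.Nil) 2 f
  (fun i => Defs.Cons (g i) (h i))).
Qed.

Lemma task_nil f : task N f (fun=> Defs.Nil).
Proof. exact: (@task_expr1 (fun=> ENil) (fun=> Defs.Nil) 1 f f _ _ (task_id f)). Qed.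

Lemma task_one f : task N f (fun=> Defs.Num 1).
Proof. exact: (@task_expr1 (fun=> EOne) (fun=> Defs.Num 1) 1 f f _ _ (task_id f)). Qed.

Lemma task_add f (x y : I -> R) : task N f (fun i => Defs.Num (x i)) ->
  task N f (fun i => Defs.Num (y i)) -> task N f (fun i => Defs.Num (x i + y i)).
Proof.
exact: (@task_expr2 EAdd (fun u v => match u, v with
  | Defs.Num a, Defs.Num b => Defs.Num (a + b) | _, _ => Defs.Nil end) 3).
Qed.

Lemma task_sub f (x y : I -> R) : task N f (fun i => Defs.Num (x i)) ->
  task N f (fun i => Defs.Num (y i)) -> task N f (fun i => Defs.Num (x i - y i)).
Proof.
exact: (@task_expr2 ESub (fun u v => match u, v with
  | Defs.Num a, Defs.Num b => Defs.Num (a - b) | _, _ => Defs.Nil end) 3).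
Qed.

Lemma task_le f (x y : I -> R) : task N f (fun i => Defs.Num (x i)) ->
  task N f (fun i => Defs.Num (y i)) -> task N f (fun i => val_of_bool R (x i <= y i)).
Proof.
exact: (@task_expr2 ELe (fun u v => match u, v with
  | Defs.Num a, Defs.Num b => val_of_bool R (a <= b) | _, _ => Defs.Nil end) 3).
Qed.

Lemma task_half f (x : I -> R) : task N f (fun i => Defs.Num (x i)) ->
  task N f (fun i => Defs.Num (x i / 2)).
Proof.
exact: (@task_expr1 EHalf (fun u => if u is Defs.Num a then Defs.Num (a / 2) else Defs.Nil) 2).
Qed.

Lemma task_zero f : task N f (fun=> Defs.Num 0).
Proof.
apply: eq_task (task_sub (task_one f) (task_one f)) => i.
by rewrite subrr.
Qed.

Lemma task_if f (b g h : I -> val) : task N f b -> task N f g -> task N f h ->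
  task N f (fun i => if truthy (b i) then g i else h i).
Proof.
move=> [c0 [p0 H0]] [c1 [p1 H1]] [c2 [p2 H2]].
exists (fun k => Seq (Assign k.+1 (Var k)) (Seq (c0 k.+1)
  (If (Var k.+1) (c1 k) (c2 k)))), (p0 + p1 + p2 + 6%:P) => i k st stk.
have e0 := ExecAssign k.+1 (Var k) st; set st0 := update _ _ _ in e0.
have [t1 [st1 [e1 r1 k1 b1]]] := H0 i k.+1 st0 (etrans (update_eq _ _ _) stk).
have st1k : st1 k = f i by rewrite k1 // /st0 update_neq // ltn_eqF.
have keep1 j : (j < k)%N -> st1 j = st j.
  by move=> jk; rewrite k1 1?ltnW // /st0 update_lt // ltnW.
have [t2 [st2 [e2 r2 k2 b2]]] : exists t st2,
    [/\ exec (if truthy (Defs.eval st1 (Var k.+1)) then c1 k else c2 k) st1 t st2,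
        st2 k = (if truthy (b i) then g i else h i),
        forall j, (j < k)%N -> st2 j = st1 j & (t <= p1.[N i] + p2.[N i])%N].
  rewrite /= r1; case: (truthy (b i)).
    have [t [st' [e r kp bd]]] := H1 _ _ _ st1k.
    by exists t, st'; split=> //; rewrite (leq_trans bd) ?leq_addr.
  have [t [st' [e r kp bd]]] := H2 _ _ _ st1k.
  by exists t, st'; split=> //; rewrite (leq_trans bd) ?leq_addl.
eexists; exists st2; split.
- apply: ExecSeq e0 _; apply: ExecSeq e1 _; exact: ExecIf e2.
- exact: r2.
- by move=> j jk; rewrite k2 // keep1.
- rewrite !hornerD hornerC /=; move: b1 b2.
  by set x := p1.[_]; set y := p2.[_]; set z := p0.[_]; lia.
Qed.

End Combinators.
(** Register [k] keeps the input, [k.+1] the remaining list, [k.+2] the accumulator, and the body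
    works from [k.+3] on. The invariant belongs to the instance type of the body, so the body need
    only meet a time bound in [N i] on states that satisfy it. *)
Lemma task_fold_inv (I : Type) (N : I -> nat) (f : I -> val)
    (A S : I -> Type) (encA : forall i, A i -> val) (encS : forall i, S i -> val)
    (inv : forall i, S i -> Prop) (step : forall i, S i -> A i -> S i)
    (l : forall i, seq (A i)) (s0 : forall i, S i) :
  (forall i, (size (l i) <= N i)%N) ->
  (forall i, inv i (s0 i)) ->
  (forall i s a, inv i s -> inv i (step i s a)) ->
  task N f (fun i => val_of_seq [seq encA i a | a <- l i]) ->
  task N f (fun i => encS i (s0 i)) ->
  task (fun x : {x : {i & (A i * S i)%type} | inv (tag x) (tagged x).2} =>
          N (tag (sval x)))
    (fun x => Defs.Cons (encA _ (tagged (sval x)).1)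
      (Defs.Cons (encS _ (tagged (sval x)).2) (f (tag (sval x)))))
    (fun x => encS _ (step _ (tagged (sval x)).2 (tagged (sval x)).1)) ->
  task N f (fun i => encS i (foldl (step i) (s0 i) (l i))).
Proof.
move=> sz inv0 invS [cl [pl Hl]] [cs [ps Hs]] [cb [pb Hb]].
pose body k := Seq (Assign k.+3 (ECons (EHd (Var k.+1)) (ECons (Var k.+2) (Var k))))
  (Seq (cb k.+3) (Seq (Assign k.+2 (Var k.+3)) (Assign k.+1 (ETl (Var k.+1))))).
have loop i k (la : seq (A i)) s st : inv i s -> st k = f i ->
    st k.+1 = val_of_seq [seq encA i a | a <- la] -> st k.+2 = encS i s ->
    exists t st', [/\ exec (While (Var k.+1) (body k)) st t st',
      st' k.+2 = encS i (foldl (step i) s la),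
      forall j, (j < k)%N -> st' j = st j &
      (t <= size la * (pb.[N i] + 20) + 2)%N].
  elim: la s st => [|a la IH] s st invs stk stl sts.
    exists 2%N, st; split=> //; first by apply: ExecWhileEnd; rewrite /= stl.
  have e0 := ExecAssign k.+3 (ECons (EHd (Var k.+1)) (ECons (Var k.+2) (Var k))) st.
  set st0 := update _ _ _ in e0.
  have st0k3 : st0 k.+3 = Defs.Cons (encA i a) (Defs.Cons (encS i s) (f i)).
    by rewrite /st0 update_eq /= stl sts stk.
  have [t1 [st1 [e1 r1 k1 b1]]] := Hb (exist _ (existT _ i (a, s)) invs) _ _ st0k3.
  rewrite /= in r1 b1.
  have e2 := ExecAssign k.+2 (Var k.+3) st1; set st2 := update _ _ _ in e2.
  have e3 := ExecAssign k.+1 (ETl (Var k.+1)) st2; set st3 := update _ _ _ in e3.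
  have keep j : (j < k.+1)%N -> st3 j = st j.
    move=> jk; have jk2 := ltnW jk : (j < k.+2)%N; have jk3 := ltnW jk2 : (j < k.+3)%N.
    by rewrite /st3 update_lt // /st2 update_lt // k1 // /st0 update_lt.
  have [] := IH (step i s a) st3.
  - exact: invS.
  - by rewrite keep.
  - by rewrite /st3 update_eq /= /st2 update_lt // k1 // /st0 update_lt // stl.
  - by rewrite /st3 update_neq ?gtn_eqF // /st2 update_eq /= r1.
  move=> t [st' [e r kp b]]; eexists; exists st'; split.
  - apply: ExecWhileStep e; first by rewrite /= stl.
    apply: ExecSeq e0 _; apply: ExecSeq e1 _; exact: ExecSeq e2 e3.
  - exact: r.
  - by move=> j jk; rewrite kp // keep // ltnW.
  - move: b1 b => /=; set x := pb.[_]; set y := size la; rewrite mulSn.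
    by set z := (y * _)%N; lia.
exists (fun k => Seq (Assign k.+1 (Var k)) (Seq (cl k.+1)
  (Seq (Assign k.+2 (Var k)) (Seq (cs k.+2) (Seq (While (Var k.+1) (body k))
    (Assign k (Var k.+2))))))), (pl + ps + 'X * (pb + 20%:P) + 20%:P) => i k st stk.
have e0 := ExecAssign k.+1 (Var k) st; set st0 := update _ _ _ in e0.
have [t1 [st1 [e1 r1 k1 b1]]] := Hl i k.+1 st0 (etrans (update_eq _ _ _) stk).
have st1k : st1 k = f i by rewrite k1 // /st0 update_lt.
have e2 := ExecAssign k.+2 (Var k) st1; set st2 := update _ _ _ in e2.
have [t3 [st3 [e3 r3 k3 b3]]] := Hs i k.+2 st2 (etrans (update_eq _ _ _) st1k).
have [||| t4 [st4 [e4 r4 k4 b4]]] := loop i k (l i) (s0 i) st3 (inv0 i).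
- by rewrite k3 // /st2 update_lt.
- by rewrite k3 // /st2 update_lt.
- exact: r3.
have e5 := ExecAssign k (Var k.+2) st4; rewrite /= r4 in e5.
eexists; eexists; split.
- apply: ExecSeq e0 _; apply: ExecSeq e1 _; apply: ExecSeq e2 _.
  apply: ExecSeq e3 _; exact: ExecSeq e4 e5.
- exact: update_eq.
- move=> j jk; have jk1 := ltnW jk : (j < k.+1)%N.
  have jk2 := ltnW jk1 : (j < k.+2)%N.
  by rewrite update_lt // k4 // k3 // /st2 update_lt // k1 // /st0 update_lt.
- rewrite !hornerD hornerM hornerX !hornerC hornerD hornerC.
  have := leq_mul (sz i) (leqnn (pb.[N i] + 20)).
  move: b1 b3 b4; rewrite /=; set x := pl.[_]; set y := ps.[_]; set z := pb.[_].
  by set u := (_ * _)%N; set v := (N i * _)%N; lia.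
Qed.

Section Derived.
Variables (I : Type) (N : I -> nat) (f : I -> val).

(** Variable binding: the bound value extends the instance and is pushed in front of the
    environment, while time is still measured by the original instance. *)
Lemma task_bind (A : I -> Type) (enc : forall i, A i -> val) g :
  task N f g ->
  task (fun x : {i & A i} => N (tag x))
    (fun x => Defs.Cons (enc _ (tagged x)) (f (tag x))) (fun x => g (tag x)).
Proof.
move=> fg; apply: (task_comp (g := fun x => f (tag x))).
  exact: task_snd (task_id _ _).
exact: (task_reindex (J := {i & A i}) (fun x => tag x) fg).
Qed.

Lemma task_bound (A : I -> Type) (enc : forall i, A i -> val) :
  task (fun x : {i & A i} => N (tag x))
    (fun x => Defs.Cons (enc _ (tagged x)) (f (tag x))) (fun x => enc _ (tagged x)).
Proof. exact: task_fst (task_id _ _). Qed.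

Lemma task_fold (A S : I -> Type) (encA : forall i, A i -> val)
    (encS : forall i, S i -> val) (step : forall i, S i -> A i -> S i)
    (l : forall i, seq (A i)) (s0 : forall i, S i) :
  (forall i, (size (l i) <= N i)%N) ->
  task N f (fun i => val_of_seq [seq encA i a | a <- l i]) ->
  task N f (fun i => encS i (s0 i)) ->
  task (fun x : {y : {i & S i} & A (tag y)} => N (tag (tag x)))
    (fun x => Defs.Cons (encA _ (tagged x))
      (Defs.Cons (encS _ (tagged (tag x))) (f (tag (tag x)))))
    (fun x => encS _ (step _ (tagged (tag x)) (tagged x))) ->
  task N f (fun i => encS i (foldl (step i) (s0 i) (l i))).
Proof.
move=> sz Tl Ts Tb; apply: (task_fold_inv (inv := fun _ _ => True)) Tl Ts _ => //.
exact: (task_reindex (fun x => existT (fun y : {i & S i} => A (tag y))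
  (existT S (tag (sval x)) (tagged (sval x)).2) (tagged (sval x)).1) Tb).
Qed.

Lemma task_rev (l : I -> seq val) : (forall i, (size (l i) <= N i)%N) ->
  task N f (fun i => val_of_seq (l i)) -> task N f (fun i => val_of_seq (rev (l i))).
Proof.
move=> sz Tl.
apply: (@eq_task _ _ _ (fun i => val_of_seq (foldl (fun s a => a :: s) [::] (l i)))).
  move=> i; congr val_of_seq; rewrite /rev.
  by elim: (l i) [::] => //= a s IH s'; rewrite IH.
apply: (@task_fold (fun=> val) (fun=> seq val) (fun _ => id) (fun=> @val_of_seq R)
  (fun _ s a => a :: s) l (fun=> [::])) => //.
- by under [X in task _ _ X]eq_fun do rewrite map_id.
- exact: task_nil.
apply: task_cons; first exact: task_fst (task_id _ _).
exact: task_fst (task_snd (task_id _ _)).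
Qed.

End Derived.

Section Booleans.
Variables (I : Type) (N : I -> nat) (f : I -> val).

Lemma task_ifb (b : I -> bool) g h : task N f (fun i => val_of_bool R (b i)) ->
  task N f g -> task N f h -> task N f (fun i => if b i then g i else h i).
Proof.
move=> Tb Tg Th; apply: eq_task (task_if Tb Tg Th) => i.
by case: (b i).
Qed.

Lemma task_false : task N f (fun=> val_of_bool R false).
Proof. exact: task_nil. Qed.

Lemma task_true : task N f (fun=> val_of_bool R true).
Proof. exact: task_one. Qed.

Lemma task_and (b c : I -> bool) : task N f (fun i => val_of_bool R (b i)) ->
  task N f (fun i => val_of_bool R (c i)) ->
  task N f (fun i => val_of_bool R (b i && c i)).
Proof.
move=> Tb Tc; apply: eq_task (task_ifb Tb Tc task_false) => i.
by case: (b i).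
Qed.

Lemma task_or (b c : I -> bool) : task N f (fun i => val_of_bool R (b i)) ->
  task N f (fun i => val_of_bool R (c i)) ->
  task N f (fun i => val_of_bool R (b i || c i)).
Proof.
move=> Tb Tc; apply: eq_task (task_ifb Tb task_true Tc) => i.
by case: (b i).
Qed.

Lemma task_neg (b : I -> bool) : task N f (fun i => val_of_bool R (b i)) ->
  task N f (fun i => val_of_bool R (~~ b i)).
Proof.
move=> Tb; apply: eq_task (task_ifb Tb task_false task_true) => i.
by case: (b i).
Qed.

Lemma task_imply (b c : I -> bool) : task N f (fun i => val_of_bool R (b i)) ->
  task N f (fun i => val_of_bool R (c i)) ->
  task N f (fun i => val_of_bool R (b i ==> c i)).
Proof.
move=> Tb Tc; apply: eq_task (task_ifb Tb Tc task_true) => i.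
by case: (b i).
Qed.

End Booleans.

Section Lists.
Variables (I : Type) (N : I -> nat) (f : I -> val).
Variables (A : I -> Type) (enc : forall i, A i -> val) (l : forall i, seq (A i)).
Hypothesis size_l : forall i, (size (l i) <= N i)%N.
Hypothesis Tl : task N f (fun i => val_of_seq [seq enc a | a <- l i]).

(** Removes the accumulator from the environment, so that a body written for a single element can
    run inside a fold. *)
Lemma task_skip (S : I -> Type) (encS : forall i, S i -> val)
    (g : forall i, A i -> val) :
  task (fun x : {i & A i} => N (tag x))
    (fun x => Defs.Cons (enc (tagged x)) (f (tag x)))
    (fun x => g (tag x) (tagged x)) ->
  task (fun x : {y : {i & S i} & A (tag y)} => N (tag (tag x)))
    (fun x => Defs.Cons (enc (tagged x))
      (Defs.Cons (encS _ (tagged (tag x))) (f (tag (tag x)))))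
    (fun x => g (tag (tag x)) (tagged x)).
Proof.
move=> Tg; apply: (task_comp (g := fun x : {y : {i & S i} & A (tag y)} =>
    Defs.Cons (enc (tagged x)) (f (tag (tag x))))).
  apply: task_cons; first exact: task_fst (task_id _ _).
  exact: task_snd (task_snd (task_id _ _)).
exact: (task_reindex (J := {y : {i & S i} & A (tag y)})
  (fun x => existT A (tag (tag x)) (tagged x)) Tg).
Qed.

Lemma task_map_filter (P : forall i, A i -> bool) (g : forall i, A i -> val) :
  task (fun x : {i & A i} => N (tag x))
    (fun x => Defs.Cons (enc (tagged x)) (f (tag x)))
    (fun x => val_of_bool R (P _ (tagged x))) ->
  task (fun x : {i & A i} => N (tag x))
    (fun x => Defs.Cons (enc (tagged x)) (f (tag x)))
    (fun x => g _ (tagged x)) ->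
  task N f (fun i => val_of_seq [seq g i a | a <- l i & P i a]).
Proof.
move=> TP Tg.
pose step i (s : seq val) (a : A i) := if P i a then g i a :: s else s.
have stepE i s' : foldl (step i) s' (l i) = catrev [seq g i a | a <- l i & P i a] s'.
  by elim: (l i) s' => //= a s IH s'; rewrite IH /step; case: (P i a).
apply: (@eq_task _ _ _ (fun i => val_of_seq (rev (foldl (step i) [::] (l i))))).
  by move=> i; rewrite stepE -/(rev _) revK.
apply: task_rev.
  move=> i; rewrite stepE -/(rev _) size_rev size_map size_filter.
  exact: leq_trans (count_size _ _) (size_l i).
apply: (@task_fold _ _ _ A (fun=> seq val) enc (fun=> @val_of_seq R) step l (fun=> [::])) => //.
  exact: task_nil.
have Ts := task_fst (task_snd (task_id (fun x : {y : {i & seq val} & A (tag y)} =>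
  N (tag (tag x))) (fun x => Defs.Cons (enc (tagged x))
      (Defs.Cons (val_of_seq (tagged (tag x))) (f (tag (tag x))))))).
apply: (@eq_task _ _ _ (fun x : {y : {i & seq val} & A (tag y)} =>
  if P _ (tagged x) then Defs.Cons (g _ (tagged x)) (val_of_seq (tagged (tag x)))
  else val_of_seq (tagged (tag x)))).
  by move=> x; rewrite /step; case: (P _ _).
apply: task_ifb; last exact: Ts.
  exact: (task_skip (g := fun i a => val_of_bool R (P i a)) (fun=> @val_of_seq R) TP).
apply: task_cons; last exact: Ts.
exact: (task_skip (fun=> @val_of_seq R) Tg).
Qed.

Lemma task_map (g : forall i, A i -> val) :
  task (fun x : {i & A i} => N (tag x))
    (fun x => Defs.Cons (enc (tagged x)) (f (tag x)))
    (fun x => g _ (tagged x)) ->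
  task N f (fun i => val_of_seq [seq g i a | a <- l i]).
Proof.
move=> Tg; apply: (@eq_task _ _ _ (fun i => val_of_seq [seq g i a | a <- l i & true])).
  by move=> i; rewrite filter_predT.
apply: (@task_map_filter (fun _ _ => true)) => //.
exact: task_one.
Qed.

Lemma task_has (P : forall i, A i -> bool) :
  task (fun x : {i & A i} => N (tag x))
    (fun x => Defs.Cons (enc (tagged x)) (f (tag x)))
    (fun x => val_of_bool R (P _ (tagged x))) ->
  task N f (fun i => val_of_bool R (has (P i) (l i))).
Proof.
move=> TP; pose step i (s : bool) (a : A i) := s || P i a.
apply: (@eq_task _ _ _ (fun i => val_of_bool R (foldl (step i) false (l i)))).
  move=> i; congr val_of_bool; rewrite -[RHS]orFb.
  by elim: (l i) false => [|a s IH] b /=; rewrite ?orbF // IH /step orbA.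
apply: (@task_fold _ _ _ A (fun=> bool) enc (fun=> val_of_bool R) step l (fun=> false)) => //.
  exact: task_nil.
apply: task_or; first exact: task_fst (task_snd (task_id _ _)).
exact: (task_skip (g := fun i a => val_of_bool R (P i a)) (fun=> val_of_bool R) TP).
Qed.

Lemma task_sum (g : forall i, A i -> R) :
  task (fun x : {i & A i} => N (tag x))
    (fun x => Defs.Cons (enc (tagged x)) (f (tag x)))
    (fun x => Defs.Num (g _ (tagged x))) ->
  task N f (fun i => Defs.Num (\sum_(a <- l i) g i a)).
Proof.
move=> Tg; pose step i (s : R) (a : A i) := s + g i a.
have stepE i s' : foldl (step i) s' (l i) = s' + \sum_(a <- l i) g i a.
  elim: (l i) s' => [|a s IH] s' /=; first by rewrite big_nil addr0.
  by rewrite IH /step big_cons addrA.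
apply: (@eq_task _ _ _ (fun i => Defs.Num (foldl (step i) 0 (l i)))).
  by move=> i; rewrite stepE add0r.
apply: (@task_fold _ _ _ A (fun=> R : Type) enc (fun=> @Defs.Num R) step l (fun=> 0)) => //.
  exact: task_zero.
apply: task_add; first exact: task_fst (task_snd (task_id _ _)).
exact: (task_skip (g := fun i a => Defs.Num (g i a)) (fun=> @Defs.Num R) Tg).
Qed.

End Lists.

Definition val_of_option (T : Type) (enc : T -> val) (s : option T) : val :=
  if s is Some a then enc a else Defs.Nil.

(** [None] is recognised by the test for [Nil], so encoded elements have to be truthy. *)
Lemma task_option (I : Type) (N : I -> nat) (f : I -> val) (A : I -> Type)
    (enc : forall i, A i -> val) (s : forall i, option (A i))
    (g : forall i, A i -> val) (h : I -> val) :
  (forall i a, truthy (enc i a)) ->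
  task N f (fun i => val_of_option (enc i) (s i)) ->
  task (fun x : {i & A i} => N (tag x))
    (fun x => Defs.Cons (enc _ (tagged x)) (f (tag x)))
    (fun x => g _ (tagged x)) ->
  task N f h ->
  task N f (fun i => if s i is Some a then g i a else h i).
Proof.
move=> enc_t [cs [ps Hs]] [cg [pg Hg]] [ch [ph Hh]].
exists (fun k => Seq (Assign k.+1 (Var k)) (Seq (cs k.+1) (If (Var k.+1)
  (Seq (Assign k.+1 (ECons (Var k.+1) (Var k)))
     (Seq (cg k.+1) (Assign k (Var k.+1)))) (ch k)))),
  (ps + pg + ph + 20%:P) => i k st stk.
have e0 := ExecAssign k.+1 (Var k) st; set st0 := update _ _ _ in e0.
have [t1 [st1 [e1 r1 k1 b1]]] := Hs i k.+1 st0 (etrans (update_eq _ _ _) stk).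
have st1k : st1 k = f i by rewrite k1 // /st0 update_lt.
have keep1 j : (j < k)%N -> st1 j = st j.
  by move=> jk; rewrite k1 1?ltnW // /st0 update_lt // ltnW.
case E : (s i) r1 => [a|] /= r1; last first.
  have [t2 [st2 [e2 r2 k2 b2]]] := Hh _ _ _ st1k.
  eexists; exists st2; split.
  - apply: ExecSeq e0 _; apply: ExecSeq e1 _; apply: ExecIf.
    by rewrite /= r1; exact: e2.
  - exact: r2.
  - by move=> j jk; rewrite k2 // keep1.
  - rewrite !hornerD hornerC /=; move: b1 b2.
    by set x := ps.[_]; set y := pg.[_]; set z := ph.[_]; lia.
have e2 := ExecAssign k.+1 (ECons (Var k.+1) (Var k)) st1; set st2 := update _ _ _ in e2.
have st2k : st2 k.+1 = Defs.Cons (enc i a) (f i) by rewrite /st2 update_eq /= r1 st1k.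
have [t3 [st3 [e3 r3 k3 b3]]] := Hg (existT A i a) _ _ st2k.
have e4 := ExecAssign k (Var k.+1) st3; rewrite /= r3 in e4.
eexists; eexists; split.
- apply: ExecSeq e0 _; apply: ExecSeq e1 _; apply: ExecIf.
  by rewrite /= r1 enc_t; apply: ExecSeq e2 _; exact: ExecSeq e3 e4.
- by rewrite update_eq.
- move=> j jk; have jk1 := ltnW jk : (j < k.+1)%N.
  by rewrite update_lt // k3 // /st2 update_lt // keep1.
- rewrite !hornerD hornerC /=; move: b1 b3 => /=.
  by set x := ps.[_]; set y := pg.[_]; set z := ph.[_]; lia.
Qed.

Lemma task_via (I J : Type) (h : J -> I) (N : I -> nat) (N' : J -> nat)
    (f g : I -> val) (f' : J -> val) :
  (forall j, N' j = N (h j)) -> task N' f' (fun j => f (h j)) -> task N f g ->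
  task N' f' (fun j => g (h j)).
Proof.
move=> NE Tf Tg; apply: task_comp Tf _.
have -> : N' = fun j => N (h j) by exact/funext.
exact: task_reindex Tg.
Qed.

Lemma task_argmin (I : Type) (N : I -> nat) (f : I -> val) (A : I -> Type)
    (enc : forall i, A i -> val) (l : forall i, seq (A i))
    (P : forall i, A i -> bool) (v : forall i, A i -> R) :
  (forall i a, truthy (enc i a)) ->
  (forall i, (size (l i) <= N i)%N) ->
  task N f (fun i => val_of_seq [seq enc i a | a <- l i]) ->
  task (fun x : {i & A i} => N (tag x))
    (fun x => Defs.Cons (enc _ (tagged x)) (f (tag x)))
    (fun x => val_of_bool R (P _ (tagged x))) ->
  task (fun x : {i & A i} => N (tag x))
    (fun x => Defs.Cons (enc _ (tagged x)) (f (tag x)))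
    (fun x => Defs.Num (v _ (tagged x))) ->
  task N f (fun i => val_of_option (enc i) (argmin_seq (P i) (v i) (l i))).
Proof.
move=> enc_t sz Tl TP Tv.
apply: (@task_fold _ _ _ A (fun i => option (A i)) enc (fun i => val_of_option (enc i))
  (fun i s x => if P i x && (if s is Some u then v i x <= v i u else true)
    then Some x else s) l (fun=> None)) => //.
  exact: task_nil.
pose J := {y : {i & option (A i)} & A (tag y)}.
pose N' : J -> nat := fun x => N (tag (tag x)).
pose f' : J -> val := fun x => Defs.Cons (enc _ (tagged x))
  (Defs.Cons (val_of_option (enc _) (tagged (tag x))) (f (tag (tag x)))).
rewrite -/J -/N' -/f'.
have Ta : task N' f' (fun x => enc _ (tagged x)) by exact: task_fst (task_id _ _).
have Ts : task N' f' (fun x => val_of_option (enc _) (tagged (tag x))).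
  exact: task_fst (task_snd (task_id _ _)).
have Tf : task N' f' (fun x => f (tag (tag x))).
  exact: task_snd (task_snd (task_id _ _)).
have Tw : task N' f' (fun x => Defs.Cons (enc _ (tagged x)) (f (tag (tag x)))).
  exact: task_cons.
apply: (@eq_task _ _ _ (fun x : J =>
  if P _ (tagged x) && (if tagged (tag x) is Some u then v _ (tagged x) <= v _ u else true)
  then enc _ (tagged x) else val_of_option (enc _) (tagged (tag x)))).
  by move=> x; case: ifP.
apply: (task_ifb _ Ta Ts); apply: task_and.
  exact: (task_via (h := fun x : J => existT A (tag (tag x)) (tagged x)) _ Tw TP).
apply: (@eq_task _ _ _ (fun x : J => if tagged (tag x) is Some u
    then val_of_bool R (v _ (tagged x) <= v _ u) else val_of_bool R true)).
  by move=> x; case: (tagged (tag x)).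
apply: (@task_option _ N' f' (fun x : J => A (tag (tag x)))
  (fun x => enc (tag (tag x))) (fun x => tagged (tag x))
  (fun x u => val_of_bool R (v _ (tagged x) <= v _ u))) => //; last exact: task_true.
pose K := {x : J & A (tag (tag x))}.
pose g' : K -> val := fun x => Defs.Cons (enc _ (tagged x)) (f' (tag x)).
have Tu : task (fun x : K => N' (tag x)) g' (fun x =>
    Defs.Cons (enc _ (tagged x)) (f (tag (tag (tag x))))).
  apply: task_cons; first exact: (task_bound _ _ (fun x : J => enc (tag (tag x)))).
  exact: (task_bind (fun x : J => enc (tag (tag x))) Tf).
cbv beta; rewrite -/K -/g'.
apply: (@task_le _ _ _ (fun x : K => v _ (tagged (tag x))) (fun x : K => v _ (tagged x))).
  exact: (task_via (h := fun x : K => existT A (tag (tag (tag x))) (tagged (tag x)))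
    _ (task_bind (fun x : J => enc (tag (tag x))) Tw) Tv).
exact: (task_via (h := fun x : K => existT A (tag (tag (tag x))) (tagged x)) _ Tu Tv).
Qed.

(** The index is counted down while the list is walked, in at most [n i] rounds. *)
Lemma task_get (I : Type) (N : I -> nat) (f : I -> val) (n : I -> nat)
    (v : forall i, 'I_(n i) -> val) (x : forall i, 'I_(n i)) :
  (forall i, (n i <= N i)%N) ->
  task N f (fun i => val_of_seq [seq v i y | y <- enum 'I_(n i)]) ->
  task N f (fun i => Defs.Num (x i)%:R) ->
  task N f (fun i => v i (x i)).
Proof.
move=> nN [cv [pv Hv]] [cx [px Hx]].
pose body k := Seq (Assign k.+1 (ESub (Var k.+1) EOne)) (Assign k.+2 (ETl (Var k.+2))).
have loop k m (s : seq val) st : (m <= size s)%N -> st k.+1 = Defs.Num m%:R ->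
    st k.+2 = val_of_seq s ->
    exists t st', [/\ exec (While (ELe EOne (Var k.+1)) (body k)) st t st',
      st' k.+2 = val_of_seq (drop m s),
      forall j, (j < k)%N -> st' j = st j & (t <= m * 20 + 10)%N].
  elim: m s st => [|m IH] s st ms stm sts.
    exists 4%N, st; split=> //; last by rewrite drop0.
    by apply: ExecWhileEnd; rewrite /= stm ler10.
  case: s ms sts => // a s ms sts.
  have e0 := ExecAssign k.+1 (ESub (Var k.+1) EOne) st.
  set st0 := update _ _ _ in e0.
  have e1 := ExecAssign k.+2 (ETl (Var k.+2)) st0; set st1 := update _ _ _ in e1.
  have [||| t [st' [e r kp b]]] := IH s st1.
  - exact: ms.
  - by rewrite /st1 update_lt // /st0 update_eq /= stm -natr1 addrK.
  - by rewrite /st1 update_eq /= /st0 update_neq ?gtn_eqF // sts.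
  eexists; exists st'; split.
  - apply: ExecWhileStep e; last exact: ExecSeq e0 e1.
    by rewrite /= stm ler1n.
  - exact: r.
  - move=> j jk; have jk1 := ltnW jk : (j < k.+1)%N.
    have jk2 := ltnW jk1 : (j < k.+2)%N.
    by rewrite kp // /st1 update_lt // /st0 update_lt.
  - by move: b; rewrite /= mulSn; lia.
exists (fun k => Seq (Assign k.+1 (Var k)) (Seq (cx k.+1)
  (Seq (Assign k.+2 (Var k)) (Seq (cv k.+2) (Seq (While (ELe EOne (Var k.+1)) (body k))
    (Assign k (EHd (Var k.+2)))))))), (pv + px + 'X * 20%:P + 30%:P) => i k st stk.
have e0 := ExecAssign k.+1 (Var k) st; set st0 := update _ _ _ in e0.
have [t1 [st1 [e1 r1 k1 b1]]] := Hx i k.+1 st0 (etrans (update_eq _ _ _) stk).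
have st1k : st1 k = f i by rewrite k1 // /st0 update_lt.
have e2 := ExecAssign k.+2 (Var k) st1; set st2 := update _ _ _ in e2.
have [t3 [st3 [e3 r3 k3 b3]]] := Hv i k.+2 st2 (etrans (update_eq _ _ _) st1k).
have xs : (x i < size [seq v i y | y <- enum 'I_(n i)])%N.
  by rewrite size_map size_enum_ord.
have [|| t4 [st4 [e4 r4 k4 b4]]] := loop k (x i) _ st3 (ltnW xs).
- by rewrite k3 // /st2 update_lt.
- exact: r3.
have e5 := ExecAssign k (EHd (Var k.+2)) st4.
rewrite /= r4 (drop_nth Defs.Nil xs) /= in e5.
eexists; eexists; split.
- apply: ExecSeq e0 _; apply: ExecSeq e1 _; apply: ExecSeq e2 _.
  apply: ExecSeq e3 _; exact: ExecSeq e4 e5.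
- by rewrite update_eq (nth_map (x i)) ?size_enum_ord // nth_ord_enum.
- move=> j jk; have jk1 := ltnW jk : (j < k.+1)%N.
  have jk2 := ltnW jk1 : (j < k.+2)%N.
  by rewrite update_lt // k4 // k3 // /st2 update_lt // k1 // /st0 update_lt.
- rewrite !hornerD hornerM hornerX !hornerC.
  have xN : (x i <= N i)%N by apply: leq_trans (nN i); exact: ltnW.
  move: b1 b3 b4 xN; rewrite /=; set a := pv.[_]; set b := px.[_].
  by lia.
Qed.

Definition val_of_ord (n : nat) (x : 'I_n) : val := Defs.Num (x%:R : R).

Definition val_of_pair (n : nat) (p : 'I_n * 'I_n) : val :=
  Defs.Cons (val_of_ord p.1) (val_of_ord p.2).

Lemma task_entry (I : Type) (N : I -> nat) (f : I -> val) (n : I -> nat)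
    (m : forall i, 'I_(n i) -> 'I_(n i) -> val) (x y : forall i, 'I_(n i)) :
  (forall i, (n i <= N i)%N) ->
  task N f (fun i => val_of_matrix (m i)) ->
  task N f (fun i => val_of_ord (x i)) -> task N f (fun i => val_of_ord (y i)) ->
  task N f (fun i => m i (x i) (y i)).
Proof.
move=> nN Tm Tx Ty; apply: (@task_get _ N f n (fun i => m i (x i)) y) => //.
exact: (task_get (v := fun i x => val_of_seq [seq m i x y | y <- enum 'I_(n i)])
  nN Tm Tx).
Qed.

Lemma task_eq_ord (I : Type) (N : I -> nat) (f : I -> val) (n : I -> nat)
    (x y : forall i, 'I_(n i)) :
  task N f (fun i => val_of_ord (x i)) -> task N f (fun i => val_of_ord (y i)) ->
  task N f (fun i => val_of_bool R (x i == y i)).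
Proof.
move=> Tx Ty; apply: eq_task (task_and (task_le Tx Ty) (task_le Ty Tx)) => i.
by congr val_of_bool; rewrite !ler_nat -eqn_leq.
Qed.

(** Loops over vertices or pairs require a list to run through and a bound on its length; pairs
    account for the square. *)
Definition vertices (I : Type) (N : I -> nat) (f : I -> val) (n : I -> nat) : Prop :=
  (forall i, (n i * n i <= N i)%N) /\
  task N f (fun i => val_of_seq [seq val_of_ord x | x <- enum 'I_(n i)]).

Section Vertices.
Variables (I : Type) (N : I -> nat) (f : I -> val) (n : I -> nat).
Hypothesis V : vertices N f n.

Lemma vertices_le i : (n i <= N i)%N.
Proof.
by case: V => /(_ i) + _; apply: leq_trans; case: (n i) => // m; rewrite leq_pmulr.
Qed.

Lemma size_vertices i : (size (enum 'I_(n i)) <= N i)%N.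
Proof. by rewrite size_enum_ord vertices_le. Qed.

Lemma vertices_bind (A : I -> Type) (enc : forall i, A i -> val) :
  vertices (fun x : {i & A i} => N (tag x))
    (fun x => Defs.Cons (enc _ (tagged x)) (f (tag x))) (fun x => n (tag x)).
Proof. by case: V => nN W; split=> [x|]; [exact: nN|exact: task_bind W]. Qed.

Lemma task_tab (g : forall i, 'I_(n i) -> val) :
  task (fun x : {i & 'I_(n i)} => N (tag x))
    (fun x => Defs.Cons (val_of_ord (tagged x)) (f (tag x)))
    (fun x => g _ (tagged x)) ->
  task N f (fun i => val_of_seq [seq g i x | x <- enum 'I_(n i)]).
Proof. exact: task_map size_vertices V.2 _. Qed.

Lemma task_exists (b : forall i, 'I_(n i) -> bool) :
  task (fun x : {i & 'I_(n i)} => N (tag x))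
    (fun x => Defs.Cons (val_of_ord (tagged x)) (f (tag x)))
    (fun x => val_of_bool R (b _ (tagged x))) ->
  task N f (fun i => val_of_bool R [exists x, b i x]).
Proof.
move=> Tb; apply: eq_task (task_has size_vertices V.2 Tb) => i.
congr val_of_bool; apply/hasP/existsP => [[x _ bx]|[x bx]]; first by exists x.
by exists x; rewrite // mem_enum.
Qed.

Lemma task_forall (b : forall i, 'I_(n i) -> bool) :
  task (fun x : {i & 'I_(n i)} => N (tag x))
    (fun x => Defs.Cons (val_of_ord (tagged x)) (f (tag x)))
    (fun x => val_of_bool R (b _ (tagged x))) ->
  task N f (fun i => val_of_bool R [forall x, b i x]).
Proof.
move=> Tb; apply: eq_task (task_neg (@task_exists (fun i x => ~~ b i x) (task_neg Tb))) => i.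
by congr val_of_bool; rewrite negb_exists; apply: eq_forallb => x; rewrite negbK.
Qed.

Lemma task_sum_ord (g : forall i, 'I_(n i) -> R) :
  task (fun x : {i & 'I_(n i)} => N (tag x))
    (fun x => Defs.Cons (val_of_ord (tagged x)) (f (tag x)))
    (fun x => Defs.Num (g _ (tagged x))) ->
  task N f (fun i => Defs.Num (\sum_x g i x)).
Proof.
move=> Tg; apply: eq_task (task_sum size_vertices V.2 Tg) => i.
by rewrite big_enum.
Qed.

Lemma task_iter (S : I -> Type) (enc : forall i, S i -> val)
    (step : forall i, S i -> S i) (s0 : forall i, S i) :
  task N f (fun i => enc i (s0 i)) ->
  task (fun x : {i & S i} => N (tag x))
    (fun x => Defs.Cons (enc _ (tagged x)) (f (tag x)))
    (fun x => enc _ (step _ (tagged x))) ->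
  task N f (fun i => enc i (iter (n i) (step i) (s0 i))).
Proof.
move=> Ts Tstep.
apply: (@eq_task _ _ _ (fun i => enc i (foldl (fun s _ => step i s) (s0 i) (enum 'I_(n i))))).
  move=> i; congr enc; rewrite -[in RHS](size_enum_ord (n i)).
  by elim: (enum _) (s0 i) => // a l IH s; rewrite [size _]/= iterSr -IH.
apply: (@task_fold _ _ _ (fun i => 'I_(n i)) S (fun i x => val_of_ord x) enc
  (fun i s _ => step i s) (fun i => enum 'I_(n i)) s0 size_vertices V.2 Ts).
apply: (task_via (h := fun x : {y : {i & S i} & 'I_(n (tag y))} => tag x) _ _ Tstep) => //.
exact: task_snd (task_id _ _).
Qed.

Lemma task_matrix (m : forall i, 'I_(n i) -> 'I_(n i) -> val) :
  task (fun x : {y : {i & 'I_(n i)} & 'I_(n (tag y))} => N (tag (tag x)))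
    (fun x => Defs.Cons (val_of_ord (tagged x))
      (Defs.Cons (val_of_ord (tagged (tag x))) (f (tag (tag x)))))
    (fun x => m _ (tagged (tag x)) (tagged x)) ->
  task N f (fun i => val_of_matrix (m i)).
Proof.
move=> Tm; apply: task_tab.
have W := vertices_bind (fun i (x : 'I_(n i)) => val_of_ord x).
have size_W (x : {i & 'I_(n i)}) : (size (enum 'I_(n (tag x))) <= N (tag x))%N.
  exact: size_vertices.
exact: (task_map size_W W.2 Tm).
Qed.

Lemma task_pairs :
  task N f (fun i => val_of_seq [seq val_of_pair p | p <- pairs (n i)]).
Proof.
pose S i := seq ('I_(n i) * 'I_(n i)).
pose encS i (s : S i) := val_of_seq [seq val_of_pair p | p <- s].
pose step i (s : S i) (x : 'I_(n i)) : S i :=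
  foldl (fun s y => (x, y) :: s) s (enum 'I_(n i)).
have stepE i s : foldl (step i) s (enum 'I_(n i)) = catrev (pairs (n i)) s.
  have inner x (l : seq 'I_(n i)) s' : foldl (fun s y => (x, y) :: s) s' l =
      catrev [seq (x, y) | y <- l] s'.
    by elim: l s' => //= a l IH s'; rewrite IH.
  suff H l1 : foldl (step i) s l1 = catrev [seq (x, y) | x <- l1, y <- enum 'I_(n i)] s.
    exact: H.
  elim: l1 s => //= a l IH s.
  by rewrite IH /step inner [RHS]catrevE rev_cat -catA -!catrevE.
apply: (@eq_task _ _ _ (fun i => val_of_seq (rev
    [seq val_of_pair p | p <- foldl (step i) [::] (enum 'I_(n i))]))).
  by move=> i; rewrite stepE -/(rev _) -map_rev revK.
apply: task_rev.
  move=> i; rewrite size_map stepE -/(rev _) size_rev size_allpairs !size_enum_ord.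
  by case: V => ->.
apply: (@task_fold _ _ _ (fun i => 'I_(n i)) S (fun i x => val_of_ord x) encS
  step (fun i => enum 'I_(n i)) (fun=> [::]) size_vertices V.2).
  exact: task_nil.
pose J := {y : {i & S i} & 'I_(n (tag y))}.
pose f' : J -> val := fun x => Defs.Cons (val_of_ord (tagged x))
  (Defs.Cons (encS _ (tagged (tag x))) (f (tag (tag x)))).
pose N' : J -> nat := fun x => N (tag (tag x)).
apply: (@task_fold J N' f' (fun x => 'I_(n (tag (tag x)))) (fun x => S (tag (tag x)))
  (fun x y => val_of_ord y) (fun x s => encS (tag (tag x)) s)
  (fun x s y => (tagged x, y) :: s) (fun x => enum 'I_(n (tag (tag x))))
  (fun x => tagged (tag x))).
- by move=> x; exact: size_vertices.
- apply: (task_via (h := fun x : J => tag (tag x)) _ _ V.2) => //.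
  exact: task_snd (task_snd (task_id _ _)).
- exact: task_fst (task_snd (task_id _ _)).
apply: task_cons; last exact: task_fst (task_snd (task_id _ _)).
apply: task_cons; last exact: task_fst (task_id _ _).
exact: task_fst (task_snd (task_snd (task_id _ _))).
Qed.

End Vertices.

End Tasks.

(** De Bruijn access to the environment: [bound0], [bound1] and so on read the bound values from the
    innermost outwards, and [lift1], [lift2], [lift3] move a task under that many binders. *)
Ltac bound0 H := match goal with |- task ?N ?f _ =>
  have H := task_fst (task_id N f) end.
Ltac bound1 H := match goal with |- task ?N ?f _ =>
  have H := task_fst (task_snd (task_id N f)) end.
Ltac bound2 H := match goal with |- task ?N ?f _ =>
  have H := task_fst (task_snd (task_snd (task_id N f))) end.
Ltac bound3 H := match goal with |- task ?N ?f _ =>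
  have H := task_fst (task_snd (task_snd (task_snd (task_id N f)))) end.

Lemma task_lift (R : realType) (I J : Type) (h : J -> I) (N : I -> nat) (N' : J -> nat)
    (f g : I -> Defs.val R) (f' : J -> Defs.val R) :
  task N' f' (fun j => f (h j)) -> task N f g -> (forall j, N' j = N (h j)) ->
  task N' f' (fun j => g (h j)).
Proof. by move=> Tf Tg NE; exact: task_via Tf Tg. Qed.

Ltac lift1 T H := match goal with |- task ?N ?f _ =>
  have H := task_lift (task_snd (task_id N f)) T (fun=> erefl) end.
Ltac lift2 T H := match goal with |- task ?N ?f _ =>
  have H := task_lift (task_snd (task_snd (task_id N f))) T (fun=> erefl) end.
Ltac lift3 T H := match goal with |- task ?N ?f _ =>
  have H := task_lift (task_snd (task_snd (task_snd (task_id N f)))) T (fun=> erefl) end.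

(** * Programs for connectivity and the primal-dual algorithm *)

Section GraphTasks.
Variable R : realType.
Notation val := (Defs.val R).

Definition val_of_rel (n : nat) (r : rel 'I_n) : val :=
  val_of_matrix (fun x y => val_of_bool R (r x y)).

Definition val_of_weight (n : nat) (w : {set 'I_n} -> R) : val :=
  val_of_matrix (fun x y : 'I_n => Defs.Num (w [set x; y]%SET)).

(** Reachability by repeated squaring: [k] rounds cover all paths of length at most [2 ^ k]. Taking
    [n] rounds is enough for simple paths and matches the loop of [task_iter]. *)
Definition squarings (n : nat) (F : {set {set 'I_n}}) (k : nat) : rel 'I_n :=
  iter k (fun M x y => [exists z, M x z && M z y])
    (fun x y => (x == y) || ([set x; y]%SET \in F)).

Lemma squarings_connect (n : nat) (F : {set {set 'I_n}}) x y :
  squarings F n x y = connect (edge_rel F) x y.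
Proof.
have sound k : forall u v, squarings F k u v -> connect (edge_rel F) u v.
  elim: k => [|k IH] u v /=.
    by case/orP => [/eqP ->|]; [exact: connect0|exact: connect1].
  by case/existsP => z /andP[/IH uz /IH]; exact: connect_trans.
have complete k : forall u p, path (edge_rel F) u p -> (size p <= 2 ^ k)%N ->
    squarings F k u (last u p).
  elim: k => [|k IH] u p.
    by case: p => [|v [|//]] /=; [rewrite eqxx|rewrite andbT => uv _; apply/orP; right].
  move=> pth sz; apply/existsP; exists (last u (take (2 ^ k) p)).
  move: pth; rewrite -{1}(cat_take_drop (2 ^ k) p) cat_path => /andP[p1 p2].
  apply/andP; split; first by apply: IH p1 _; rewrite size_take_min geq_minl.
  rewrite -{2}(cat_take_drop (2 ^ k) p) last_cat; apply: IH p2 _.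
  by rewrite size_drop leq_subLR addnn -mul2n -expnS.
apply/idP/idP; first exact: sound.
case/connectP => p pth ->; case/shortenP: pth => p' pth' u' _.
apply: complete => //; apply: leq_trans (ltnW (ltn_expl n (ltnSn 1))).
by have := max_card (mem (x :: p')); rewrite (card_uniqP u') card_ord; exact: ltnW.
Qed.

Section Conn.
Variables (I : Type) (N : I -> nat) (f : I -> val) (n : I -> nat).
Hypothesis V : vertices N f n.
Variable F : forall i, {set {set 'I_(n i)}}.
Hypothesis TF : task N f (fun i => val_of_edge_set R (F i)).

Lemma task_conn : task N f (fun i => val_of_rel (connect (edge_rel (F i)))).
Proof.
have nN := vertices_le V.
apply: (@eq_task _ _ _ _ (fun i => val_of_rel (squarings (F i) (n i)))).
  move=> i; congr val_of_matrix; apply/funext => x; apply/funext => y.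
  by rewrite squarings_connect.
apply: (task_iter V (S := fun i => rel 'I_(n i)) (enc := fun i r => val_of_rel r)).
  apply: (task_matrix V); bound1 Tx; bound0 Ty; lift2 TF TF2.
  by apply: task_or; [exact: task_eq_ord Tx Ty|exact: (task_entry _ TF2 Tx Ty)].
have V1 := vertices_bind V (fun i (r : rel 'I_(n i)) => val_of_rel r).
apply: (task_matrix V1).
have V2 := vertices_bind V1 (fun x (y : 'I_(n (tag x))) => val_of_ord R y).
have V3 := vertices_bind V2 (fun x (y : 'I_(n (tag (tag x)))) => val_of_ord R y).
cbv beta; apply: (task_exists V3).
bound0 Tz; bound1 Ty; bound2 Tx; bound3 TM.
apply: task_and; [exact: (task_entry _ TM Tx Tz)|exact: (task_entry _ TM Tz Ty)].
Qed.

Variable D : forall i, rel 'I_(n i).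
Arguments D : clear implicits.
Hypothesis TD : task N f (fun i => val_of_rel (D i)).

Lemma task_act :
  task N f (fun i => val_of_seq [seq val_of_bool R (act (D i) (F i) x) | x <- enum 'I_(n i)]).
Proof.
have nN := vertices_le V; have TC := task_conn.
have V1 := vertices_bind V (fun i (x : 'I_(n i)) => val_of_ord R x).
have V2 := vertices_bind V1 (fun x (y : 'I_(n (tag x))) => val_of_ord R y).
rewrite /act; apply: (task_tab V); apply: (task_exists V1); apply: (task_exists V2).
bound0 Tb; bound1 Ta; bound2 Tx; lift3 TC TC3; lift3 TD TD3.
apply: task_and; first exact: (task_entry _ TD3 Ta Tb).
apply: task_and; first exact: (task_entry _ TC3 Tx Ta).
by apply: task_neg; exact: (task_entry _ TC3 Tx Tb).
Qed.

Lemma task_satisfies : task N f (fun i => val_of_bool R (satisfies (D i) (F i))).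
Proof.
have nN := vertices_le V; have TC := task_conn.
have V1 := vertices_bind V (fun i (x : 'I_(n i)) => val_of_ord R x).
rewrite /satisfies; apply: (task_forall V); apply: (task_forall V1).
bound0 Ty; bound1 Tx; lift2 TC TC2; lift2 TD TD2.
apply: task_imply; [exact: (task_entry _ TD2 Tx Ty)|exact: (task_entry _ TC2 Tx Ty)].
Qed.

End Conn.

Lemma task_if_num (I : Type) (N : I -> nat) (f : I -> val) (b : I -> bool) (x y : I -> R) :
  task N f (fun i => val_of_bool R (b i)) ->
  task N f (fun i => Defs.Num (x i)) -> task N f (fun i => Defs.Num (y i)) ->
  task N f (fun i => Defs.Num (if b i then x i else y i)).
Proof.
move=> Tb Tx Ty; apply: eq_task (task_ifb Tb Tx Ty) => i.
by case: (b i).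
Qed.

Section Edges.
Variables (I : Type) (N : I -> nat) (f : I -> val) (n : I -> nat).
Variables (u v x y : forall i, 'I_(n i)).
Hypotheses (Tu : task N f (fun i => val_of_ord R (u i)))
  (Tv : task N f (fun i => val_of_ord R (v i)))
  (Tx : task N f (fun i => val_of_ord R (x i)))
  (Ty : task N f (fun i => val_of_ord R (y i))).

Lemma task_eq_edge :
  task N f (fun i => val_of_bool R ([set u i; v i]%SET == [set x i; y i]%SET)).
Proof.
apply: (@eq_task _ _ _ _ (fun i => val_of_bool R
    ((u i == x i) && (v i == y i) || (u i == y i) && (v i == x i)))).
  by move=> i; rewrite set2_eq.
by apply: task_or; apply: task_and; exact: task_eq_ord.
Qed.

End Edges.

Definition val_of_growth (n : nat) (st : {set {set 'I_n}} * ({set 'I_n} -> R)) : val :=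
  Defs.Cons (val_of_edge_set R st.1) (val_of_weight st.2).

Section Grow.
Variables (I : Type) (N : I -> nat) (f : I -> val) (n : I -> nat).
Hypothesis V : vertices N f n.
Variables (E : forall i, {set {set 'I_(n i)}}) (D : forall i, rel 'I_(n i)).
Arguments D : clear implicits.
Variable st : forall i, {set {set 'I_(n i)}} * ({set 'I_(n i)} -> R).
Hypotheses (TE : task N f (fun i => val_of_edge_set R (E i)))
  (TD : task N f (fun i => val_of_rel (D i)))
  (Tst : task N f (fun i => val_of_growth (st i))).

Lemma task_grow_step :
  task N f (fun i => val_of_growth (grow_step (E i) (D i) (st i))).
Proof.
have nN := vertices_le V.
have TF : task N f (fun i => val_of_edge_set R (st i).1) by exact: task_fst Tst.
have Tw : task N f (fun i => val_of_weight (st i).2) by exact: task_snd Tst.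
have TC := task_conn V TF; have TA := task_act V TF TD.
pose enc i (p : 'I_(n i) * 'I_(n i)) := val_of_pair R p.
have pairT : task (fun x : {i & 'I_(n i) * 'I_(n i)}%type => N (tag x))
    (fun x => Defs.Cons (enc _ (tagged x)) (f (tag x)))
    (fun x => Defs.Num (tight_time (D (tag x)) (st (tag x)).1 (st (tag x)).2
       (tagged x).1 (tagged x).2)).
  bound0 Tp; have Tu := task_fst Tp; have Tv := task_snd Tp.
  lift1 TA TA1; lift1 Tw Tw1.
  have Tauv := task_and (task_get _ TA1 Tu) (task_get _ TA1 Tv).
  have Tuv := task_entry _ Tw1 Tu Tv.
  apply: task_if_num; [exact: Tauv|apply: task_half; exact: Tuv|exact: Tuv].
have Tbest : task N f (fun i => val_of_option (@enc i)
    (argmin_seq (fun p => candidate (E i) (D i) (st i).1 p.1 p.2)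
       (fun p => tight_time (D i) (st i).1 (st i).2 p.1 p.2) (pairs (n i)))).
  apply: (@task_argmin _ _ _ _ (fun i => 'I_(n i) * 'I_(n i))%type enc (fun i => pairs (n i))
    (fun i p => candidate (E i) (D i) (st i).1 p.1 p.2)
    (fun i p => tight_time (D i) (st i).1 (st i).2 p.1 p.2)).
  - by [].
  - by move=> i; rewrite size_allpairs !size_enum_ord; case: V.
  - exact: task_pairs.
  - rewrite /candidate; bound0 Tp; have Tu := task_fst Tp; have Tv := task_snd Tp.
    lift1 TA TA1; lift1 TE TE1; lift1 TC TC1.
    apply: task_and; first exact: (task_entry _ TE1 Tu Tv).
    apply: task_and; first by apply: task_neg; exact: (task_entry _ TC1 Tu Tv).
    by apply: task_or; [exact: (task_get _ TA1 Tu)|exact: (task_get _ TA1 Tv)].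
  - exact: pairT.
apply: (@eq_task _ _ _ _ (fun i =>
    if argmin_seq (fun p => candidate (E i) (D i) (st i).1 p.1 p.2)
       (fun p => tight_time (D i) (st i).1 (st i).2 p.1 p.2) (pairs (n i)) is Some p
    then val_of_growth ([set p.1; p.2]%SET |: (st i).1,
        fun e => (st i).2 e -
          tight_time (D i) (st i).1 (st i).2 p.1 p.2 *+ load (D i) (st i).1 e)
    else val_of_growth (st i))).
  by move=> i; rewrite /grow_step; case: argmin_seq.
apply: (task_option (enc := enc) (g := fun i p => val_of_growth ([set p.1; p.2]%SET |: (st i).1,
        fun e => (st i).2 e -
          tight_time (D i) (st i).1 (st i).2 p.1 p.2 *+ load (D i) (st i).1 e))) => //.
have V1 := vertices_bind V enc; cbv beta; apply: task_cons => /=.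
  apply: (task_matrix V1); bound0 Ty; bound1 Tx; bound2 Tp; lift3 TF TF3.
  have Tu := task_fst Tp; have Tv := task_snd Tp.
  have T1 := task_or (task_eq_edge Tx Ty Tu Tv) (task_entry _ TF3 Tx Ty).
  by apply: eq_task (T1 _) => // x; rewrite in_setU1.
apply: (task_matrix V1); bound0 Ty; bound1 Tx.
lift3 TC TC3; lift3 TA TA3; lift3 Tw Tw3; lift2 pairT Tt.
have T0 := task_zero; move/(_ R _ _ _): T0 => T0.
have TAx := task_if_num (task_get _ TA3 Tx) Tt (T0 _ _ _).
have TAy := task_if_num (task_get _ TA3 Ty) Tt (T0 _ _ _).
have TCxy := task_neg (task_entry _ TC3 Tx Ty).
have Tl := task_if_num (TCxy _) (task_add (TAx _) (TAy _)) (T0 _ _ _).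
apply: eq_task (task_sub (task_entry _ Tw3 Tx Ty) (Tl _ _ _)) => //= x.
(* The load of a pair reduces to two activity tests. Diagonal entries are consistent too, since a
   vertex is connected to itself and the load is 0. *)
congr (Defs.Num (_ - _)); rewrite load2; case: ifP => // _.
by rewrite mulrnDr; congr (_ + _); case: (act _ _ _).
Qed.

End Grow.
Section Steiner.
Variables (I : Type) (N : I -> nat) (f : I -> val) (n : I -> nat).
Hypothesis V : vertices N f n.
Variables (E : forall i, {set {set 'I_(n i)}}) (D : forall i, rel 'I_(n i)).
Arguments D : clear implicits.
Variable w : forall i, {set 'I_(n i)} -> R.
Arguments w : clear implicits.
Hypotheses (TE : task N f (fun i => val_of_edge_set R (E i)))
  (TD : task N f (fun i => val_of_rel (D i)))
  (Tw : task N f (fun i => val_of_weight (w i))).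

Lemma task_grow : task N f (fun i => val_of_growth (grow (E i) (w i) (D i))).
Proof.
pose S i := ({set {set 'I_(n i)}} * ({set 'I_(n i)} -> R))%type.
(* Of the [n.+1] rounds, [task_iter] provides [n], and the last one is run separately. *)
apply: (task_grow_step V TE TD
  (st := fun i => iter (n i) (grow_step (E i) (D i)) (finset.set0, w i))).
apply: (task_iter V (S := S) (enc := fun i (s : S i) => val_of_growth s)).
  apply: task_cons Tw; apply: (task_matrix V).
  apply: eq_task (task_false _ _) => // x.
  by rewrite inE.
have V1 := vertices_bind V (fun i (s : S i) => val_of_growth s).
bound0 Ts; lift1 TE TE1; lift1 TD TD1.
exact: (task_grow_step V1 TE1 TD1 Ts).
Qed.

Lemma size_pairs_le i : (size (pairs (n i)) <= N i)%N.
Proof. by rewrite size_allpairs !size_enum_ord; case: V. Qed.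

Lemma task_prune (F : forall i, {set {set 'I_(n i)}}) :
  task N f (fun i => val_of_edge_set R (F i)) ->
  task N f (fun i => val_of_edge_set R (prune (D i) (F i))).
Proof.
move=> TF; pose S i := {set {set 'I_(n i)}}.
pose step i (s : S i) (p : 'I_(n i) * 'I_(n i)) : S i :=
  if satisfies (D i) (s :\ [set p.1; p.2]%SET) then s :\ [set p.1; p.2]%SET else s.
pose encA i (p : 'I_(n i) * 'I_(n i)) := val_of_pair R p.
apply: (@task_fold R I N f (fun i => 'I_(n i) * 'I_(n i))%type S encA
  (fun i (s : S i) => val_of_edge_set R s) step (fun i => pairs (n i)) F
  size_pairs_le (task_pairs V) TF).
have V1 := vertices_bind V (fun i (s : S i) => val_of_edge_set R s).
have V2 := vertices_bind V1 (fun x (p : 'I_(n (tag x)) * 'I_(n (tag x))) => val_of_pair R p).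
pose J := {y : {i & S i} & ('I_(n (tag y)) * 'I_(n (tag y)))%type}.
bound0 Tp; bound1 Ts; lift2 TD TD2.
have TF' : task (fun x : J => N (tag (tag x)))
    (fun x => Defs.Cons (encA _ (tagged x))
      (Defs.Cons (val_of_edge_set R (tagged (tag x))) (f (tag (tag x)))))
    (fun x => val_of_edge_set R (tagged (tag x) :\ [set (tagged x).1; (tagged x).2]%SET)).
  apply: (task_matrix V2); bound0 Ty; bound1 Tx; bound2 Tq; bound3 Ts2.
  have T1 := task_and (task_neg (task_eq_edge Tx Ty (task_fst Tq) (task_snd Tq)))
    (task_entry _ Ts2 Tx Ty).
  apply: eq_task (T1 _) => [x|x]; last exact: (vertices_le V).
  by rewrite finset.in_setD1.
have Tsat := task_satisfies V2 TF' TD2.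
apply: eq_task (task_ifb Tsat TF' Ts) => // x.
by rewrite /step; case: ifP.
Qed.

Lemma task_steiner : task N f (fun i => val_of_edge_set R (steiner (E i) (w i) (D i))).
Proof. by apply: task_prune; exact: task_fst task_grow. Qed.

Lemma task_pair_cost (F : forall i, {set {set 'I_(n i)}}) :
  task N f (fun i => val_of_edge_set R (F i)) ->
  task N f (fun i => Defs.Num (pair_cost (F i) (w i))).
Proof.
move=> TF; have nN := vertices_le V; apply: task_half; apply: (task_sum_ord V).
have V1 := vertices_bind V (fun i (x : 'I_(n i)) => val_of_ord R x).
apply: (task_sum_ord V1); bound0 Ty; bound1 Tx; lift2 TF TF2; lift2 Tw Tw2.
by apply: task_if_num (task_entry _ TF2 Tx Ty) (task_entry _ Tw2 Tx Ty) (task_zero _ _).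
Qed.

End Steiner.
End GraphTasks.

(** * Programs for services and the whole plan *)

Section OnlineTasks.
Variable R : realType.
Notation val := (Defs.val R).

Definition val_of_entry (n : nat) (p : request R n * R) : val :=
  Defs.Cons (val_of_request p.1) (Defs.Num p.2).

Section Requests.
Variables (I : Type) (N : I -> nat) (f : I -> val) (n : I -> nat).
Hypothesis V : vertices N f n.
Variable q : forall i, request R (n i).
Hypothesis Tq : task N f (fun i => val_of_request (q i)).

Lemma task_release : task N f (fun i => Defs.Num (release (q i))).
Proof. exact: (task_fst (task_snd Tq)). Qed.

Lemma task_deadline : task N f (fun i => Defs.Num (deadline (q i))).
Proof. exact: (task_snd (task_snd Tq)). Qed.

Lemma task_terminal (x : forall i, 'I_(n i)) :
  task N f (fun i => val_of_ord R (x i)) ->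
  task N f (fun i => val_of_bool R (x i \in terminals (q i))).
Proof. exact: (task_get (vertices_le V) (task_fst Tq)). Qed.

End Requests.

Lemma task_together (I : Type) (N : I -> nat) (f : I -> val) (n : I -> nat)
    (q : forall i, request R (n i)) : vertices N f n ->
  task N f (fun i => val_of_request (q i)) ->
  task N f (fun i => val_of_rel R (together (q i))).
Proof.
move=> V Tq; apply: (task_matrix V).
have V1 := vertices_bind V (fun i (x : 'I_(n i)) => val_of_ord R x).
have V2 := vertices_bind V1 (fun x (y : 'I_(n (tag x))) => val_of_ord R y).
bound0 Ty; bound1 Tx; lift2 Tq Tq2.
exact: (task_and (task_terminal V2 Tq2 Tx) (task_terminal V2 Tq2 Ty)).
Qed.

Lemma task_served (I : Type) (N : I -> nat) (f : I -> val) (n : I -> nat)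
    (t : I -> R) (F : forall i, {set {set 'I_(n i)}})
    (q : forall i, request R (n i)) : vertices N f n ->
  task N f (fun i => Defs.Num (t i)) ->
  task N f (fun i => val_of_edge_set R (F i)) ->
  task N f (fun i => val_of_request (q i)) ->
  task N f (fun i => val_of_bool R (served (t i) (F i) (q i))).
Proof.
move=> V Tt TF Tq; apply: (task_and (task_le (task_release Tq) Tt) _).
exact: (task_satisfies V TF (task_together V Tq)).
Qed.

Lemma task_eligible (I : Type) (N : I -> nat) (f : I -> val) (n : I -> nat)
    (t B : I -> R) (p : forall i, request R (n i) * R) :
  task N f (fun i => Defs.Num (t i)) -> task N f (fun i => Defs.Num (B i)) ->
  task N f (fun i => val_of_entry (p i)) ->
  task N f (fun i => val_of_bool R (eligible (t i) (B i) (p i))).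
Proof.
move=> Tt TB Tp; apply: (task_and (task_le (task_release (task_fst Tp)) Tt) _).
apply: (eq_task _ (task_neg (task_le TB (task_snd Tp)))) => i.
by rewrite ltNge.
Qed.

Section Network.
Variables (I : Type) (N : I -> nat) (f : I -> val) (n : I -> nat).
Hypothesis V : vertices N f n.
Variable G : forall i, network R (n i).
Hypotheses (TE : task N f (fun i => val_of_edge_set R (edges (G i))))
  (Tc : task N f (fun i => val_of_weight (edge_cost (G i)))).

Lemma task_solo (q : forall i, request R (n i)) :
  task N f (fun i => val_of_request (q i)) ->
  task N f (fun i => val_of_edge_set R (solo (G i) (q i))).
Proof. by move=> Tq; apply: (task_steiner V TE _ Tc); exact: task_together. Qed.

Lemma task_init_level (q : forall i, request R (n i)) :
  task N f (fun i => val_of_request (q i)) ->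
  task N f (fun i => Defs.Num (init_level (G i) (q i))).
Proof. by move=> Tq; apply: (task_pair_cost V Tc); exact: task_solo. Qed.

(** In the absence of multiplication, [n * n] times a cost is formed as a double sum of a constant
    over the vertices. *)
Lemma task_cheap (B : I -> R) (x y : forall i, 'I_(n i)) :
  task N f (fun i => Defs.Num (B i)) ->
  task N f (fun i => val_of_ord R (x i)) -> task N f (fun i => val_of_ord R (y i)) ->
  task N f (fun i => val_of_bool R (cheap (G i) (B i) [set x i; y i]%SET)).
Proof.
move=> TB Tx Ty; have Txy := task_entry (vertices_le V) Tc Tx Ty.
have V1 := vertices_bind V (fun i (x : 'I_(n i)) => val_of_ord R x).
have Ts : task N f (fun i => Defs.Num
    (\sum_(u : 'I_(n i)) \sum_(v : 'I_(n i)) edge_cost (G i) [set x i; y i]%SET)).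
  apply: (task_sum_ord V); apply: (task_sum_ord V1).
  by lift2 Txy Txy2; exact: Txy2.
apply: (eq_task _ (task_le Ts TB)) => i.
by rewrite /cheap !sumr_const !card_ord mulrnA.
Qed.

End Network.

Section Service.
Variables (I : Type) (N : I -> nat) (f : I -> val) (n : I -> nat).
Hypothesis V : vertices N f n.
Variable G : forall i, network R (n i).
Hypotheses (TE : task N f (fun i => val_of_edge_set R (edges (G i))))
  (Tc : task N f (fun i => val_of_weight (edge_cost (G i)))).
Variables (B : I -> R) (q : forall i, request R (n i)).
Hypotheses (TB : task N f (fun i => Defs.Num (B i)))
  (Tq : task N f (fun i => val_of_request (q i))).

Lemma task_reduced_cost : task N f (fun i => val_of_weight (reduced_cost (G i) (B i))).
Proof.
have nN := vertices_le V; apply: (task_matrix V).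
have V1 := vertices_bind V (fun i (x : 'I_(n i)) => val_of_ord R x).
have V2 := vertices_bind V1 (fun x (y : 'I_(n (tag x))) => val_of_ord R y).
bound0 Ty; bound1 Tx; lift2 TB TB2; lift2 Tc Tc2.
exact: (task_if_num (task_cheap V2 Tc2 TB2 Tx Ty) (task_zero _ _)
  (task_entry (vertices_le V2) Tc2 Tx Ty)).
Qed.

Lemma task_cheap_edges : task N f
  (fun i => val_of_edge_set R [set e in edges (G i) | cheap (G i) (B i) e]%SET).
Proof.
apply: (task_matrix V).
have V1 := vertices_bind V (fun i (x : 'I_(n i)) => val_of_ord R x).
have V2 := vertices_bind V1 (fun x (y : 'I_(n (tag x))) => val_of_ord R y).
bound0 Ty; bound1 Tx; lift2 TB TB2; lift2 Tc Tc2; lift2 TE TE2.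
apply: (eq_task _ (task_and (task_entry (vertices_le V2) TE2 Tx Ty)
  (task_cheap V2 Tc2 TB2 Tx Ty))) => x.
by rewrite inE.
Qed.

Section Group.
Variable pl : forall i, seq (request R (n i) * R).
Hypotheses (size_pl : forall i, (size (pl i) <= N i)%N)
  (Tpl : task N f (fun i => val_of_seq [seq val_of_entry p | p <- pl i])).
Variable d : I -> R.
Hypothesis Td : task N f (fun i => Defs.Num (d i)).

Lemma task_group_demand : task N f
  (fun i => val_of_rel R (group_demand (pl i) (deadline (q i)) (B i) (q i) (d i))).
Proof.
apply: (task_matrix V).
have V1 := vertices_bind V (fun i (x : 'I_(n i)) => val_of_ord R x).
have V2 := vertices_bind V1 (fun x (y : 'I_(n (tag x))) => val_of_ord R y).
have V3 := vertices_bind V2 (fun x (p : request R (n (tag (tag x))) * R) => val_of_entry p).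
bound0 Ty; bound1 Tx; lift2 Tq Tq2; lift2 Tpl Tpl2.
apply: task_or.
  exact: (task_and (task_terminal V2 Tq2 Tx) (task_terminal V2 Tq2 Ty)).
apply: (task_has (fun x => size_pl (tag (tag x))) Tpl2).
bound0 Tp; bound1 Ty3; bound2 Tx3; lift3 Tq Tq3; lift3 TB TB3; lift3 Td Td3.
have Tpq := task_fst Tp.
apply: (task_and (task_eligible (task_deadline Tq3) TB3 Tp) _).
apply: (task_and (task_le (task_deadline Tpq) Td3) _).
exact: (task_and (task_terminal V3 Tpq Tx3) (task_terminal V3 Tpq Ty3)).
Qed.

Lemma task_group : task N f
  (fun i => val_of_edge_set R (group (G i) (pl i) (deadline (q i)) (B i) (q i) (d i))).
Proof. exact: (task_steiner V TE task_group_demand task_reduced_cost). Qed.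

Lemma task_affordable : task N f
  (fun i => val_of_bool R (affordable (G i) (pl i) (deadline (q i)) (B i) (q i) (d i))).
Proof.
exact: (task_le (task_pair_cost V task_reduced_cost task_group) (task_add TB TB)).
Qed.

End Group.
End Service.

Section Transmission.
Variables (I : Type) (N : I -> nat) (f : I -> val) (n : I -> nat).
Hypothesis V : vertices N f n.
Variable G : forall i, network R (n i).
Hypotheses (TE : task N f (fun i => val_of_edge_set R (edges (G i))))
  (Tc : task N f (fun i => val_of_weight (edge_cost (G i)))).
Variables (B : I -> R) (q : forall i, request R (n i)).
Hypotheses (TB : task N f (fun i => Defs.Num (B i)))
  (Tq : task N f (fun i => val_of_request (q i))).
Variable pl : forall i, seq (request R (n i) * R).
Hypotheses (size_pl : forall i, (size (pl i) <= N i)%N)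
  (Tpl : task N f (fun i => val_of_seq [seq val_of_entry p | p <- pl i])).

Lemma task_best_group : task N f (fun i =>
  Defs.Cons (Defs.Num (best_group (G i) (pl i) (B i) (q i)).1)
    (val_of_edge_set R (best_group (G i) (pl i) (B i) (q i)).2)).
Proof.
pose S i := (R * {set {set 'I_(n i)}})%type.
pose enc i (s : S i) : val := Defs.Cons (Defs.Num s.1) (val_of_edge_set R s.2).
apply: (@task_fold R I N f (fun i => request R (n i) * R)%type S
  (fun i p => val_of_entry p) enc (fun i acc p =>
      if [&& eligible (deadline (q i)) (B i) p,
             affordable (G i) (pl i) (deadline (q i)) (B i) (q i) (deadline p.1) &
             acc.1 <= deadline p.1]
      then (deadline p.1, group (G i) (pl i) (deadline (q i)) (B i) (q i) (deadline p.1)) else acc)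
  pl (fun i => (deadline (q i), solo (G i) (q i))) size_pl Tpl).
  exact: (task_cons (task_deadline Tq) (task_solo V TE Tc Tq)).
have V1 := vertices_bind V enc.
have V2 := vertices_bind V1 (fun x (p : request R (n (tag x)) * R) => val_of_entry p).
bound0 Tp; bound1 Ts; lift2 TE TE2; lift2 Tc Tc2; lift2 Tq Tq2; lift2 TB TB2; lift2 Tpl Tpl2.
have Tpq := task_fst Tp; have Td := task_deadline Tpq.
have sz := fun x : {y : {i & S i} & (request R (n (tag y)) * R)%type} => size_pl (tag (tag x)).
have Tg := task_group V2 TE2 Tc2 TB2 Tq2 sz Tpl2 Td.
have Ta := task_affordable V2 TE2 Tc2 TB2 Tq2 sz Tpl2 Td.
have Te := task_eligible (task_deadline Tq2) TB2 Tp.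
have Tb := task_and Te (task_and Ta (task_le (task_fst Ts) Td)).
apply: (eq_task _ (task_ifb Tb (task_cons Td Tg) Ts)) => x.
by case: ifP.
Qed.

Lemma task_transmitted :
  task N f (fun i => val_of_edge_set R (transmitted (G i) (pl i) (B i) (q i))).
Proof.
have T1 := task_snd task_best_group; have T2 := task_cheap_edges V TE Tc TB.
apply: (task_matrix V).
bound0 Ty; bound1 Tx; lift2 T1 T12; lift2 T2 T22.
have nN := fun x : {y : {i & 'I_(n i)} & 'I_(n (tag y))} => vertices_le V (tag (tag x)).
apply: (eq_task _ (task_or (task_entry nN T12 Tx Ty) (task_entry nN T22 Tx Ty))) => x.
by rewrite finset.in_setU.
Qed.

End Transmission.
Definition val_of_state (n : nat) (st : seq (request R n * R) * schedule R n) : val :=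
  Defs.Cons (val_of_seq [seq val_of_entry p | p <- st.1]) (val_of_schedule st.2).

Lemma task_serve (I : Type) (N : I -> nat) (f : I -> val) (n : I -> nat)
    (G : forall i, network R (n i))
    (st : forall i, seq (request R (n i) * R) * schedule R (n i)) :
  vertices N f n ->
  task N f (fun i => val_of_edge_set R (edges (G i))) ->
  task N f (fun i => val_of_weight (edge_cost (G i))) ->
  (forall i, (size (st i).1 <= N i)%N) ->
  task N f (fun i => val_of_state (st i)) ->
  task N f (fun i => val_of_state (serve (G i) (st i))).
Proof.
move=> V TE Tc sz Tst; have Tpl := task_fst Tst; have Tout := task_snd Tst.
pose A i := (request R (n i) * R)%type; pose enc i (p : A i) := val_of_entry p.
have Ttrig : task N f (fun i => val_of_option (@enc i) (trigger (st i).1)).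
  apply: (@task_argmin _ _ _ _ A enc (fun i => (st i).1) (fun _ _ => true)
    (fun i p => deadline p.1)) => //; first exact: task_true.
  by bound0 Tp; exact: (task_deadline (task_fst Tp)).
pose g i (p : A i) := val_of_state
  (let t := deadline p.1 in let B := p.2 + p.2 in
   let F := transmitted (G i) (st i).1 B p.1 in
   ([seq raised t B p' | p' <- (st i).1 & ~~ served t F p'.1], (t, F) :: (st i).2)).
apply: (@eq_task _ _ _ _ (fun i => if trigger (st i).1 is Some p then g i p
    else val_of_state (st i))).
  by move=> i; rewrite /serve; case: (trigger _).
apply: (task_option (enc := enc) (g := g)) => //.
have V1 := vertices_bind V enc.
bound0 Tp; lift1 TE TE1; lift1 Tc Tc1; lift1 Tpl Tpl1; lift1 Tout Tout1.
have Tq := task_fst Tp; have TB := task_add (task_snd Tp) (task_snd Tp).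
have Tt := task_deadline Tq.
have sz1 := fun x : {i & A i} => sz (tag x).
have TF := task_transmitted V1 TE1 Tc1 TB Tq sz1 Tpl1.
apply: task_cons; last exact: (task_cons (task_cons Tt TF) Tout1).
pose A2 (x : {i & A i}) := A (tag x).
have V2 := vertices_bind V1 (fun x (p : A2 x) => val_of_entry p).
apply: (eq_task (g := fun x : {i & A i} => val_of_seq [seq val_of_entry
    (raised (deadline (tagged x).1) ((tagged x).2 + (tagged x).2) p') |
    p' <- (st (tag x)).1 & ~~ served (deadline (tagged x).1)
       (transmitted (G (tag x)) (st (tag x)).1 ((tagged x).2 + (tagged x).2) (tagged x).1) p'.1])).
  by move=> x /=; rewrite -map_comp.
apply: (task_map_filter (A := A2) (enc := fun x (p : A2 x) => val_of_entry p)
  (l := fun x => (st (tag x)).1) sz1 Tpl1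
  (P := fun x p' => ~~ served (deadline (tagged x).1)
       (transmitted (G (tag x)) (st (tag x)).1 ((tagged x).2 + (tagged x).2) (tagged x).1) p'.1)
  (g := fun x p' => val_of_entry
    (raised (deadline (tagged x).1) ((tagged x).2 + (tagged x).2) p'))).
  bound0 Tp'; lift1 Tt Tt2; lift1 TF TF2.
  exact: (task_neg (task_served V2 Tt2 TF2 (task_fst Tp'))).
bound0 Tp'; lift1 Tt Tt2; lift1 TB TB2.
exact: (task_cons (task_fst Tp') (task_if_num (task_eligible Tt2 TB2 Tp') TB2 (task_snd Tp'))).
Qed.

Lemma size_serve (n : nat) (G : network R n) st :
  (size (serve G st).1 <= size st.1)%N /\ (size (serve G st).2 <= (size st.2).+1)%N.
Proof.
rewrite /serve; case: (trigger _) => [p|] /=; last by rewrite leqnSn.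
by rewrite size_map size_filter count_size.
Qed.

Lemma val_size_seq (vs : seq val) :
  val_size (val_of_seq vs) = (\sum_(v <- vs) (val_size v).+1).+1%N.
Proof.
elim: vs => [|v vs IH]; first by rewrite big_nil.
by rewrite /= IH big_cons addnS addSn.
Qed.

Lemma size_le_val_size (vs : seq val) : (size vs <= val_size (val_of_seq vs))%N.
Proof.
rewrite val_size_seq -sum1_size; apply: leqW.
exact: leq_sum.
Qed.

Definition instance := {n : nat & (network R n * seq (request R n))%type}.

Lemma size_steiner_plan (n : nat) (G : network R n) (qs : seq (request R n)) :
  (size (steiner_plan G qs) <= size qs)%N.
Proof.
rewrite size_rev -[leqRHS]addn0 -[X in (_ + X)%N]/(size ([::] : schedule R n)).
set st := (_, [::]); rewrite -[size [::]]/(size st.2).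
elim: (size qs) => // m IH; rewrite iterS addSn.
by apply: leq_trans (proj2 (size_serve _ _)) _; rewrite ltnS.
Qed.

Section Plan.
Let I := instance.
Let n (i : I) : nat := tag i.
Let G (i : I) : network R (n i) := (tagged i).1.
Let qs (i : I) : seq (request R (n i)) := (tagged i).2.
Let f (i : I) : val := val_of_input (G i) (qs i).
Let N (i : I) : nat := val_size (f i).

(** The network is given by a full matrix, so even without edges the input has at least [n * n]
    leaves. *)
Lemma instance_size i : (n i * n i <= N i)%N /\ (size (qs i) <= N i)%N.
Proof.
rewrite /N /=; split; last first.
  apply: leqW; apply: leq_trans (leq_addl _ _).
  by rewrite -(size_map (@val_of_request R _)) size_le_val_size.
apply: leqW; apply: leq_trans (leq_addr _ _).
rewrite /val_of_network /val_of_matrix val_size_seq big_map; apply: leqW.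
rewrite -[X in (X * _)%N](size_enum_ord (n i)) -sum1_size big_distrl /=.
apply: leq_sum => j _; rewrite mul1n; apply: leqW.
by apply: leq_trans (size_le_val_size _); rewrite size_map size_enum_ord.
Qed.

(** The input does not list the vertices. Their number is counted up along the rows of the matrix,
    then counted down while the list is built from its end. *)
Lemma instance_vertices : vertices N f n.
Proof.
split=> [i|]; first by case: (instance_size i).
pose rows (i : I) := [seq val_of_seq [seq if [set x; y]%SET \in edges (G i)
  then Defs.Num (cost (G i) [set x; y]%SET) else Defs.Nil | y <- enum 'I_(n i)] |
  x <- enum 'I_(n i)].
have n_le i : (n i <= N i)%N.
  by case: (instance_size i) => + _; apply: leq_trans; case: (n i) => // m; rewrite leq_pmulr.
have size_rows i : (size (rows i) <= N i)%N by rewrite size_map size_enum_ord.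
have Trows : task N f (fun i => val_of_seq [seq id r | r <- rows i]).
  apply: (eq_task (g := fun i => val_of_seq (rows i))) => [i|]; first by rewrite map_id.
  exact: (task_fst (task_id N f)).
pose up (i : I) (x : R) (_ : val) := x + 1.
have Tn : task N f (fun i => Defs.Num (foldl (up i) 0 (rows i))).
  apply: (@task_fold R I N f (fun=> val) (fun=> R : Type) (fun=> id) (fun=> @Defs.Num R)
    up rows (fun=> 0) size_rows Trows (task_zero _ _)).
  by bound1 Ts; exact: (task_add Ts (task_one _ _)).
have upE i (l : seq val) x : foldl (up i) x l = x + (size l)%:R.
  elim: l x => [|v l IH] x /=; first by rewrite addr0.
  by rewrite IH /up -addrA nat1r.
pose down (i : I) (s : R * seq val) (_ : val) := (s.1 - 1, Defs.Num (s.1 - 1) :: s.2).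
have Td : task N f (fun i => Defs.Cons
    (Defs.Num (foldl (down i) (foldl (up i) 0 (rows i), [::]) (rows i)).1)
    (val_of_seq (foldl (down i) (foldl (up i) 0 (rows i), [::]) (rows i)).2)).
  apply: (@task_fold R I N f (fun=> val) (fun=> (R * seq val)%type) (fun=> id)
    (fun _ s => Defs.Cons (Defs.Num s.1) (val_of_seq s.2)) down rows
    (fun i => (foldl (up i) 0 (rows i), [::])) size_rows Trows).
    exact: (task_cons Tn (task_nil _ _)).
  bound1 Ts; have T1 := task_sub (task_fst Ts) (task_one _ _).
  exact: (task_cons T1 (task_cons T1 (task_snd Ts))).
apply: (eq_task _ (task_snd Td)) => i.
have downE (l : seq val) acc : (foldl (down i) ((size l)%:R, acc) l).2 =
    [seq Defs.Num (j%:R : R) | j <- iota 0 (size l)] ++ acc.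
  elim: l acc => // a l IH acc.
  rewrite (_ : size (a :: l) = size l + 1)%N ?addn1 // -addn1.
  by rewrite iotaD map_cat -catA add0n /= -IH {2}/down /= natrD addrK.
rewrite upE add0r downE cats0 size_map size_enum_ord -val_enum_ord -map_comp.
by congr val_of_seq; apply: eq_map.
Qed.

Lemma instance_entries : task N f (fun i => val_of_matrix (fun x y : 'I_(n i) =>
  if [set x; y]%SET \in edges (G i) then Defs.Num (cost (G i) [set x; y]%SET) else Defs.Nil)).
Proof. exact: (task_fst (task_id N f)). Qed.

Lemma instance_edges : task N f (fun i => val_of_edge_set R (edges (G i))).
Proof.
have V := instance_vertices; have TG := instance_entries.
apply: (task_matrix V); bound0 Ty; bound1 Tx; lift2 TG TG2.
have nN := fun x : {y : {i & 'I_(n i)} & 'I_(n (tag y))} => vertices_le V (tag (tag x)).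
apply: (eq_task _ (task_if (task_entry nN TG2 Tx Ty) (task_one _ _) (task_nil _ _))) => x.
by case: (_ \in edges _).
Qed.

Lemma instance_costs : task N f (fun i => val_of_weight (edge_cost (G i))).
Proof.
have V := instance_vertices; have TG := instance_entries.
apply: (task_matrix V); bound0 Ty; bound1 Tx; lift2 TG TG2.
have nN := fun x : {y : {i & 'I_(n i)} & 'I_(n (tag y))} => vertices_le V (tag (tag x)).
have Txy := task_entry nN TG2 Tx Ty.
apply: (eq_task _ (task_if Txy Txy (task_zero _ _))) => x.
by rewrite /edge_cost; case: (_ \in edges _).
Qed.

Lemma task_plan : task N f (fun i => val_of_schedule (steiner_plan (G i) (qs i))).
Proof.
have V := instance_vertices; have TE := instance_edges; have Tc := instance_costs.
have szq i : (size (qs i) <= N i)%N by case: (instance_size i).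
have Tqs : task N f (fun i => val_of_seq [seq val_of_request q | q <- qs i]).
  exact: (task_snd (task_id N f)).
pose S i := (seq (request R (n i) * R) * schedule R (n i))%type.
pose s0 i : S i := ([seq (q, init_level (G i) q) | q <- qs i], [::]).
have T0 : task N f (fun i => val_of_state (s0 i)).
  apply: (task_cons _ (task_nil _ _)).
  apply: (eq_task (g := fun i => val_of_seq
    [seq val_of_entry (q, init_level (G i) q) | q <- qs i])).
    by move=> i /=; rewrite -map_comp.
  apply: (task_map (A := fun i => request R (n i)) (enc := fun i q => val_of_request q) szq Tqs).
  bound0 Tq; lift1 TE TE1; lift1 Tc Tc1.
  have V1 := vertices_bind V (fun i (q : request R (n i)) => val_of_request q).
  exact: (task_cons Tq (task_init_level V1 TE1 Tc1 Tq)).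
(* The requests act as a counter of rounds. The invariant keeps the pending list no longer than the
   input, which bounds the loops inside [serve]. *)
pose step i (s : S i) (q : request R (n i)) : S i := serve (G i) s.
pose inv i (s : S i) : Prop := (size s.1 <= size (qs i))%N.
have Tloop : task N f (fun i => val_of_state (foldl (step i) (s0 i) (qs i))).
  apply: (task_fold_inv (A := fun i => request R (n i)) (S := S)
    (encA := fun i q => val_of_request q) (encS := fun i s => val_of_state s)
    (inv := inv) szq _ _ Tqs T0).
  - by move=> i; rewrite /inv size_map.
  - by move=> i s q; apply: leq_trans; case: (size_serve (G i) s).
  bound1 Ts.
  pose J := {x : {i & (request R (n i) * S i)%type} | inv (tag x) (tagged x).2}.
  lift2 V.2 V2; lift2 TE TE2; lift2 Tc Tc2.
  apply: (task_serve (n := fun x : J => n (tag (sval x))) _ TE2 Tc2 _ Ts).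
    by split=> // x; exact: V.1.
  by move=> x; apply: leq_trans (szq _); exact: (svalP x).
have loopE i : foldl (step i) (s0 i) (qs i) = iter (size (qs i)) (serve (G i)) (s0 i).
  by elim: (qs i) (s0 i) => // q l IH s; rewrite [size _]/= iterSr -IH.
apply: (eq_task (g := fun i => val_of_seq (rev
    [seq Defs.Cons (Defs.Num x.1) (val_of_edge_set R x.2) |
       x <- (foldl (step i) (s0 i) (qs i)).2]))).
  by move=> i; rewrite loopE -map_rev.
apply: task_rev; last exact: (task_snd Tloop).
move=> i; apply: leq_trans (szq i); rewrite size_map loopE -size_rev.
exact: size_steiner_plan.
Qed.

End Plan.

Lemma val_size_edge_set (n : nat) (F : {set {set 'I_n}}) :
  val_size (val_of_edge_set R F) = (n * (2 * n + 2) + 1)%N.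
Proof.
have row (x : 'I_n) : val_size (val_of_seq
    [seq val_of_bool R ([set x; y]%SET \in F) | y <- enum 'I_n]) = (2 * n + 1)%N.
  rewrite val_size_seq big_map (eq_bigr (fun=> 2%N)) => [|y _]; last first.
    by rewrite /val_of_bool; case: ifP.
  by rewrite big_const_seq count_predT size_enum_ord iter_addn_0 addn1.
rewrite /val_of_edge_set /val_of_matrix val_size_seq big_map.
rewrite (eq_bigr (fun=> (2 * n + 2)%N)) => [|x _]; last by rewrite row -addnS.
by rewrite big_const_seq count_predT size_enum_ord iter_addn_0 mulnC addn1.
Qed.

Lemma steiner_plan_polynomial :
  polynomial_time (fun n (G : network R n) qs => steiner_plan G qs).
Proof.
have [c [p Hp]] := task_plan.
(* Beyond the running time [p], the polynomial covers the output: at most ['X] transmissions, each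
   with a matrix of size [2 * n * n + 2 * n + 1] and a few more cells, where [n * n] and [n] are at
   most ['X]. *)
exists (c 0%N), (p + 'X * (4%:P * 'X + 5%:P) + 1%:P) => n G qs _ v w.
pose i : instance := existT _ n (G, qs).
have [t [st [e r _ b]]] := Hp i 0%N (update (fun=> Defs.Nil) 0%N v) (update_eq _ _ _).
exists t; first by exists st.
have [nN qN] := instance_size i; pose N0 := val_size v.
have -> : (p + 'X * (4%:P * 'X + 5%:P) + 1%:P).[val_size v] =
    (p.[N0] + (N0 * (4 * N0 + 5) + 1))%N.
  by rewrite !hornerD !hornerM !hornerD !hornerM !hornerC !hornerX -addrA.
apply: leq_add b _; rewrite /w /val_of_schedule val_size_seq big_map.
rewrite addn1 ltnS.
apply: (@leq_trans (\sum_(x <- steiner_plan G qs) (4 * N0 + 5))%N).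
  apply: leq_sum => x _; rewrite /= val_size_edge_set.
  have nN0 : (n <= N0)%N by exact: (vertices_le instance_vertices i).
  by rewrite mulnDr mulnCA; move: nN nN0; rewrite -/N0 /=; set M := (n * n)%N; lia.
rewrite big_const_seq count_predT iter_addn_0 mulnC leq_mul2r.
by rewrite (leq_trans _ qN) ?orbT // size_steiner_plan.
Qed.

End OnlineTasks.

(** * The competitive ratio *)

(** This is [48 * p.+2] for [p = 2 * trunc_log 2 n + 5]. As [n] is below [2 ^ (trunc_log 2 n).+1],
    this [p] satisfies [8 * (n * n) <= 2 ^ p]. *)
Definition ratio (n : nat) : nat := 48 * (2 * trunc_log 2 n + 7).

Lemma ratio_competitive (R : realType) (n : nat) :
  competitive (fun n G qs => steiner_plan G qs) n ((ratio n)%:R : R).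
Proof.
move=> G qs valid [s0 s0_feas] s; have [_ /allP timely] := valid.
have sat : {in qs, forall q, satisfies (together q) (edges G)}.
  move=> q /(s0_feas.2)[t [F [tF _ /satisfies_connects]]].
  by apply: satisfiesS; exact: s0_feas.1 tF.
have sE : s = run G (size qs) (qs, init_level G).
  by rewrite /s online_run_steiner // steiner_planE.
have ratio_gt0 : 0 < (ratio n)%:R :> R by rewrite ltr0n muln_gt0 addnS.
split; first by rewrite sE; exact: orbit_feasible.
rewrite -ler_pdivrMl //; apply: lb_le_inf; first by exists (schedule_cost G s0), s0.
move=> _ [s' s'_feas <-]; rewrite ler_pdivrMl // mulr_natl sE.
have -> : ratio n = (48 * (2 * trunc_log 2 n + 5).+2)%N by rewrite /ratio !addnS.
apply: orbit_cost => //.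
rewrite (_ : (2 * trunc_log 2 n + 5 = 3 + 2 * (trunc_log 2 n).+1)%N); last first.
  by rewrite mulnS addnA addnC.
rewrite expnD leq_mul2l /= mulnC expnM -mulnn leq_mul // ltnW //;
  exact: trunc_log_ltn.
Qed.

Local Open Scope classical_set_scope.

Lemma ratio_bigO (R : realType) :
  (fun n => (ratio n)%:R : R) =O_\oo (fun n : nat => ln (n%:R : R)).
Proof.
have ln2 : 0 < ln (2 : R) by rewrite ln_gt0 // ltr1n.
apply/eqOP; near=> k; near=> n.
have n2 : (2 <= n)%N by near: n; exists 2%N.
have n0 : 0 < n%:R :> R by rewrite ltr0n (leq_trans _ n2).
have lnn0 : 0 <= ln (n%:R : R) by rewrite ln_ge0 // ler1n (leq_trans _ n2).
rewrite ger0_norm // ger0_norm //.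
have le1 : ln 2 <= ln (n%:R : R) by rewrite ler_ln ?posrE // ler_nat.
have le2 : (trunc_log 2 n)%:R * ln 2 <= ln (n%:R : R).
  rewrite mulr_natl -lnXn // ler_ln ?posrE ?exprn_gt0 // -natrX ler_nat.
  by rewrite trunc_logP // (leq_trans _ n2).
(* For [n >= 2] both [ln 2] and [trunc_log 2 n] times [ln 2] are at most [ln n], so the bracket in
   [ratio] is at most [(2 + 7) * ln n / ln 2]. *)
apply: (@le_trans _ _ (48 * 9 / ln 2 * ln n%:R)); last first.
  by apply: ler_wpM2r => //; near: k; apply: nbhs_pinfty_ge; exact: num_real.
rewrite mulrAC ler_pdivlMr // /ratio natrM natrD natrM.
move: le2; set t := (trunc_log 2 n)%:R.
by move: le1; clear => le1 le2; lra.
Unshelve. all: by end_near. Qed.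

Theorem theorem3p2 (R : realType) :
  exists (A : online_algorithm R) (alpha : nat -> R),
    [/\ polynomial_time A,
        alpha =O_\oo (fun n : nat => ln (n%:R : R)) &
        forall n : nat, competitive A n (alpha n)].
Proof.
exists (fun n G qs => steiner_plan G qs), (fun n => (ratio n)%:R).
split; [exact: steiner_plan_polynomial|exact: ratio_bigO|exact: ratio_competitive].
Qed.
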